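(* Let $(A,\Phi)$ be a finite-dimensional dual $\ell$CEDS and let $\mathcal{D}$ be a set. Consider the symmetric algebra $S(\mathfrak{g}_{A,\mathcal{D}})$ generated by $\mathfrak{g}_{A,\mathcal{D}}$, with its usual product $m$, and let $f\in A^*$. For any $A$-typed and $\mathcal{D}$-decorated forest $F$, put $$\Delta_f(F)=\sum_{c\in\mathrm{Adm}(F)}P^c(F)\otimes_{\Phi,f}R^c(F).$$ If $(f\otimes f)\circ\Phi=f\otimes f$, then $(S(\mathfrak{g}_{A,\mathcal{D}}),m,\Delta_f)$ is a Hopf algebra, denoted by $H_{\Phi,\mathcal{D},f}$. Moreover, if $(\mathcal{D},\times)$ is a commutative associative semigroup, then $H_{\Phi,\mathcal{D},f}$ is a Hopf algebra in the category of left $B_{\Phi,(\mathcal{D},\times)}$-comodules, with the coaction $\delta$.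
   Context: $\mathbb{K}$ is a field of characteristic zero and all vector spaces are over $\mathbb{K}$; $\tau$ is the flip of $A\otimes A$. A dual $\ell$CEDS is a pair $(A,\Phi)$ with $A$ a vector space and $\Phi:A\otimes A\to A\otimes A$ linear such that $(\mathrm{Id}\otimes\Phi)\circ(\Phi\otimes\mathrm{Id})\circ(\mathrm{Id}\otimes\Phi)=(\Phi\otimes\mathrm{Id})\circ(\mathrm{Id}\otimes\tau)\circ(\Phi\otimes\mathrm{Id})$ and $(\Phi\otimes\mathrm{Id})\circ(\tau\otimes\mathrm{Id})\circ(\mathrm{Id}\otimes\tau)\circ(\mathrm{Id}\otimes\Phi)=(\mathrm{Id}\otimes\tau)\circ(\mathrm{Id}\otimes\Phi)\circ(\Phi\otimes\mathrm{Id})\circ(\tau\otimes\mathrm{Id})$. An $A$-typed and $\mathcal{D}$-decorated rooted tree is a (non-planar) rooted tree whose vertices are decorated by elements of $\mathcal{D}$ and whose edges are typed by elements of $A$; $\mathfrak{g}_{A,\mathcal{D}}$ is the vector space generated by them, trees being linear in the type of each edge. A forest is a commutative product of such trees, i.e. a monomial of $S(\mathfrak{g}_{A,\mathcal{D}})$; $E(F)$ is its set of edges. The first extremity of an edge is the one closest to the root. Admissible cuts (as in Connes–Kreimer). For a tree $T$, an admissible cut $c$ is either a (possibly empty) set of edges such that any path from the root to a leaf meets at most one edge of $c$, or the total cut. If $c$ is a set of edges, deleting them gives a forest, $R^c(T)$ is the component containing the root and $P^c(T)$ is the product of the other components; for the total cut, $P^c(T)=T$ and $R^c(T)=1$. For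 a forest, an admissible cut is the choice of an admissible cut of each of its trees, $P^c$ and $R^c$ being multiplicative. $\mathrm{Adm}(F)$ is the set of admissible cuts of $F$. $P^c(F)\otimes_{\Phi,f}R^c(F)$ is the sum of tensors of typed decorated forests obtained from $P^c(F)\otimes R^c(F)$ as follows. For each cut edge $e\in c$ (treated successively; the result does not depend on the order), let $e_1,\ldots,e_k$ be the edges in the path from the root of the tree containing $e$ to the first extremity of $e$, listed starting from the root, $a$ the type of $e$ and $a_i$ the (current) type of $e_i$. Compute $$\sum_{i=1}^p a'_{1,i}\otimes\ldots\otimes a'_{k,i}=(f\otimes\mathrm{Id}^{\otimes k})\circ\left(\Phi\otimes\mathrm{Id}^{\otimes(k-1)}\right)\circ\left(\mathrm{Id}\otimes\Phi\otimes\mathrm{Id}^{\otimes(k-2)}\right)\circ\ldots\circ\left(\mathrm{Id}^{\otimes(k-1)}\otimes\Phi\right)(a_1\otimes\ldots\otimes a_k\otimes a)$$ and take the sum over $i$ of the tensors obtained by typing $e_j$ by $a'_{j,i}$ for each $j$. (If $k=0$, one multiplies by the scalar $f(a)$.) Bialgebra $B_{\Phi,(\mathcal{D},\times)}$, for $(\mathcal{D},\times)$ a commutative associative semigroup: it is $(S(\mathfrak{g}_{A,\mathcal{D}}),m,\delta)$ with $\delta(F)=\sum_{I\subseteq E(F)}F_{\mid I}\otimes_\Phi F_{/I}$. Here $F_{\mid I}$ is obtained by deleting the edges not in $I$; $F_{/I}$ is obtained by contracting the edges in $I$, each vertex of $F_{/I}$, being the contraction of a subtree of $F$, is decorated by the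 product in $\mathcal{D}$ of the decorations of the vertices of this subtree; and $F_{\mid I}\otimes_\Phi F_{/I}$ is obtained from $F_{\mid I}\otimes F_{/I}$ as follows: for each edge $e\notin I$ (successively, in any order), with $e_1,\ldots,e_k$ the edges belonging to $I$ in the path from the root of the tree containing $e$ to the first extremity of $e$ (listed from the root), $a$ the type of $e$ and $a_i$ the (current) type of $e_i$, compute $\sum_i a'_i\otimes a'_{1,i}\otimes\ldots\otimes a'_{k,i}=\left(\Phi\otimes\mathrm{Id}^{\otimes(k-1)}\right)\circ\ldots\circ\left(\mathrm{Id}^{\otimes(k-1)}\otimes\Phi\right)(a_1\otimes\ldots\otimes a_k\otimes a)$ and sum over $i$ the tensors obtained by typing $e$ by $a'_i$ and $e_j$ by $a'_{j,i}$. The last assertion means that, $H_{\Phi,\mathcal{D},f}$ being a left comodule by $\delta:H_{\Phi,\mathcal{D},f}\to B_{\Phi,(\mathcal{D},\times)}\otimes H_{\Phi,\mathcal{D},f}$, all the structure maps of the Hopf algebra $H_{\Phi,\mathcal{D},f}$ are comodule morphisms; in particular $(\mathrm{Id}\otimes\Delta_f)\circ\delta=m_{1,3,24}\circ(\delta\otimes\delta)\circ\Delta_f$, where $m_{1,3,24}(b_1\otimes h_1\otimes b_2\otimes h_2)=b_1b_2\otimes h_1\otimes h_2$.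
   Formalization: In δ, e_1,…,e_k are only the edges of I joining e to the root of its tree in F restricted to I∪{e}; edges of I separated from e by another edge outside I are not used, since with all edges of I on the path in F, δ is not coassociative. *)

(* Defs.v *)
From HB Require Import structures.
From mathcomp Require Import all_boot all_order all_algebra.
From mathcomp Require Import generic_quotient ring_quotient.
From mathcomp Require Import finmap monalg.
From mathcomp Require Import boolp.

Set Implicit Arguments.
Unset Strict Implicit.
Unset Printing Implicit Defensive.

Import GRing.Theory.
Local Open Scope ring_scope.
Local Open Scope quotient_scope.

Section QuotientModule.
Variables (K : fieldType) (V : lmodType K) (S : V -> Prop).

Inductive spanned : V -> Prop :=
| spanned0 : spanned 0
| spannedD a u v : S u -> spanned v -> spanned (a *: u + v).

Definition span_pred : {pred V} := fun v => `[< spanned v >].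

Lemma spanned_add u v : spanned u -> spanned v -> spanned (u + v).
Proof.
elim=> [|a x y Sx _ IH] Sv; first by rewrite add0r.
by rewrite -addrA; apply: spannedD => //; apply: IH.
Qed.

Lemma spanned_scale a u : spanned u -> spanned (a *: u).
Proof.
elim=> [|b x y Sx _ IH]; first by rewrite scaler0; apply: spanned0.
by rewrite scalerDr scalerA; apply: spannedD.
Qed.

Lemma span_pred_closed : zmod_closed span_pred.
Proof.
split=> [|u v /asboolP Su /asboolP Sv]; apply/asboolP; first exact: spanned0.
by apply: spanned_add => //; rewrite -scaleN1r; apply: spanned_scale.
Qed.

HB.instance Definition _ := GRing.isZmodClosed.Build V span_pred span_pred_closed.

Definition quotmod : Type := (Quotient.quot span_pred).
HB.instance Definition _ := GRing.Zmodule.on quotmod.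

Definition qclass (v : V) : quotmod := \pi_(Quotient.quot span_pred) v.
Definition qrepr (x : quotmod) : V := repr (x : (Quotient.quot span_pred)).

Lemma qreprK : cancel qrepr qclass.
Proof. by move=> x; apply: reprK. Qed.

Lemma qclass_eq u v : qclass u = qclass v <-> spanned (u - v).
Proof.
split=> [/eqP|h]; first by rewrite -Quotient.idealrBE => /asboolP.
by apply/eqP; rewrite -Quotient.idealrBE; apply/asboolP.
Qed.

Lemma qclassD u v : qclass (u + v) = qclass u + qclass v.
Proof. exact: (@pi_addr _ _ _ _ _ (Quotient.quot span_pred)). Qed.

Definition qscale (a : K) (x : quotmod) : quotmod := qclass (a *: qrepr x).

Lemma qscaleE a v : qscale a (qclass v) = qclass (a *: v).
Proof.
apply/qclass_eq; rewrite -scalerBr; apply: spanned_scale.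
by apply/qclass_eq; rewrite qreprK.
Qed.

Lemma qscaleA a b x : qscale a (qscale b x) = qscale (a * b) x.
Proof. by rewrite -[x]qreprK !qscaleE scalerA. Qed.

Lemma qscale1 : left_id 1 qscale.
Proof. by move=> x; rewrite -[x]qreprK qscaleE scale1r. Qed.

Lemma qscaleDr : right_distributive qscale +%R.
Proof.
move=> a x y; rewrite -[x]qreprK -[y]qreprK -qclassD !qscaleE.
by rewrite -qclassD scalerDr.
Qed.

Lemma qscaleDl x : {morph qscale^~ x : a b / a + b}.
Proof. by move=> a b; rewrite -[x]qreprK !qscaleE -qclassD scalerDl. Qed.

HB.instance Definition _ :=
  GRing.Zmodule_isLmodule.Build K quotmod qscaleA qscale1 qscaleDr qscaleDl.

End QuotientModule.

Section Tensor.
Variables (K : fieldType) (U V : lmodType K).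

Inductive tensor_rel : {malg K[(U * V)%type]} -> Prop :=
| tensor_rell a u u' v :
    tensor_rel (<< (a *: u + u', v) >> - a *: << (u, v) >> - << (u', v) >>)
| tensor_relr a u v v' :
    tensor_rel (<< (u, a *: v + v') >> - a *: << (u, v) >> - << (u, v') >>).

Definition tensor : Type := quotmod tensor_rel.
HB.instance Definition _ := GRing.Lmodule.on tensor.

End Tensor.

Arguments tensor {K} (U V)%_type.

HB.lock Definition tens (K : fieldType) (U V : lmodType K) (u : U) (v : V) :
  tensor U V := qclass (@tensor_rel K U V) << (u, v) >>.

(* [tlift b] maps \sum_i u_i ⊗ v_i to \sum_i b u_i v_i. It is defined through a
   representative, hence it is meaningful only when b is bilinear. *)
HB.lock Definition tlift (K : fieldType) (U V W : lmodType K)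
    (b : U -> V -> W) (z : tensor U V) : W :=
  \sum_(x <- msupp (qrepr z)) (qrepr z)@_x *: b x.1 x.2.

Notation "U ⊗ V" := (tensor U V) (at level 40, left associativity) : type_scope.
Notation "u ⊗ v" := (tens u v) (at level 40, left associativity) : ring_scope.

Section TensorMaps.
Variable K : fieldType.
Implicit Types U V W : lmodType K.

Definition tmap U V U' V' (g : U -> U') (h : V -> V') : (U ⊗ V) -> (U' ⊗ V') :=
  tlift (fun u v => g u ⊗ h v).

Definition tflip U V : (U ⊗ V) -> (V ⊗ U) := tlift (fun u v => v ⊗ u).

Definition tassoc U V W : ((U ⊗ V) ⊗ W) -> (U ⊗ (V ⊗ W)) :=
  tlift (fun z w => tlift (fun u v => u ⊗ (v ⊗ w)) z).

Definition tassocV U V W : (U ⊗ (V ⊗ W)) -> ((U ⊗ V) ⊗ W) :=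
  tlift (fun u z => tlift (fun v w => (u ⊗ v) ⊗ w) z).

Definition tform U V (g : U -> K) (h : V -> K) : (U ⊗ V) -> K^o :=
  tlift (fun u v => g u * h v : K^o).

Definition tscalel U V (g : U -> K) : (U ⊗ V) -> V := tlift (fun u v => g u *: v).

Definition tscaler U V (g : V -> K) : (U ⊗ V) -> U := tlift (fun u v => g v *: u).

(* g ⊗ Id and Id ⊗ h on the right-bracketed triple product. *)
Definition op12 U V U' V' W (g : (U ⊗ V) -> (U' ⊗ V')) :
    (U ⊗ (V ⊗ W)) -> (U' ⊗ (V' ⊗ W)) :=
  fun z => tassoc (tmap g id (tassocV z)).

Definition op23 U V W V' W' (h : (V ⊗ W) -> (V' ⊗ W')) :
    (U ⊗ (V ⊗ W)) -> (U ⊗ (V' ⊗ W')) := tmap id h.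

End TensorMaps.

(* Symmetric algebra: polynomials with one variable per vector, modulo the ideal
   making the variables linear in the vector. *)

Section SymmetricAlgebra.
Variables (K : fieldType) (V : lmodType K).

Local Notation spoly := {malg K[{cmonom V}]}.
Definition svar (v : V) : spoly := << ucm v >>.

Inductive sym_ideal : spoly -> Prop :=
| sym_ideal0 : sym_ideal 0
| sym_idealD p q a u v : sym_ideal q ->
    sym_ideal (p * (svar (a *: u + v) - a *: svar u - svar v) + q).

Definition sym_pred : {pred spoly} := fun p => `[< sym_ideal p >].

Lemma sym_ideal_add p q : sym_ideal p -> sym_ideal q -> sym_ideal (p + q).
Proof.
elim=> [|p' q' a u v _ IH] Sq; first by rewrite add0r.
by rewrite -addrA; apply: sym_idealD; apply: IH.
Qed.

Lemma sym_ideal_mul p q : sym_ideal q -> sym_ideal (p * q).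
Proof.
elim=> [|p' q' a u v _ IH]; first by rewrite mulr0; apply: sym_ideal0.
by rewrite mulrDr mulrA; apply: sym_idealD.
Qed.

Lemma svar_coef1 v : (svar v)@_(@mone {cmonom V}) = 0.
Proof. by rewrite mcoeffU -mdeg_eq0 mdegU. Qed.

Lemma sym_ideal_coef1 p : sym_ideal p -> p@_(@mone {cmonom V}) = 0.
Proof.
elim=> [|p' q' a u v _ IH]; first by rewrite mcoeff0.
rewrite mcoeffD IH addr0 (@mcoeff1g_is_multiplicative _ K).1.
move: (svar _) (svar u) (svar v) (svar_coef1 (a *: u + v)) (svar_coef1 u)
  (svar_coef1 v) => x y z x0 y0 z0.
by rewrite 2!mcoeffB mcoeffZ x0 y0 z0 mulr0 !subr0 mulr0.
Qed.

Lemma sym_pred_closed : idealr_closed sym_pred.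
Proof.
split.
- exact/asboolP/sym_ideal0.
- apply/negP=> /asboolP /sym_ideal_coef1; rewrite mcoeff1 eqxx => /eqP.
  by rewrite oner_eq0.
- move=> p q r /asboolP Sq /asboolP Sr; apply/asboolP.
  by apply: sym_ideal_add => //; apply: sym_ideal_mul.
Qed.

HB.instance Definition _ := isIdealr.Build spoly sym_pred sym_pred_closed.

Definition Sym : Type := (Quotient.quot sym_pred).
HB.instance Definition _ := GRing.ComNzRing.on Sym.

Definition sclass (p : spoly) : Sym := \pi_(Quotient.quot sym_pred) p.
Definition srepr (x : Sym) : spoly := repr (x : (Quotient.quot sym_pred)).

Lemma sreprK : cancel srepr sclass.
Proof. by move=> x; apply: reprK. Qed.

Lemma sclass_eq p q : sclass p = sclass q <-> sym_ideal (p - q).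
Proof.
split=> [/eqP|h]; first by rewrite -Quotient.idealrBE => /asboolP.
by apply/eqP; rewrite -Quotient.idealrBE; apply/asboolP.
Qed.

Lemma sclassD p q : sclass (p + q) = sclass p + sclass q.
Proof. exact: (@pi_addr _ _ _ _ _ (Quotient.quot sym_pred)). Qed.

Lemma sclassM p q : sclass (p * q) = sclass p * sclass q.
Proof. exact: (@pi_mulr _ _ _ _ _ _ _ (Quotient.quot sym_pred)). Qed.

Definition sscale (a : K) (x : Sym) : Sym := sclass (a *: srepr x).

Lemma sscaleE a p : sscale a (sclass p) = sclass (a *: p).
Proof.
apply/sclass_eq; rewrite -scalerBr -mulr_algl; apply: sym_ideal_mul.
by apply/sclass_eq; rewrite sreprK.
Qed.

Lemma sscaleA a b x : sscale a (sscale b x) = sscale (a * b) x.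
Proof. by rewrite -[x]sreprK !sscaleE scalerA. Qed.

Lemma sscale1 : left_id 1 sscale.
Proof. by move=> x; rewrite -[x]sreprK sscaleE scale1r. Qed.

Lemma sscaleDr : right_distributive sscale +%R.
Proof.
move=> a x y; rewrite -[x]sreprK -[y]sreprK -sclassD !sscaleE.
by rewrite -sclassD scalerDr.
Qed.

Lemma sscaleDl x : {morph sscale^~ x : a b / a + b}.
Proof. by move=> a b; rewrite -[x]sreprK !sscaleE -sclassD scalerDl. Qed.

HB.instance Definition _ :=
  GRing.Zmodule_isLmodule.Build K Sym sscaleA sscale1 sscaleDr sscaleDl.

Lemma sscaleAl (a : K) (x y : Sym) : a *: (x * y) = a *: x * y.
Proof.
rewrite -[x]sreprK -[y]sreprK -sclassM.
by rewrite [LHS]sscaleE [X in _ = X * _]sscaleE -sclassM scalerAl.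
Qed.

HB.instance Definition _ := GRing.Lmodule_isLalgebra.Build K Sym sscaleAl.
HB.instance Definition _ := GRing.Lalgebra_isComAlgebra.Build K Sym.

End SymmetricAlgebra.

HB.lock Definition sgen (K : fieldType) (V : lmodType K) (v : V) : Sym V :=
  sclass (svar v).

Inductive tree (D L : Type) := Node of D & seq (L * tree D L).

HB.instance Definition _ (D L : Type) := gen_eqMixin (tree D L).
HB.instance Definition _ (D L : Type) := gen_choiceMixin (tree D L).

Section Trees.
Variable D : Type.

Definition root_dec L (t : tree D L) : D := let: Node d _ := t in d.
Definition children L (t : tree D L) := let: Node _ l := t in l.

Fixpoint relabel L L' (g : L -> L') (t : tree D L) : tree D L' :=
  let: Node d l := t in Node d [seq (g x.1, relabel g x.2) | x <- l].

Fixpoint labels L (t : tree D L) : seq L :=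
  let: Node _ l := t in flatten [seq x.1 :: labels x.2 | x <- l].

Definition flabels L (F : seq (tree D L)) : seq L := flatten [seq labels t | t <- F].

(* One exchange of two neighbouring siblings, anywhere in the tree. *)
Inductive sibling_swap L : tree D L -> tree D L -> Prop :=
| swap_here d l1 x y l2 :
    sibling_swap (Node d (l1 ++ x :: y :: l2)) (Node d (l1 ++ y :: x :: l2))
| swap_below d l1 a t t' l2 : sibling_swap t t' ->
    sibling_swap (Node d (l1 ++ (a, t) :: l2)) (Node d (l1 ++ (a, t') :: l2)).

Section NamedEdges.
Variable E : eqType.
Implicit Types (t : tree D E) (F : seq (tree D E)).

(* Edges met on each path from the root to a leaf, listed from the root. *)
Fixpoint leaf_paths t : seq (seq E) :=
  let: Node _ l := t in
  if l is [::] then [:: [::]]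
  else flatten [seq [seq x.1 :: p | p <- leaf_paths x.2] | x <- l].

(* Edges between the root and the first extremity of e, listed from the root. *)
Fixpoint path_to (e : E) t : seq E :=
  let: Node _ l := t in
  flatten [seq if e \in labels x.2 then x.1 :: path_to e x.2 else [::] | x <- l].

Definition fpath_to e F : seq E := flatten [seq path_to e t | t <- F].

(* Deletion of edges: the component of the root and the other components. *)
Fixpoint delete_edges (c : pred E) t : tree D E * seq (tree D E) :=
  let: Node d l := t in
  let r := [seq (x.1, delete_edges c x.2) | x <- l] in
  (Node d [seq (y.1, y.2.1) | y <- r & ~~ c y.1],
   flatten [seq if c y.1 then y.2.1 :: y.2.2 else y.2.2 | y <- r]).

Fixpoint contract_edges (times : D -> D -> D) (I : pred E) t : tree D E :=
  let: Node d l := t in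
  let r := [seq (x.1, contract_edges times I x.2) | x <- l] in
  Node (foldl times d [seq root_dec y.2 | y <- r & I y.1])
       (flatten [seq if I y.1 then children y.2 else [:: y] | y <- r]).

(* A cut of F is encoded by a pair (b, c): the j-th entry of b tells whether the
   j-th tree gets the total cut, and c is the set of cut edges, which all lie in
   the other trees. *)
Definition admissible F (b : seq bool) (c : pred E) : bool :=
  all (fun x => if x.1 then ~~ has c (labels x.2)
                else all (fun p => (count c p <= 1)%N) (leaf_paths x.2))
      (zip b F).

Definition cutP F (b : seq bool) (c : pred E) : seq (tree D E) :=
  flatten [seq if x.1 then [:: x.2] else (delete_edges c x.2).2 | x <- zip b F].

Definition cutR F (b : seq bool) (c : pred E) : seq (tree D E) :=
  flatten [seq if x.1 then [::] else [:: (delete_edges c x.2).1] | x <- zip b F].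

Definition restrict F (I : pred E) : seq (tree D E) :=
  flatten [seq let: (r, s) := delete_edges (predC I) t in r :: s | t <- F].

Definition contract times F (I : pred E) : seq (tree D E) :=
  [seq contract_edges times I t | t <- F].

End NamedEdges.
End Trees.

(* The vector space spanned by A-typed D-decorated rooted trees. Multilinearity
   is stated on a tree s whose edges have distinct names, with types ty. *)

Section TypedTrees.
Variables (K : fieldType) (A : lmodType K) (D : Type).

Definition set_type (E : eqType) (ty : E -> A) (e : E) (a : A) : E -> A :=
  fun x => if x == e then a else ty x.

Inductive tree_rel : {malg K[tree D A]} -> Prop :=
| tree_rel_swap t t' : sibling_swap t t' -> tree_rel (<< t >> - << t' >>)
| tree_rel_lin (s : tree D nat) (ty : nat -> A) (e : nat) (k : K) (a b : A) :
    uniq (labels s) -> e \in labels s ->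
    tree_rel (<< relabel (set_type ty e (k *: a + b)) s >>
              - k *: << relabel (set_type ty e a) s >>
              - << relabel (set_type ty e b) s >>).

Definition gtrees : Type := quotmod tree_rel.
HB.instance Definition _ := GRing.Lmodule.on gtrees.

Definition SgAD : comAlgType K := Sym gtrees.

End TypedTrees.

HB.lock Definition tree_class (K : fieldType) (A : lmodType K) (D : Type)
  (t : tree D A) : gtrees A D := qclass (@tree_rel K A D) << t >>.

(* The forest with edges named by E and typed by ty, as a monomial. *)
Definition forest_of (K : fieldType) (A : lmodType K) (D E : Type)
    (F : seq (tree D E)) (ty : E -> A) : SgAD A D :=
  \prod_(t <- F) sgen (tree_class (relabel ty t)).

Section DualCEDS.
Variables (K : fieldType) (A : lmodType K) (Phi : (A ⊗ A) -> (A ⊗ A)).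

Definition dual_lCEDS : Prop :=
  (op23 Phi \o op12 Phi \o op23 Phi
     =1 op12 Phi \o op23 (@tflip K A A) \o op12 Phi :> (A ⊗ (A ⊗ A) -> _)) /\
  (op12 Phi \o op12 (@tflip K A A) \o op23 (@tflip K A A) \o op23 Phi
     =1 op23 (@tflip K A A) \o op23 Phi \o op12 Phi \o op12 (@tflip K A A)
     :> (A ⊗ (A ⊗ A) -> _)).

Fixpoint tpow (n : nat) : lmodType K := 
  if n is m.+1 then tensor A (tpow m) else K^o.

(* a_1 ⊗ ... ⊗ a_k ⊗ a *)
Fixpoint tpure (l : seq A) (a : A) : tpow (size l).+1 :=
  if l is a1 :: l' then a1 ⊗ tpure l' a else a ⊗ (1 : K^o).

(* [tsum g z] is \sum_i g [:: a_{1,i}; ...; a_{n,i}] for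
   z = \sum_i a_{1,i} ⊗ ... ⊗ a_{n,i} and g multilinear. *)
Fixpoint tsum (W : lmodType K) (n : nat) : (seq A -> W) -> tpow n -> W :=
  match n with
  | 0 => fun g k => (k : K) *: g [::]
  | m.+1 => fun g => tlift (fun a (z : tpow m) => tsum (fun l => g (a :: l)) z)
  end.

(* (Phi ⊗ Id) o (Id ⊗ Phi ⊗ Id) o ... o (Id ⊗ ... ⊗ Id ⊗ Phi), with k factors. *)
Fixpoint Phi_chain (k : nat) : tpow k.+1 -> tpow k.+1 :=
  if k is m.+1 then fun z => op12 Phi (tmap id (@Phi_chain m) z) else id.

Section Retyping.
Variables (D : Type) (E : finType) (F : seq (tree D E)).

Definition retype (ty : E -> A) (s : seq E) (l : seq A) : E -> A :=
  fun x => if x \in s then nth 0 l (index x s) else ty x.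

(* Treatment of one cut edge; g is what remains to be done with the new types. *)
Definition cut_step (W : lmodType K) (f : A -> K)
    (e : E) (g : (E -> A) -> W) (ty : E -> A) : W :=
  let s := fpath_to e F in
  tsum (fun l => g (retype ty s l))
       (tscalel f (Phi_chain (tpure [seq ty x | x <- s] (ty e)))).

(* P^c(F) ⊗_{Phi,f} R^c(F). *)
Definition cut_tensor (f : A -> K) (b : seq bool) (c : {set E}) (ty : E -> A) :
    SgAD A D ⊗ SgAD A D :=
  foldr (cut_step f)
    (fun ty' => forest_of (cutP F b (mem c)) ty' ⊗ forest_of (cutR F b (mem c)) ty')
    (enum c) ty.

(* Treatment of one edge e outside I. The path starts from the root of the tree
   containing e once the other edges outside I are deleted, so that it consists of
   the edges of I joining that root to the first extremity of e. An edge of I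
   separated from e by another edge outside I does not take part: with such edges
   the coproduct below would not be coassociative. *)
Definition contract_step (W : lmodType K) (I : {set E})
    (e : E) (g : (E -> A) -> W) (ty : E -> A) : W :=
  let s := fpath_to e (restrict F (mem (e |: I))) in
  tsum (fun l => g (retype ty (e :: s) l))
       (Phi_chain (tpure [seq ty x | x <- s] (ty e))).

(* F_{|I} ⊗_Phi F_{/I}. *)
Definition contract_tensor (times : D -> D -> D) (I : {set E}) (ty : E -> A) :
    SgAD A D ⊗ SgAD A D :=
  foldr (contract_step I)
    (fun ty' => forest_of (restrict F (mem I)) ty'
                  ⊗ forest_of (contract times F (mem I)) ty')
    (enum (~: I)) ty.

End Retyping.

(* A typed decorated forest is given by a forest F whose edges are in bijection
   with a finite type E, together with the types ty : E -> A of its edges. As E is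
   arbitrary, so is the order in which [enum] lists the edges to be treated. *)
Definition is_cut_coproduct (D : Type) (f : A -> K)
    (Delta : SgAD A D -> SgAD A D ⊗ SgAD A D) : Prop :=
  forall (E : finType) (F : seq (tree D E)) (ty : E -> A),
    perm_eq (flabels F) (enum E) ->
    Delta (forest_of F ty) =
      \sum_(b : (size F).-tuple bool)
        \sum_(c : {set E} | admissible F b (mem c)) cut_tensor F f b c ty.

Definition is_contraction_coproduct (D : Type) (times : D -> D -> D)
    (delta : SgAD A D -> SgAD A D ⊗ SgAD A D) : Prop :=
  forall (E : finType) (F : seq (tree D E)) (ty : E -> A),
    perm_eq (flabels F) (enum E) ->
    delta (forest_of F ty) = \sum_(I : {set E}) contract_tensor F times I ty.

End DualCEDS.

Section Bialgebras.
Variable K : fieldType.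

Definition tmul (B H : algType K) (z z' : B ⊗ H) : B ⊗ H :=
  tlift (fun x y => tlift (fun x' y' => (x * x') ⊗ (y * y')) z') z.

Definition mult (H : algType K) : (H ⊗ H) -> H := tlift (fun x y => x * y).

Definition is_coalgebra (C : lmodType K) (Delta : C -> C ⊗ C) (eps : C -> K) : Prop :=
  [/\ forall x, tassoc (tmap Delta id (Delta x)) = tmap id Delta (Delta x),
      forall x, tscalel eps (Delta x) = x
    & forall x, tscaler eps (Delta x) = x].

Definition is_bialgebra (H : algType K) (Delta : H -> H ⊗ H) (eps : H -> K) : Prop :=
  [/\ is_coalgebra Delta eps,
      (forall x y, Delta (x * y) = tmul (Delta x) (Delta y)) /\ Delta 1 = 1 ⊗ 1
    & (forall x y, eps (x * y) = eps x * eps y) /\ eps 1 = 1].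

Definition is_hopf_algebra (H : algType K)
    (Delta : H -> H ⊗ H) (eps : H -> K) (S : H -> H) : Prop :=
  [/\ is_bialgebra Delta eps,
      forall x, mult (tmap S id (Delta x)) = eps x *: 1
    & forall x, mult (tmap id S (Delta x)) = eps x *: 1].

Definition is_left_comodule (C V : lmodType K)
    (Delta : C -> C ⊗ C) (eps : C -> K) (rho : V -> C ⊗ V) : Prop :=
  (forall v, tassoc (tmap Delta id (rho v)) = tmap id rho (rho v)) /\
  (forall v, tscalel eps (rho v) = v).

Definition comodule_morphism (C V W : lmodType K)
    (rhoV : V -> C ⊗ V) (rhoW : W -> C ⊗ W) (g : V -> W) : Prop :=
  forall v, rhoW (g v) = tmap id g (rhoV v).

Definition m1_3_24 (B : algType K) (V W : lmodType K) :
    ((B ⊗ V) ⊗ (B ⊗ W)) -> B ⊗ (V ⊗ W) :=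
  tlift (fun x y =>
    tlift (fun b v => tlift (fun b' w => (b * b') ⊗ (v ⊗ w)) y) x).

Definition tensor_coaction (B : algType K) (V W : lmodType K)
    (rhoV : V -> B ⊗ V) (rhoW : W -> B ⊗ W) : V ⊗ W -> B ⊗ (V ⊗ W) :=
  fun z => m1_3_24 (tmap rhoV rhoW z).

Definition unit_coaction (B : algType K) : K^o -> B ⊗ K^o := fun k => 1 ⊗ k.

(* (H, Delta, eps, S) is a Hopf algebra in the category of left comodules over
   the commutative bialgebra (B, deltaB, epsB), with the coaction rho. *)
Definition is_comodule_hopf_algebra (B : comAlgType K)
    (deltaB : B -> B ⊗ B) (epsB : B -> K) (H : algType K)
    (Delta : H -> H ⊗ H) (eps : H -> K) (S : H -> H) (rho : H -> B ⊗ H) : Prop :=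
  [/\ is_bialgebra deltaB epsB, is_hopf_algebra Delta eps S
    & is_left_comodule deltaB epsB rho] /\
  [/\ comodule_morphism (tensor_coaction rho rho) rho (@mult H),
      comodule_morphism (@unit_coaction B) rho (fun k : K^o => (k : K) *: (1 : H)),
      comodule_morphism rho (tensor_coaction rho rho) Delta,
      comodule_morphism rho (@unit_coaction B) (eps : H -> K^o)
    & comodule_morphism rho rho S].

End Bialgebras.

(* Main.v *)
(** Fix a basis of [A]. A character of the symmetric algebra with values in a
    commutative algebra [R] is then a function [u : tree D iota -> R] of the trees
    whose edges are typed by basis vectors, and [Phi] becomes a tensor [phi] which
    exchanges two neighbouring types. A planted forest is treated by recursion:
    letting a type pass through the root edges of the forest below it ([pass])
    realises the chains of [Phi], and the two axioms of a dual lCEDS say that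
    exchanges commute and satisfy a pentagon identity. Hence contracting [J] and
    then [I \ J] amounts to contracting [I], with the types carried along
    ([expand_coassoc]). This single identity implies that the product of characters
    [star] given by contractions is associative, that the product [conv] given by
    cuts is associative (a cut is a contraction whose other components have no
    edge), and that [star] is left distributive over [conv]. Applied to the
    tautological characters with values in tensor powers of the symmetric algebra,
    these are the coassociativity of both coproducts and the comodule
    compatibilities. The inverse of [u] for [conv] is
    [star (fun t => - u t) label_eval], where [label_eval] multiplies the values of
    the form [f] on all the types.

    The sums over sets of edges are compared with the recursion by naming the
    edges: treating the cut edges successively is a sequence of exchanges indexed
    by pairs of edges, and such a sequence depends only, for each cut edge, on the
    order of its own exchanges. *)

Require Import Defs.
From HB Require Import structures.
From mathcomp Require Import all_boot all_order all_algebra.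
From mathcomp Require Import generic_quotient ring_quotient.
From mathcomp Require Import finmap monalg.
From mathcomp Require Import ring zify.
From mathcomp Require Import boolp.

Set Implicit Arguments.
Unset Strict Implicit.
Unset Printing Implicit Defensive.

Import GRing.Theory.
Local Open Scope ring_scope.

(** * Linear maps out of quotients and tensor products *)

(** The obstacle is the form of [cut_tensor] and [contract_tensor]: they treat the edges of a named
    forest in the order of [enum], which is unsuited to iterating a coproduct. They are compared
    once with recursive sums; every algebraic identity is proved for functions of basis-typed trees
    with values in any commutative algebra. Such a function defines a character as soon as it is
    invariant under swaps of siblings, and naturality in the algebra makes it enough to know the
    product of the two inclusions of the symmetric algebra in its tensor square. The unit of [conv]
    is the zero function, because the counit kills trees; the unit of [star] is [edgeless]. The
    antipode comes from distributivity: [u] is the [star] product of [- u] and [- edgeless], so that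
    inverting the single character [- edgeless] suffices, and [label_eval] inverts it. This formula
    takes a product on [D] even where none is given: an auxiliary one is chosen, and uniqueness of
    inverses makes the antipode compatible with the coaction for every product. *)

Section LinearExtension.
Variable K : fieldType.

Definition lin_pack (U W : lmodType K) (g : U -> W) (lg : linear g) :
    {linear U -> W} :=
  HB.pack g (GRing.isLinear.Build K U W *:%R g lg).

Lemma lin0 (U W : lmodType K) (g : U -> W) : linear g -> g 0 = 0.
Proof. by move=> lg; apply: (linear0 (lin_pack lg)). Qed.

Lemma linD (U W : lmodType K) (g : U -> W) :
  linear g -> {morph g : x y / x + y}.
Proof. by move=> lg; apply: (linearD (lin_pack lg)). Qed.

Lemma linZ (U W : lmodType K) (g : U -> W) :
  linear g -> forall a, {morph g : x / a *: x}.
Proof. by move=> lg a x; rewrite -[a *: x]addr0 lg (lin0 lg) addr0. Qed.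

Lemma linB (U W : lmodType K) (g : U -> W) :
  linear g -> {morph g : x y / x - y}.
Proof. by move=> lg; apply: (linearB (lin_pack lg)). Qed.

Lemma lin_sum (U W : lmodType K) (g : U -> W) I (r : seq I) (P : pred I) F :
  linear g -> g (\sum_(i <- r | P i) F i) = \sum_(i <- r | P i) g (F i).
Proof. by move=> lg; apply: (linear_sum (lin_pack lg)). Qed.

Lemma linear_comp (U V W : lmodType K) (g : V -> W) (h : U -> V) :
  linear g -> linear h -> linear (g \o h).
Proof. by move=> lg lh a u v /=; rewrite lh lg. Qed.

Lemma linear_id (U : lmodType K) : linear (@id U).
Proof. by []. Qed.

Definition mlift (T : choiceType) (W : lmodType K) (phi : T -> W)
    (p : {malg K[T]}) : W := \sum_(x <- msupp p) p@_x *: phi x.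

(** Coefficients vanish outside the support, so the sum may run over any larger finite set; sums for
    several elements can then be compared over a common one. *)
Lemma mlift_Ew (T : choiceType) (W : lmodType K) (phi : T -> W)
    (d : {fset T}) (p : {malg K[T]}) : (msupp p `<=` d)%fset ->
  mlift phi p = \sum_(x <- d) p@_x *: phi x.
Proof.
move=> le; rewrite [LHS](big_fset_incl _ le) //= => x xd /mcoeff_outdom ->.
by rewrite scale0r.
Qed.

Lemma mlift_linear (T : choiceType) (W : lmodType K) (phi : T -> W) :
  linear (mlift phi).
Proof.
move=> a p q; set d := (msupp p `|` msupp q)%fset.
have dp : (msupp p `<=` d)%fset by apply: fsubsetUl.
have dq : (msupp q `<=` d)%fset by apply: fsubsetUr.
have dr : (msupp (a *: p + q) `<=` d)%fset.
  apply: fsubset_trans (msuppD_le _ _) _.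
  by apply/fsetSU/msuppZ_le.
rewrite (mlift_Ew _ dp) (mlift_Ew _ dq) (mlift_Ew _ dr) scaler_sumr -big_split.
by apply: eq_bigr => x _; rewrite mcoeffD mcoeffZ scalerDl scalerA.
Qed.

Lemma mliftU (T : choiceType) (W : lmodType K) (phi : T -> W) x :
  mlift phi << x >> = phi x.
Proof. by rewrite (mlift_Ew _ msuppU_le) big_seq_fset1 mcoeffUU scale1r. Qed.

Lemma monalgU_scale (T : choiceType) (c : K) (x : T) :
  << c *g x >> = c *: << x >> :> {malg K[T]}.
Proof. by apply/malgP => y; rewrite mcoeffZ !mcoeffU mulrnAr mulr1. Qed.

Lemma malg_lin_sum (T : choiceType) (W : lmodType K) (g : {malg K[T]} -> W) p :
  linear g -> g p = mlift (fun x => g << x >>) p.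
Proof.
move=> lg; rewrite {1}(monalgE p) (lin_sum _ _ _ lg); apply: eq_bigr => x _.
by rewrite monalgU_scale (linZ lg).
Qed.

Lemma eq_mlift (T : choiceType) (W : lmodType K) (phi psi : T -> W) :
  phi =1 psi -> mlift phi =1 mlift psi.
Proof. by move=> e p; apply: eq_bigr => x _; rewrite e. Qed.

Section Quotient.
Variables (V W : lmodType K) (S : V -> Prop) (g : V -> W).
Hypotheses (lg : linear g) (gS : forall v, S v -> g v = 0).

Lemma spanned_ker v : spanned S v -> g v = 0.
Proof.
elim=> [|a u w Su _ IH]; first exact: lin0.
by rewrite lg gS // IH scaler0 addr0.
Qed.

Definition qlift (x : quotmod S) : W := g (qrepr x).

(** Two representatives of a class differ by an element of the span of [S], on which [g]
    vanishes. *)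
Lemma qliftE v : qlift (qclass S v) = g v.
Proof.
apply/eqP; rewrite -subr_eq0 -(linB lg); apply/eqP/spanned_ker.
by apply/qclass_eq; rewrite qreprK.
Qed.

End Quotient.

Lemma qclass_linear (V : lmodType K) (S : V -> Prop) : linear (qclass S).
Proof. by move=> a u v; rewrite qclassD -qscaleE. Qed.

Lemma qlift_linear (V W : lmodType K) (S : V -> Prop) (g : V -> W) :
  linear g -> (forall v, S v -> g v = 0) -> linear (qlift (S := S) g).
Proof.
move=> lg gS a x y; rewrite -[x]qreprK -[y]qreprK -qclass_linear.
by rewrite !(qliftE lg gS) lg.
Qed.

Definition bilin (U V W : lmodType K) (b : U -> V -> W) :=
  (forall v, linear (b^~ v)) /\ (forall u, linear (b u)).

Section TensorLift.
Variables (U V W : lmodType K) (b : U -> V -> W).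
Hypothesis lb : bilin b.

Let phi (x : U * V) := b x.1 x.2.

Lemma tlift_rel z : tensor_rel z -> mlift phi z = 0.
Proof.
have lphi := mlift_linear phi.
by case=> [a u u' v|a u v v']; rewrite !(linB lphi) (linZ lphi) !mliftU /phi /=
  ?lb.1 ?lb.2 addrAC addrK subrr.
Qed.

Lemma tliftE z : tlift b z = qlift (mlift phi) z.
Proof. by rewrite tlift.unlock. Qed.

Lemma tlift_linear : linear (tlift b).
Proof.
move=> a x y; rewrite !tliftE.
by apply: qlift_linear tlift_rel _ _ _; apply: mlift_linear.
Qed.

Lemma tlift_tens u v : tlift b (tens u v) = b u v.
Proof.
rewrite tliftE tens.unlock qliftE ?mliftU //; last exact: tlift_rel.
exact: mlift_linear.
Qed.

End TensorLift.

Lemma tens_bilin (U V : lmodType K) : bilin (@tens K U V).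
Proof.
split=> [v a u u'|u a v v']; rewrite tens.unlock -qclass_linear; apply/qclass_eq.
  rewrite opprD addrA -[X in spanned _ X]addr0 -[X in X + _]scale1r.
  by apply: spannedD; [apply: tensor_rell|apply: spanned0].
rewrite opprD addrA -[X in spanned _ X]addr0 -[X in X + _]scale1r.
by apply: spannedD; [apply: tensor_relr|apply: spanned0].
Qed.

(** Both maps are pulled back to the free module on pairs, where a linear map is determined by its
    values on generators. *)
Lemma tensor_ext (U V W : lmodType K) (g h : U ⊗ V -> W) :
  linear g -> linear h -> (forall u v, g (u ⊗ v) = h (u ⊗ v)) -> g =1 h.
Proof.
move=> lg lh e x; rewrite -[x]qreprK.
have lq := @qclass_linear _ (@tensor_rel K U V).
rewrite -[LHS]/((g \o qclass _) _) -[RHS]/((h \o qclass _) _).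
rewrite (malg_lin_sum _ (linear_comp lg lq)) (malg_lin_sum _ (linear_comp lh lq)).
by apply: eq_mlift => -[u v]; have := e u v; rewrite tens.unlock.
Qed.

Lemma eq_tlift (U V W : lmodType K) (b b' : U -> V -> W) :
  (forall u v, b u v = b' u v) -> tlift b =1 tlift b'.
Proof.
by move=> e z; rewrite !tlift.unlock; apply: eq_bigr => x _; rewrite e.
Qed.

End LinearExtension.

(** * Tensor products and symmetric algebras as algebras *)

(** The representative of [z] is fixed, so linearity in the parameter is checked term by term. *)
Lemma tlift_param_linear (K : fieldType) (X U V W : lmodType K)
    (b : X -> U -> V -> W) z :
  (forall u v, linear (fun x => b x u v)) -> linear (fun x => tlift (b x) z).
Proof.
move=> lb a x y; rewrite tlift.unlock /= scaler_sumr -big_split.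
by apply: eq_bigr => -[u v] _; rewrite lb scalerDr !scalerA mulrC.
Qed.

(* MathComp's algebras are nontrivial by construction. A linear form sending 1
   to 1 is what makes tensor products of algebras nontrivial. *)
HB.mixin Record hasUnitForm (K : fieldType) R of GRing.ComAlgebra K R := {
  unit_form : R -> K;
  unit_form_linear : linear (unit_form : R -> K^o);
  unit_form1 : unit_form 1 = 1
}.

#[short(type="unitFormAlgType")]
HB.structure Definition UnitFormAlg (K : fieldType) :=
  { R of hasUnitForm K R & GRing.ComAlgebra K R }.

HB.instance Definition _ (K : fieldType) :=
  hasUnitForm.Build K (K^o) (@linear_id K (K^o)) erefl.

Lemma mul_bilin (K : fieldType) (R : comAlgType K) : bilin (@GRing.mul R).
Proof.
split=> [x a u v|x a u v]; first by rewrite mulrDl -scalerAl.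
by rewrite mulrDr -scalerAr.
Qed.

(** * The tensor product of two commutative algebras *)

Section TensorAlgebra.
Variables (K : fieldType) (B H : unitFormAlgType K).
Local Notation T := (B ⊗ H)%type.

(** The same lift as [tmul]: an algebra morphism into [B ⊗ H] then satisfies the multiplicativity
    axiom of bialgebras by conversion. *)
Definition tpmul (z z' : T) : T :=
  tlift (fun x y => tlift (fun x' y' => (x * x') ⊗ (y * y')) z') z.

Lemma tpmul_bilin1 (x : B) (y : H) :
  bilin (fun (x' : B) (y' : H) => (x * x') ⊗ (y * y')).
Proof.
split=> [y' a u v|x' a u v].
  by rewrite mulrDr -scalerAr (tens_bilin _ _).1.
by rewrite mulrDr -scalerAr (tens_bilin _ _).2.
Qed.

Lemma tpmul_bilin2 (z' : T) :
  bilin (fun x y => tlift (fun x' y' => (x * x') ⊗ (y * y')) z').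
Proof.
split=> [y|x]; apply: tlift_param_linear => x' y' a u v.
  by rewrite mulrDl -scalerAl (tens_bilin _ _).1.
by rewrite mulrDl -scalerAl (tens_bilin _ _).2.
Qed.

Lemma tpmul_tens x y x' y' : tpmul (x ⊗ y) (x' ⊗ y') = (x * x') ⊗ (y * y').
Proof.
by rewrite /tpmul (tlift_tens (tpmul_bilin2 _)) (tlift_tens (tpmul_bilin1 _ _)).
Qed.

Lemma tpmul_linl z' : linear (tpmul^~ z').
Proof. exact: tlift_linear (tpmul_bilin2 _). Qed.

Lemma tpmul_linr z : linear (tpmul z).
Proof.
apply: tlift_param_linear => x y; exact: tlift_linear (tpmul_bilin1 _ _).
Qed.

Lemma tpmulA : associative tpmul.
Proof.
move=> z z' z''; apply: (tensor_ext (g := fun z => tpmul z _)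
  (h := fun z => tpmul (tpmul z _) _)) z => [||x y].
- exact: tpmul_linl.
- exact: (linear_comp (tpmul_linl _) (tpmul_linl _)).
apply: (tensor_ext (g := fun z => tpmul _ (tpmul z _))
  (h := fun z => tpmul (tpmul _ z) _)) z' => [||x' y'].
- exact: (linear_comp (tpmul_linr _) (tpmul_linl _)).
- exact: (linear_comp (tpmul_linl _) (tpmul_linr _)).
apply: (tensor_ext (g := fun z => tpmul _ (tpmul _ z))
  (h := fun z => tpmul _ z)) z'' => [||x'' y''].
- exact: (linear_comp (tpmul_linr _) (tpmul_linr _)).
- exact: tpmul_linr.
by rewrite !tpmul_tens !mulrA.
Qed.

Lemma tpmulC : commutative tpmul.
Proof.
move=> z z'; apply: (tensor_ext (g := fun z => tpmul z _)
  (h := fun z => tpmul _ z)) z => [||x y].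
- exact: tpmul_linl.
- exact: tpmul_linr.
apply: (tensor_ext (g := fun z => tpmul _ z)
  (h := fun z => tpmul z _)) z' => [||x' y'].
- exact: tpmul_linr.
- exact: tpmul_linl.
by rewrite !tpmul_tens mulrC [y * _]mulrC.
Qed.

Lemma tpmul1 : left_id (1 ⊗ 1) tpmul.
Proof.
move=> z; apply: (tensor_ext (g := fun z => tpmul _ z) (h := id)) z => // [|x y].
  exact: tpmul_linr.
by rewrite !tpmul_tens !mul1r.
Qed.

Lemma tpmulDl : left_distributive tpmul +%R.
Proof. by move=> x y z; rewrite (linD (tpmul_linl z)). Qed.

Definition tensor_unit_form : T -> K^o :=
  tform (unit_form : B -> K) (unit_form : H -> K).

Lemma tensor_unit_form_bilin :
  bilin (fun (x : B) (y : H) => unit_form x * unit_form y : K^o).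
Proof.
split=> [y a u v|x a u v].
  have -> : unit_form (a *: u + v) = a * unit_form u + unit_form v :> K.
    exact: unit_form_linear.
  by rewrite [LHS]mulrDl -mulrA.
have -> : unit_form (a *: u + v) = a * unit_form u + unit_form v :> K.
  exact: unit_form_linear.
by rewrite [LHS]mulrDr mulrCA.
Qed.

Lemma tensor_unit_form_linear : linear tensor_unit_form.
Proof. exact: tlift_linear tensor_unit_form_bilin. Qed.

Lemma tensor_unit_form1 : tensor_unit_form (1 ⊗ 1) = 1.
Proof.
by rewrite /tensor_unit_form /tform (tlift_tens tensor_unit_form_bilin)
  !unit_form1 mulr1.
Qed.

Lemma tens1_neq0 : (1 ⊗ 1 : T) != 0.
Proof.
apply/eqP => e; have /eqP := tensor_unit_form1.
by rewrite e (lin0 tensor_unit_form_linear) eq_sym oner_eq0.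
Qed.

HB.instance Definition _ := GRing.Zmodule_isComNzRing.Build T
  tpmulA tpmulC tpmul1 tpmulDl tens1_neq0.

Lemma tscalerAl (a : K) (x y : T) : a *: (x * y) = (a *: x) * y.
Proof. by rewrite [RHS](linZ (tpmul_linl y)). Qed.

HB.instance Definition _ := GRing.Lmodule_isLalgebra.Build K T tscalerAl.
HB.instance Definition _ := GRing.Lalgebra_isComAlgebra.Build K T.
HB.instance Definition _ :=
  hasUnitForm.Build K T tensor_unit_form_linear tensor_unit_form1.

Lemma tensM (x x' : B) (y y' : H) :
  (x ⊗ y) * (x' ⊗ y') = (x * x') ⊗ (y * y') :> T.
Proof. exact: tpmul_tens. Qed.

End TensorAlgebra.

(** * Algebra morphisms, and morphisms out of a tensor product *)

Definition alg_morph (K : fieldType) (R R' : comAlgType K) (g : R -> R') :=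
  [/\ linear g, {morph g : x y / x * y} & g 1 = 1].

Section AlgMorphisms.
Variable K : fieldType.
Implicit Types R : comAlgType K.

Lemma alg_morph_id R : alg_morph (@id R).
Proof. by []. Qed.

Lemma alg_morph_comp R R' R'' (g : R' -> R'') (h : R -> R') :
  alg_morph g -> alg_morph h -> alg_morph (g \o h).
Proof.
case=> lg mg g1 [lh mh h1]; split=> [|x y|] /=.
- exact: linear_comp.
- by rewrite mh mg.
- by rewrite h1 g1.
Qed.

Lemma eq_alg_morph R R' (g h : R -> R') : g =1 h -> alg_morph g -> alg_morph h.
Proof.
by move=> e [lg mg g1]; split=> [a x y|x y|]; rewrite -!e ?lg ?mg ?g1.
Qed.

Lemma alg_morph_inl (B H : unitFormAlgType K) :
  alg_morph (fun x : B => x ⊗ (1 : H)).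
Proof.
split=> [a x y|x y|//]; first by rewrite (tens_bilin _ _).1.
by rewrite tensM mulr1.
Qed.

Lemma alg_morph_inr (B H : unitFormAlgType K) :
  alg_morph (fun y : H => (1 : B) ⊗ y).
Proof.
split=> [a x y|x y|//]; first by rewrite (tens_bilin _ _).2.
by rewrite tensM mulr1.
Qed.

Section Pairing.
Variables (B H : unitFormAlgType K) (R : comAlgType K) (g : B -> R) (h : H -> R).
Hypotheses (mg : alg_morph g) (mh : alg_morph h).

Lemma pairing_bilin : bilin (fun x y => g x * h y).
Proof.
case: mg mh => lg _ _ [lh _ _]; split=> [y a u v|x a u v].
  by rewrite lg mulrDl -scalerAl.
by rewrite lh mulrDr -scalerAr.
Qed.

(** The tensor product is the coproduct of commutative algebras; this is the morphism induced by [g]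
    and [h]. *)
Definition pairing : B ⊗ H -> R := tlift (fun x y => g x * h y).

Lemma pairing_tens x y : pairing (x ⊗ y) = g x * h y.
Proof. exact: tlift_tens pairing_bilin x y. Qed.

Lemma pairing_alg_morph : alg_morph pairing.
Proof.
have lp : linear pairing by apply: tlift_linear pairing_bilin.
split=> [//|z z'|]; last by rewrite pairing_tens; case: mg mh => _ _ -> [_ _ ->]; rewrite mulr1.
apply: (tensor_ext (g := fun z => pairing (z * z'))
  (h := fun z => pairing z * pairing z')) z => [||x y].
- exact: (linear_comp lp (tpmul_linl _)).
- exact: (linear_comp ((mul_bilin R).1 _) lp).
apply: (tensor_ext (g := fun z => pairing (_ * z))
  (h := fun z => pairing _ * pairing z)) z' => [||x' y'].
- exact: (linear_comp lp (tpmul_linr _)).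
- exact: (linear_comp ((mul_bilin R).2 _) lp).
case: mg mh => _ eg _ [_ eh _].
by rewrite tensM !pairing_tens eg eh mulrACA.
Qed.

End Pairing.
End AlgMorphisms.

(** * Universal property of the symmetric algebra *)

Section SymLift.
Variables (K : fieldType) (V : lmodType K) (R : comAlgType K).
Local Notation spoly := {malg K[{cmonom V}]}.

Lemma sclass_linear : linear (@sclass K V).
Proof. by move=> a u v; rewrite sclassD -sscaleE. Qed.

Lemma sgen_linear : linear (@sgen K V).
Proof.
move=> a u v; rewrite sgen.unlock -sclass_linear; apply/sclass_eq.
rewrite opprD addrA -[X in sym_ideal X]addr0 -[X in X + _]mul1r.
by apply: sym_idealD; apply: sym_ideal0.
Qed.

Section Lift.
Variable v : V -> R.
Hypothesis lv : linear v.

Definition mon_eval (m : {cmonom V}) : R := \prod_(i <- finsupp m) v i ^+ m i.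

Lemma mon_evalEw (m : {cmonom V}) (d : {fset V}) : (finsupp m `<=` d)%fset ->
  mon_eval m = \prod_(i <- d) v i ^+ m i.
Proof.
move=> le; rewrite /mon_eval (big_fset_incl _ le) // => i _.
by rewrite -cmE_eq0 => /eqP ->.
Qed.

Lemma mon_evalM m m' : mon_eval (mmul m m') = mon_eval m * mon_eval m'.
Proof.
rewrite (mon_evalEw (m := m) (fsubsetUl _ (finsupp m'))).
rewrite (mon_evalEw (m := m') (fsubsetUr (finsupp m) _)).
rewrite -big_split /mon_eval mdomD; apply: eq_bigr => i _ /=.
by rewrite cmM exprD.
Qed.

Definition poly_eval : spoly -> R := mlift mon_eval.

Lemma poly_eval_linear : linear poly_eval.
Proof. exact: mlift_linear. Qed.

Lemma poly_evalM : {morph poly_eval : p q / p * q}.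
Proof.
have lp := poly_eval_linear; move=> p q.
rewrite malgME (lin_sum _ _ _ lp) mulr_suml; apply: eq_bigr => m _.
rewrite (lin_sum _ _ _ lp) mulr_sumr; apply: eq_bigr => m' _.
rewrite monalgU_scale (linZ lp) /poly_eval mliftU mon_evalM.
by rewrite -scalerAl -scalerAr scalerA.
Qed.

Lemma poly_eval1 : poly_eval 1 = 1.
Proof. by rewrite /poly_eval [X in mlift _ X]/1 /= mliftU /mon_eval mdom1 big_seq_fset0. Qed.

Lemma poly_eval_svar u : poly_eval (svar u) = v u.
Proof. by rewrite /poly_eval mliftU /mon_eval mdomU big_seq_fset1 cmUU expr1. Qed.

Lemma poly_eval_ideal p : sym_ideal p -> poly_eval p = 0.
Proof.
have lp := poly_eval_linear; elim=> [|p' q a u w _ IH]; first exact: lin0.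
rewrite (linD lp) IH addr0 poly_evalM.
move: (poly_eval_svar u) (poly_eval_svar w) (poly_eval_svar (a *: u + w)).
move: (svar u) (svar w) (svar (a *: u + w)) => x y z ex ey ez.
rewrite (linB lp) (linB lp) (linZ lp) ex ey ez lv.
by rewrite addrAC addrK subrr mulr0.
Qed.

Definition slift (x : Sym V) : R := poly_eval (srepr x).

Lemma slift_sclass p : slift (sclass p) = poly_eval p.
Proof.
apply/eqP; rewrite -subr_eq0 -(linB poly_eval_linear).
by apply/eqP/poly_eval_ideal/sclass_eq; rewrite sreprK.
Qed.

Lemma slift_alg_morph : alg_morph slift.
Proof.
split=> [a x y|x y|].
- rewrite -[x]sreprK -[y]sreprK -sclass_linear !slift_sclass.
  exact: poly_eval_linear.
- by rewrite -[x]sreprK -[y]sreprK -sclassM !slift_sclass poly_evalM.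
- have -> : 1 = sclass 1 :> Sym V.
    rewrite /sclass -[1 in RHS]/(1 : spoly).
    by rewrite (@pi_oner _ _ _ _ _ _ _ (Quotient.quot (@sym_pred K V))).
  by rewrite slift_sclass poly_eval1.
Qed.

Lemma slift_sgen u : slift (sgen u) = v u.
Proof. by rewrite sgen.unlock slift_sclass poly_eval_svar. Qed.

End Lift.

(** Induction on the degree: a nontrivial monomial is divisible by one of its variables. *)
Lemma cmonom_ind (P : {cmonom V} -> Prop) :
  P mone -> (forall i m, P m -> P (mmul (ucm i) m)) -> forall m, P m.
Proof.
move=> P1 PM m; move: {2}(mdeg m) (leqnn (mdeg m)) => n.
elim: n m => [|n IH] m.
  by rewrite leqn0 => /eqP /mdeg_eq0I ->.
case: (fset_0Vmem (finsupp m)) => [e|[i im]].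
  suff -> : m = mone by [].
  by apply/eqP/cmP => i; rewrite cm1; apply/eqP; rewrite cmE_eq0 e in_fset0.
have e : m = mmul (ucm i) (divcm m (ucm i)).
  apply/eqP/cmP => j; rewrite cmM cmU divcmE cmU subnKC //.
  by case: eqP => // <-; rewrite lt0n cmE_neq0.
rewrite e mdegM mdegU add1n ltnS => le; apply: PM; exact: IH.
Qed.

Lemma sym_ext (g h : Sym V -> R) :
  alg_morph g -> alg_morph h -> (forall u, g (sgen u) = h (sgen u)) -> g =1 h.
Proof.
move=> mg mh e x; rewrite -[x]sreprK.
case: (mg) (mh) => lg eg g1 [lh eh h1].
rewrite -[LHS]/((g \o @sclass K V) _) -[RHS]/((h \o @sclass K V) _).
rewrite (malg_lin_sum _ (linear_comp lg sclass_linear)).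
rewrite (malg_lin_sum _ (linear_comp lh sclass_linear)).
apply: eq_mlift => m /=; elim/cmonom_ind: m => [|i m IH].
  have -> : sclass << mone >> = 1 :> Sym V.
    by rewrite /sclass (@pi_oner _ _ _ _ _ _ _ (Quotient.quot (@sym_pred K V))).
  by rewrite g1 h1.
have -> : << mmul (ucm i) m >> = svar i * << m >> :> spoly.
  by rewrite /svar -[RHS]/(fgmul _ _) fgmulUU mulr1.
have := e i; rewrite sgen.unlock sclassM eg eh.
by move: (svar i) << m >> IH => y z -> ->.
Qed.

End SymLift.

Section SymUnitForm.
Variables (K : fieldType) (V : lmodType K).

Lemma zero_linear (W : lmodType K) : linear (fun _ : V => 0 : W).
Proof. by move=> a u v; rewrite scaler0 addr0. Qed.

(** The augmentation of the symmetric algebra. *)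
Definition sym_unit_form : Sym V -> K := @slift K V (K^o) (fun _ => 0).

Lemma sym_unit_form_linear : linear (sym_unit_form : Sym V -> K^o).
Proof. by case: (slift_alg_morph (@zero_linear (K^o))). Qed.

Lemma sym_unit_form1 : sym_unit_form 1 = 1.
Proof. by case: (slift_alg_morph (@zero_linear (K^o))). Qed.

HB.instance Definition _ :=
  hasUnitForm.Build K (Sym V) sym_unit_form_linear sym_unit_form1.

End SymUnitForm.

(** * Products of functions of trees *)

(** Trees contain lists of trees, hence a double fixpoint: [loop] goes down a tree and [floop] along
    its children. The step receives hypotheses on the forest below the first edge and on the
    remaining siblings. *)
Lemma planted_ind (D L : Type) (Q : seq (L * tree D L) -> Prop) :
  Q [::] -> (forall i d Y X, Q Y -> Q X -> Q ((i, Node d Y) :: X)) ->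
  forall X, Q X.
Proof.
move=> Q0 QS.
pose fix loop (t : tree D L) : Q (children t) :=
  let: Node d l := t in
  (fix floop (l : seq (L * tree D L)) : Q l :=
    match l with
    | [::] => Q0
    | (i, t') :: l' =>
      (match t' as s return Q (children s) -> Q ((i, s) :: l') with
       | Node d' Y => fun QY => QS i d' Y l' QY (floop l')
       end) (loop t')
    end) l.
by elim=> [|[i [d Y]] X QX] //; exact: (QS _ _ _ _ (loop (Node d Y)) QX).
Qed.

(** * Formal sums with coefficients in a commutative ring *)

Section FormalSums.
Variable R : comNzRingType.

(* A formal sum is a list of weighted elements; [esum m h] is the value of its
   extension along h. *)
Definition fsum (X : Type) : Type := seq (R * X).
Arguments fsum X%_type.

Definition esum X (m : fsum X) (h : X -> R) : R := \sum_(x <- m) x.1 * h x.2.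

Definition fret X (x : X) : fsum X := [:: (1, x)].

Definition fbind X Y (m : fsum X) (k : X -> fsum Y) : fsum Y :=
  flatten [seq [seq (x.1 * y.1, y.2) | y <- k x.2] | x <- m].

Definition fscale X (c : R) (m : fsum X) : fsum X := [seq (c * x.1, x.2) | x <- m].

Definition esum2 X Y (m : fsum (X * Y)) (h : X -> Y -> R) : R :=
  esum m (fun x => h x.1 x.2).

Definition esum3 X Y Z (m : fsum (X * Y * Z)) (h : X -> Y -> Z -> R) : R :=
  esum m (fun x => h x.1.1 x.1.2 x.2).

Lemma esum_ret X (x : X) h : esum (fret x) h = h x.
Proof. by rewrite /esum big_seq1 mul1r. Qed.

Lemma esum_bind X Y (m : fsum X) (k : X -> fsum Y) h :
  esum (fbind m k) h = esum m (fun x => esum (k x) h).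
Proof.
rewrite /esum /fbind big_flatten big_map; apply: eq_bigr => x _.
by rewrite big_map mulr_sumr; apply: eq_bigr => y _; rewrite mulrA.
Qed.

Lemma esum_cat X (m m' : fsum X) h : esum (m ++ m') h = esum m h + esum m' h.
Proof. by rewrite /esum big_cat. Qed.

Lemma esum_fscale X c (m : fsum X) h : esum (fscale c m) h = c * esum m h.
Proof.
by rewrite /esum big_map mulr_sumr; apply: eq_bigr => x _; rewrite mulrA.
Qed.

Lemma eq_esum X (m : fsum X) h h' : h =1 h' -> esum m h = esum m h'.
Proof. by move=> e; apply: eq_bigr => x _; rewrite e. Qed.

Lemma esum_exch X Y (m : fsum X) (m' : fsum Y) h :
  esum m (fun x => esum m' (h x)) = esum m' (fun y => esum m (h^~ y)).
Proof.
rewrite /esum; under eq_bigr do rewrite mulr_sumr.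
rewrite exchange_big; apply: eq_bigr => y _.
by rewrite mulr_sumr; apply: eq_bigr => x _; rewrite mulrCA.
Qed.

Lemma esum_add X (m : fsum X) h h' :
  esum m (fun x => h x + h' x) = esum m h + esum m h'.
Proof. by rewrite -big_split; apply: eq_bigr => x _; rewrite mulrDr. Qed.

Lemma esum_mull X (m : fsum X) c h : c * esum m h = esum m (fun x => c * h x).
Proof. by rewrite mulr_sumr; apply: eq_bigr => x _; rewrite mulrCA. Qed.

Lemma esum_mulr X (m : fsum X) c h : esum m h * c = esum m (fun x => h x * c).
Proof. by rewrite mulr_suml; apply: eq_bigr => x _; rewrite mulrA. Qed.

Lemma esum_zero X (m : fsum X) : esum m (fun=> 0) = 0.
Proof. by rewrite /esum big1 // => x _; rewrite mulr0. Qed.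

Section Curried.
Variables X Y Z X' Y' Z' : Type.
Variables (m2 : fsum (X * Y)) (m3 : fsum (X * Y * Z)).

Lemma eq_esum2 h h' :
  (forall x y, h x y = h' x y) -> esum2 m2 h = esum2 m2 h'.
Proof. by move=> e; apply: eq_esum => -[]. Qed.

Lemma eq_esum3 h h' :
  (forall x y z, h x y z = h' x y z) -> esum3 m3 h = esum3 m3 h'.
Proof. by move=> e; apply: eq_esum => -[[]]. Qed.

Lemma esum2_mull c h : c * esum2 m2 h = esum2 m2 (fun x y => c * h x y).
Proof. exact: esum_mull. Qed.

Lemma esum3_mull c h : c * esum3 m3 h = esum3 m3 (fun x y z => c * h x y z).
Proof. exact: esum_mull. Qed.

Lemma esum2_mulr c h : esum2 m2 h * c = esum2 m2 (fun x y => h x y * c).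
Proof. exact: esum_mulr. Qed.

Lemma esum3_mulr c h : esum3 m3 h * c = esum3 m3 (fun x y z => h x y z * c).
Proof. exact: esum_mulr. Qed.

Lemma esum3_add h h' :
  esum3 m3 (fun x y z => h x y z + h' x y z) = esum3 m3 h + esum3 m3 h'.
Proof. exact: esum_add. Qed.

Lemma esum2_add h h' :
  esum2 m2 (fun x y => h x y + h' x y) = esum2 m2 h + esum2 m2 h'.
Proof. exact: esum_add. Qed.

Lemma esum22 (m2' : fsum (X' * Y')) h :
  esum2 m2 (fun x y => esum2 m2' (h x y))
  = esum2 m2' (fun x' y' => esum2 m2 (fun x y => h x y x' y')).
Proof. exact: (esum_exch m2 m2' (fun u v => h u.1 u.2 v.1 v.2)). Qed.

Lemma esum33 (m3' : fsum (X' * Y' * Z')) h :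
  esum3 m3 (fun x y z => esum3 m3' (h x y z))
  = esum3 m3' (fun x' y' z' => esum3 m3 (fun x y z => h x y z x' y' z')).
Proof.
exact: (esum_exch m3 m3' (fun u v => h u.1.1 u.1.2 u.2 v.1.1 v.1.2 v.2)).
Qed.

Lemma esum23 (m2' : fsum (X' * Y')) h :
  esum2 m2' (fun x' y' => esum3 m3 (h x' y'))
  = esum3 m3 (fun x y z => esum2 m2' (fun x' y' => h x' y' x y z)).
Proof. exact: (esum_exch m2' m3 (fun u v => h u.1 u.2 v.1.1 v.1.2 v.2)). Qed.

Lemma esum2_zero : esum2 m2 (fun _ _ => 0) = 0.
Proof. exact: esum_zero. Qed.

Lemma esum3_zero : esum3 m3 (fun _ _ _ => 0) = 0.
Proof. exact: esum_zero. Qed.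

End Curried.
End FormalSums.

Arguments fsum R X%_type.

(** * Contractions, cuts, and the two convolution products *)

Section Contraction.
Variables (D : Type) (iota : finType) (R : comNzRingType).
Variable phi : iota -> iota -> iota -> iota -> R.
Variable times : D -> D -> D.

Local Notation T := (tree D iota).
Local Notation PF := (seq (iota * T)).
Implicit Types (i j k l : iota) (t : T) (X Y p q : PF) (d e : D)
  (o : option D) (al be u v : T -> R).

(** As [D] is only a semigroup, [None] is a unit adjoined to it, for a root that absorbs nothing. *)
Definition dmul d o := if o is Some d' then times d d' else d.

Definition omul o o' :=
  match o, o' with
  | Some d, _ => Some (dmul d o')
  | None, _ => o'
  end.

(** [i] types the upper edge and [j] the lower one. In a pair [(k, l)], the new type of the lower
    edge comes first and that of the upper edge second, as in the target of [Phi]. *)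
Definition exch i j : fsum R (iota * iota) :=
  [seq (phi i j kl.1 kl.2, kl) | kl <- enum {: iota * iota}].

(* An edge of type i placed above the planted forest q exchanges its type with
   those of the root edges of q. *)
Fixpoint pass i q : fsum R (iota * PF) :=
  if q is x :: q' then
    fbind (exch i x.1) (fun kl => fbind (pass kl.2 q') (fun y =>
      fret R (y.1, (kl.1, x.2) :: y.2)))
  else fret R (i, [::]).

(* [expand al X] sums over the sets I of edges of the planted forest X. A term
   (p, o, q) is made of the component p of X|I reaching the root, the product o
   of the decorations it absorbs, and the planted forest q of X/I; al evaluates
   the other components of X|I. *)
Definition expand_edge al i d (m : fsum R (PF * option D * PF)) :
    fsum R (PF * option D * PF) :=
  fbind m (fun x =>
    fscale (al (Node d x.1.1))
      (fret R ([::], None, [:: (i, Node (dmul d x.1.2) x.2)]))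
    ++ fbind (pass i x.2) (fun y =>
         fret R ([:: (y.1, Node d x.1.1)], Some (dmul d x.1.2), y.2))).

Definition expand_cat (m m' : fsum R (PF * option D * PF)) :
    fsum R (PF * option D * PF) :=
  fbind m (fun x => fbind m' (fun y =>
    fret R (x.1.1 ++ y.1.1, omul x.1.2 y.1.2, x.2 ++ y.2))).

Fixpoint expand_tree al t : fsum R (PF * option D * PF) :=
  let: Node _ X := t in
  foldr (fun x m =>
    expand_cat (expand_edge al x.1 (root_dec x.2) (expand_tree al x.2)) m)
    (fret R ([::], None, [::])) X.

Definition expand al X := foldr (fun x m =>
    expand_cat (expand_edge al x.1 (root_dec x.2) (expand_tree al x.2)) m)
    (fret R ([::], None, [::])) X.

Lemma pass_nil i h : esum2 (pass i [::]) h = h i [::].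
Proof. exact: esum_ret. Qed.

Lemma pass_cons i j t q h :
  esum2 (pass i ((j, t) :: q)) h
  = esum2 (exch i j) (fun k l =>
      esum2 (pass l q) (fun i' q' => h i' ((k, t) :: q'))).
Proof.
rewrite /esum2 esum_bind; apply: eq_esum => -[k l] /=.
by rewrite esum_bind; apply: eq_esum => y; rewrite esum_ret.
Qed.

Lemma expand_nil al h : esum3 (expand al [::]) h = h [::] None [::].
Proof. exact: esum_ret. Qed.

Lemma expand_cons al i d Y X h :
  esum3 (expand al ((i, Node d Y) :: X)) h
  = esum3 (expand al Y) (fun p o q =>
      al (Node d p) * esum3 (expand al X) (fun p' o' q' =>
        h p' o' ((i, Node (dmul d o) q) :: q'))
      + esum2 (pass i q) (fun i' q1 => esum3 (expand al X) (fun p' o' q' =>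
        h ((i', Node d p) :: p') (Some (dmul (dmul d o) o')) (q1 ++ q')))).
Proof.
rewrite /esum3 /= /expand_cat esum_bind /expand_edge esum_bind.
apply: eq_esum => -[[p o] q]; rewrite esum_cat esum_fscale esum_ret /=.
rewrite !esum_bind; congr (_ * _ + _).
  by apply: eq_esum => -[[p' o'] q']; rewrite esum_ret.
apply: eq_esum => -[i' q1] /=; rewrite esum_ret esum_bind.
by apply: eq_esum => -[[p' o'] q']; rewrite esum_ret.
Qed.

Arguments expand : simpl never.
Arguments pass : simpl never.

(** The convolution dual to the contraction coproduct: [al] is evaluated here on the root component,
    and inside [expand] on the others. *)
Definition star al be t : R :=
  let: Node e X := t in
  esum3 (expand al X) (fun p o q => al (Node e p) * be (Node (dmul e o) q)).

Lemma pass_cat i X Y h :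
  esum2 (pass i (X ++ Y)) h
  = esum2 (pass i X) (fun i' X' => esum2 (pass i' Y) (fun i'' Y' =>
      h i'' (X' ++ Y'))).
Proof.
elim: X i h => [|[j t] X IH] i h; first by rewrite pass_nil.
by rewrite !pass_cons; apply: eq_esum2 => k l; rewrite IH.
Qed.

(** The second axiom in coordinates: an upper edge of type [i] crosses two lower edges of types [j]
    and [j'] in either order. *)
Definition exch_commutes : Prop := forall i j j' (h : iota -> iota -> iota -> R),
  esum2 (exch i j) (fun k l => esum2 (exch l j') (fun k' l' => h k k' l'))
  = esum2 (exch i j') (fun k' l => esum2 (exch l j) (fun k l' => h k k' l')).

(** The first axiom in coordinates, for three successive edges of types [i], [j], [r] listed from
    the root: three exchanges on one side, two on the other. *)
Definition exch_pentagonal : Prop := forall i j r (h : iota -> iota -> iota -> R),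
  esum2 (exch j r) (fun r1 j1 => esum2 (exch i r1) (fun r2 i1 =>
    esum2 (exch i1 j1) (fun j2 i2 => h r2 j2 i2)))
  = esum2 (exch i j) (fun j1 i1 => esum2 (exch j1 r) (fun r2 j2 => h r2 j2 i1)).

Definition exch_preserves (f : iota -> R) : Prop := forall i j,
  esum2 (exch i j) (fun k l => f k * f l) = f i * f j.

Hypothesis exchC : exch_commutes.

(** Iterates [exchC] along the root edges of [Y]: the upper edge crosses [j] before or after all of
    them. *)
Lemma pass_exch i j Y h :
  esum2 (exch i j) (fun k l => esum2 (pass l Y) (fun i' Y' => h k i' Y'))
  = esum2 (pass i Y) (fun i' Y' => esum2 (exch i' j) (fun k l => h k l Y')).
Proof.
elim: Y i h => [|[j' t] Y IH] i h.
  by rewrite pass_nil; apply: eq_esum2 => k l; rewrite pass_nil.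
rewrite pass_cons.
under [RHS]eq_esum2 do rewrite -(IH _ (fun k i' Y' => h k i' (_ :: Y'))).
rewrite -(exchC _ _ _ (fun k k' l' => esum2 (pass l' Y) (fun i' Y' =>
  h k i' ((k', t) :: Y')))).
by apply: eq_esum2 => k l; rewrite pass_cons.
Qed.

Hypothesis timesA : associative times.
Hypothesis timesC : commutative times.

Lemma dmul_omul d o o' : dmul (dmul d o) o' = dmul d (omul o o').
Proof. by case: o o' => [a|] [b|] //=; rewrite timesA. Qed.

Lemma omulA : associative omul.
Proof. by move=> [a|] [b|] [c|] //=; rewrite timesA. Qed.

Lemma omulC : commutative omul.
Proof. by move=> [a|] [b|] //=; rewrite timesC. Qed.

Lemma omulAC : right_commutative omul.
Proof. by move=> a b c; rewrite -omulA [omul b c]omulC omulA. Qed.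

Lemma omulACA : interchange omul omul.
Proof. by move=> a b c d; rewrite !omulA [omul (omul a b) c]omulAC. Qed.

Lemma omul_Some o d : omul o (Some d) = Some (dmul d o).
Proof. by case: o => //= d'; rewrite timesC. Qed.

Lemma expand_catE al X Y h :
  esum3 (expand al (X ++ Y)) h
  = esum3 (expand al X) (fun p o q => esum3 (expand al Y) (fun p' o' q' =>
      h (p ++ p') (omul o o') (q ++ q'))).
Proof.
elim: X h => [|[i [d Z]] X IH] h; first by rewrite expand_nil.
rewrite cat_cons !expand_cons.
apply: eq_esum3 => p o q; rewrite IH; congr (_ + _).
apply: eq_esum2 => i' q1; rewrite IH; apply: eq_esum3 => p' o' q'.
by apply: eq_esum3 => p'' o'' q''; rewrite /= -dmul_omul catA.
Qed.

Lemma expand1 al i d Y h :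
  esum3 (expand al [:: (i, Node d Y)]) h
  = esum3 (expand al Y) (fun p o q =>
      al (Node d p) * h [::] None [:: (i, Node (dmul d o) q)]
      + esum2 (pass i q) (fun i' q1 =>
          h [:: (i', Node d p)] (Some (dmul d o)) q1)).
Proof.
rewrite expand_cons; apply: eq_esum3 => p o q; rewrite expand_nil.
by congr (_ + _); apply: eq_esum2 => i' q1; rewrite expand_nil cats0.
Qed.

Hypothesis exch_pentagon : exch_pentagonal.

(** Iterates the pentagon along the root edges of [r], a forest placed below an edge of type [j],
    itself below an edge of type [i]. *)
Lemma pass_pentagon i j (r : PF) h :
  esum2 (pass j r) (fun j' r' => esum2 (pass i r') (fun i1 r1 =>
    esum2 (exch i1 j') (fun k l => h k l r1)))
  = esum2 (exch i j) (fun j1 i1 => esum2 (pass j1 r) (fun k r1 => h k i1 r1)).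
Proof.
elim: r i j h => [|[z t] r IH] i j h.
  by rewrite !pass_nil; apply: eq_esum2 => k l; rewrite pass_nil.
rewrite pass_cons.
under [RHS]eq_esum2 do rewrite pass_cons.
rewrite -(exch_pentagon _ _ _ (fun r2 j2 i2 => esum2 (pass j2 r) (fun i' q' =>
  h i' i2 ((r2, t) :: q')))).
apply: eq_esum2 => z1 j1.
under eq_esum2 do rewrite pass_cons.
rewrite esum22; apply: eq_esum2 => z2 i1.
by rewrite (IH _ _ (fun k l r1 => h k l ((z2, t) :: r1))).
Qed.

(** Induction on [q]. If the first edge survives the contraction, this is the recursion of [pass];
    if it is contracted, [pass_exch] and [pass_pentagon] bring the exchanges of both sides into the
    same order. *)
Lemma pass_expand be i q h :
  esum2 (pass i q) (fun i' q1 => esum3 (expand be q1) (h i'))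
  = esum3 (expand be q) (fun p o q2 => esum2 (pass i q2) (fun i' q' =>
      esum2 (pass i' p) (fun i'' p' => h i'' p' o q'))).
Proof.
elim: q i h => [|[j [e Y]] q IH] i h.
  by rewrite pass_nil !expand_nil !pass_nil.
rewrite pass_cons expand_cons.
under eq_esum2 do under eq_esum2 do rewrite expand_cons.
under eq_esum2 do rewrite esum23.
rewrite esum23; apply: eq_esum3 => p o r.
under eq_esum2 do rewrite esum2_add.
rewrite esum2_add; congr (_ + _).
  under eq_esum2 do rewrite -esum2_mull
    (IH _ (fun i' p' o' q' => h i' p' o' (_ :: q'))).
  rewrite -esum2_mull esum23; congr (_ * _); apply: eq_esum3 => p2 o2 q2.
  by rewrite pass_cons.
under eq_esum2 => k l do
  (rewrite esum22; under eq_esum2 => k' r' do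
     rewrite (IH _ (fun i' p' o' q' => h i' ((k', Node e p) :: p')
       (Some (dmul (dmul e o) o')) (r' ++ q'))); rewrite esum23).
rewrite esum23 [RHS]esum23; apply: eq_esum3 => p2 o2 q2.
under [RHS]eq_esum2 do rewrite pass_cat.
under [RHS]eq_esum2 do under eq_esum2 do under eq_esum2 do rewrite pass_cons.
under [RHS]eq_esum2 => j' r' do under eq_esum2 => i1 r'' do
  rewrite -(pass_exch _ _ _ (fun k i' Y' => esum2 (pass i' p2)
    (fun i'' p' => h i'' ((k, Node e p) :: p') (Some (dmul (dmul e o) o2))
       (r'' ++ Y')))).
by rewrite (pass_pentagon _ _ _ (fun k l r'' => esum2 (pass l q2) (fun i' Y' =>
  esum2 (pass i' p2) (fun i'' p' => h i'' ((k, Node e p) :: p')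
    (Some (dmul (dmul e o) o2)) (r'' ++ Y'))))).
Qed.

(* Contracting J and then I \ J amounts to contracting I: this is the common
   source of the coassociativity of both coproducts and of their
   compatibility. *)
Lemma expand_coassoc al be X h :
  esum3 (expand (star al be) X) (fun p o q => esum3 (expand al p)
    (fun p' o' q' => h p' o' q' o q))
  = esum3 (expand al X) (fun p o q => esum3 (expand be q)
    (fun p' o' q' => h p o p' (omul o o') q')).
Proof.
elim/planted_ind: X h => [|i e Y X IHY IHX] h; first by rewrite !expand_nil.
rewrite !expand_cons.
(* [A], [B] and [C] are the contributions of the first edge according to whether it lies outside
   [I], in [I] but not in [J], or in [J]. *)
pose A p' o' q' o q : R :=
  al (Node e p') * be (Node (dmul e o') q') *
  esum3 (expand (star al be) X) (fun p1 o1 q1 => esum3 (expand al p1)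
    (fun p1' o1' q1' => h p1' o1' q1' o1 ((i, Node (dmul e o) q) :: q1))).
pose B p' o' q' o q : R := al (Node e p') * esum2 (pass i q) (fun i' q2 =>
  esum3 (expand (star al be) X) (fun p1 o1 q1 => esum3 (expand al p1)
   (fun p1' o1' q1' => h p1' o1' ((i', Node (dmul e o') q') :: q1')
      (Some (dmul (dmul e o) o1)) (q2 ++ q1)))).
pose C p' o' q' o q : R := esum2 (pass i q) (fun i' q2 =>
  esum3 (expand (star al be) X) (fun p1 o1 q1 => esum3 (expand al p1)
   (fun p1' o1' q1' => esum2 (pass i' q') (fun i'' q2' =>
       h ((i'', Node e p') :: p1') (Some (dmul (dmul e o') o1')) (q2' ++ q1')
         (Some (dmul (dmul e o) o1)) (q2 ++ q1))))).
transitivity (esum3 (expand (star al be) Y) (fun p o q => esum3 (expand al p)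
    (fun p' o' q' => A p' o' q' o q + B p' o' q' o q + C p' o' q' o q))).
  apply: eq_esum3 => p o q; rewrite !esum3_add -addrA; congr (_ + _).
    by rewrite esum3_mulr.
  rewrite /B /C; under [X in _ = X + _]eq_esum3 do rewrite esum2_mull.
  rewrite -!esum23 -esum2_add; apply: eq_esum2 => i' q2.
  under [X in _ = X + _]eq_esum3 do rewrite esum3_mull.
  rewrite !(esum33 (expand al p)) -esum3_add; apply: eq_esum3 => p1 o1 q1.
  rewrite expand_cons -esum3_add; apply: eq_esum3 => p' o' q'.
  by rewrite esum23.
rewrite (IHY (fun p' o' q' o q =>
  A p' o' q' o q + B p' o' q' o q + C p' o' q' o q)).
apply: eq_esum3 => p o q; rewrite esum3_add; congr (_ + _).
  rewrite esum3_mull; under [RHS]eq_esum3 do rewrite expand_cons esum3_mull.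
  rewrite esum33; apply: eq_esum3 => p' o' q'.
  under [RHS]eq_esum3 do rewrite mulrDr.
  rewrite esum3_add; congr (_ + _).
    rewrite /A IHX esum3_mull; apply: eq_esum3 => p1 o1 q1.
    by rewrite dmul_omul mulrA.
  rewrite /B -esum3_mull; congr (_ * _); rewrite -esum23.
  apply: eq_esum2 => i' q2; rewrite (IHX (fun p1' o1' q1' o1 q1 =>
    h p1' o1' (_ :: q1') (Some (dmul _ o1)) (q2 ++ q1))).
  apply: eq_esum3 => p1 o1 q1; apply: eq_esum3 => p2 o2 q3.
  by rewrite omul_Some !dmul_omul !omulA [in RHS]omulAC.
(* The first edge now lies in [J]: it has crossed the root edges of [q], and [pass_expand] carries
   the second contraction through these exchanges. *)
under [RHS]eq_esum2 do under eq_esum3 do rewrite expand_catE.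
under [RHS]eq_esum2 do rewrite esum33.
rewrite (pass_expand _ _ _ (fun i' p3 o3 q3 => esum3 (expand al X)
  (fun p1 o1 q1 => esum3 (expand be q1) (fun p4 o4 q4 =>
    h ((i', Node e p) :: p1) (Some (dmul (dmul e o) o1)) (p3 ++ p4)
      (omul (Some (dmul (dmul e o) o1)) (omul o3 o4)) (q3 ++ q4))))).
apply: eq_esum3 => p' o' q'; rewrite /C; apply: eq_esum2 => i' q2.
rewrite (IHX (fun p1' o1' q1' o1 q1 => esum2 (pass i' p') (fun i'' q2' =>
  h ((i'', Node e p) :: p1') (Some (dmul (dmul e o) o1')) (q2' ++ q1')
    (Some (dmul _ o1)) (q2 ++ q1)))).
rewrite esum23; apply: eq_esum3 => p1 o1 q1.
rewrite esum23; apply: eq_esum3 => p4 o4 q4.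
apply: eq_esum2 => i'' p3.
by rewrite /= !dmul_omul omulACA.
Qed.

(** The counit of the contraction coproduct, and the unit of [star]. *)
Definition edgeless t : R := if t is Node _ [::] then 1 else 0.

Lemma mul_edgeless d X c :
  edgeless (Node d X) * c = if X is [::] then c else 0.
Proof. by case: X => [|x X]; rewrite /= ?mul1r ?mul0r. Qed.

(** [edgeless] forbids contracted edges outside the root component and [p = [::]] forbids them
    inside, so that only the empty set contributes. *)
Lemma expand_edgeless_nil X h :
  esum3 (expand edgeless X) (fun p o q => if p is [::] then h o q else 0)
  = h None X.
Proof.
elim/planted_ind: X h => [|i e Y X IHY IHX] h; first by rewrite expand_nil.
rewrite expand_cons; pose h' o q := h None ((i, Node (dmul e o) q) :: X).
rewrite -[RHS]/(h' None Y) -IHY; apply: eq_esum3 => p o q.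
rewrite (IHX (fun o' q' => h o' (_ :: q'))) mul_edgeless.
under [X in _ + X]eq_esum2 do rewrite esum3_zero.
by rewrite esum2_zero addr0.
Qed.

Lemma pass_is_nil i q c h :
  esum2 (pass i q) (fun i' q' => if q' is [::] then h i' else c)
  = if q is [::] then h i else esum2 (pass i q) (fun _ _ => c).
Proof.
case: q => [|[j t] q]; first by rewrite pass_nil.
by rewrite !pass_cons.
Qed.

(** No edge survives only if all are contracted; the root component is then the whole of [X], and
    [al] has no other component to evaluate. *)
Lemma expand_right_nil al X h :
  esum3 (expand al X) (fun p o q => if q is [::] then h p else 0) = h X.
Proof.
elim/planted_ind: X h => [|i e Y X IHY IHX] h; first by rewrite expand_nil.
rewrite expand_cons; pose h' p := h ((i, Node e p) :: X).
rewrite -[RHS]/(h' Y) -IHY; apply: eq_esum3 => p o q.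
rewrite esum3_zero mulr0 add0r -[0 in RHS](esum2_zero (pass i q)).
rewrite -(pass_is_nil i q 0 (fun j => h ((j, Node e p) :: X))).
apply: eq_esum2 => i' [|x q1]; last by rewrite esum3_zero.
by rewrite (IHX (fun p' => h (_ :: p'))).
Qed.

Lemma starE al be d X : star al be (Node d X)
  = esum3 (expand al X) (fun p o q => al (Node d p) * be (Node (dmul d o) q)).
Proof. by []. Qed.

Lemma star_edgelessl u : star edgeless u = u.
Proof.
apply/funext => -[d X]; rewrite starE; under eq_esum3 do rewrite mul_edgeless.
exact: expand_edgeless_nil (fun o q => u (Node (dmul d o) q)).
Qed.

Lemma star_edgelessr al : star al edgeless = al.
Proof.
apply/funext => -[d X]; rewrite starE; under eq_esum3 do rewrite mulrC mul_edgeless.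
exact: expand_right_nil.
Qed.

Lemma star_assoc al be u : star (star al be) u = star al (star be u).
Proof.
apply/funext => -[d X] /=; under eq_esum3 do rewrite esum3_mulr.
rewrite (expand_coassoc _ _ _ (fun p' o' q' o q =>
  al (Node d p') * be (Node (dmul d o') q') * u (Node (dmul d o) q))).
apply: eq_esum3 => p o q; rewrite esum3_mull; apply: eq_esum3 => p' o' q'.
by rewrite dmul_omul mulrA.
Qed.

Lemma star_zero al : star al (fun=> 0) = fun=> 0.
Proof.
apply/funext => -[d X] /=; under eq_esum3 do rewrite mulr0.
exact: esum3_zero.
Qed.

(* The sum over the admissible cuts of X; a term (p, q) is made of the part p
   containing the root and of the planted forest q of the parts cut off. *)
Definition cut_edge i t (m : fsum R (PF * PF)) : fsum R (PF * PF) :=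
  fret R ([::], [:: (i, t)])
  ++ fbind m (fun x => fbind (pass i x.2) (fun y =>
       fret R ([:: (y.1, Node (root_dec t) x.1)], y.2))).

Definition cut_cat (m m' : fsum R (PF * PF)) : fsum R (PF * PF) :=
  fbind m (fun x => fbind m' (fun y => fret R (x.1 ++ y.1, x.2 ++ y.2))).

Fixpoint cut_tree t : fsum R (PF * PF) :=
  let: Node _ X := t in
  foldr (fun x m => cut_cat (cut_edge x.1 x.2 (cut_tree x.2)) m)
    (fret R ([::], [::])) X.

Definition cut X := foldr (fun x m =>
  cut_cat (cut_edge x.1 x.2 (cut_tree x.2)) m) (fret R ([::], [::])) X.

Lemma cut_nil h : esum2 (cut [::]) h = h [::] [::].
Proof. exact: esum_ret. Qed.

Lemma cut_cons i d Y X h :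
  esum2 (cut ((i, Node d Y) :: X)) h
  = esum2 (cut X) (fun p' q' => h p' ((i, Node d Y) :: q'))
  + esum2 (cut Y) (fun p q => esum2 (pass i q) (fun i' q1 =>
      esum2 (cut X) (fun p' q' => h ((i', Node d p) :: p') (q1 ++ q')))).
Proof.
rewrite /esum2 /= /cut_cat esum_bind /cut_edge esum_cat esum_ret !esum_bind.
congr (_ + _); first by apply: eq_esum => -[p q]; rewrite esum_ret.
apply: eq_esum => -[p q]; rewrite esum_bind; apply: eq_esum => -[i' q1].
by rewrite esum_ret esum_bind; apply: eq_esum => -[p' q']; rewrite esum_ret.
Qed.

Arguments cut : simpl never.

Lemma expand_edgeless_cut X h :
  esum3 (expand edgeless X) (fun p _ q => h p q) = esum2 (cut X) h.
Proof.
elim/planted_ind: X h => [|i e Y X IHY IHX] h; first by rewrite expand_nil cut_nil.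
rewrite expand_cons cut_cons esum3_add; congr (_ + _).
  under eq_esum3 do rewrite (IHX (fun p' q' => h p' (_ :: q'))) mul_edgeless.
  exact: (expand_edgeless_nil Y (fun o q => esum2 (cut X) (fun p' q' =>
    h p' ((i, Node (dmul e o) q) :: q')))).
rewrite -IHY; apply: eq_esum3 => p o q; apply: eq_esum2 => i' q1.
exact: (IHX (fun p' q' => h (_ :: p') (_ ++ q'))).
Qed.

(** The case [al = be = edgeless] of [expand_coassoc], because [star edgeless edgeless] is
    [edgeless]. *)
Lemma cut_coassoc X h :
  esum2 (cut X) (fun p q => esum2 (cut p) (fun p' q' => h p' q' q))
  = esum2 (cut X) (fun p q => esum2 (cut q) (fun p' q' => h p p' q')).
Proof.
rewrite -!expand_edgeless_cut; under eq_esum3 do rewrite -expand_edgeless_cut.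
rewrite -{1}(star_edgelessl edgeless).
rewrite (expand_coassoc _ _ _ (fun p' _ q' _ q => h p' q' q)).
by apply: eq_esum3 => p o q; rewrite -expand_edgeless_cut.
Qed.

Lemma cut_right_nil X h :
  esum2 (cut X) (fun p q => if q is [::] then h p else 0) = h X.
Proof. by rewrite -expand_edgeless_cut (expand_right_nil _ _ h). Qed.

Lemma cut_left_nil X h :
  esum2 (cut X) (fun p q => if p is [::] then h q else 0) = h X.
Proof.
by rewrite -expand_edgeless_cut (expand_edgeless_nil _ (fun=> h)).
Qed.

Variable f : iota -> R.
Hypothesis exch_f : exch_preserves f.

(** The factor contributed by the parts cut off: [f] on the cut edges and [u] on the trees they
    carry. *)
Definition planted u q : R := \prod_(x <- q) (f x.1 * u x.2).

(** The convolution dual to the cut coproduct. The isolated first term is the total cut. *)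
Definition conv u v t : R :=
  let: Node d X := t in
  u (Node d X) + esum2 (cut X) (fun p q => planted u q * v (Node d p)).

Lemma planted_nil u : planted u [::] = 1.
Proof. exact: big_nil. Qed.

Lemma planted_cons u i t q :
  planted u ((i, t) :: q) = f i * u t * planted u q.
Proof. exact: big_cons. Qed.

Lemma planted_cat u p q : planted u (p ++ q) = planted u p * planted u q.
Proof. exact: big_cat. Qed.

(** This is where the condition [(f ⊗ f) o Phi = f ⊗ f] enters: an edge weighted by [f] crosses
    edges weighted by [f] without changing the total weight. *)
Lemma pass_planted u i q :
  esum2 (pass i q) (fun i' q' => planted u q' * f i') = f i * planted u q.
Proof.
elim: q i => [|[j t] q IH] i; first by rewrite pass_nil mulrC.
rewrite pass_cons.
transitivity (esum2 (exch i j) (fun k l => f k * f l) * (u t * planted u q)).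
  rewrite esum2_mulr; apply: eq_esum2 => k l.
  rewrite [RHS]mulrACA -IH esum2_mull; apply: eq_esum2 => i' q'.
  by rewrite planted_cons mulrA.
by rewrite exch_f planted_cons; ring.
Qed.

(** When a root edge of [q] stays with the root part, it crosses the root edges of the parts cut
    below it; [pass_planted] removes these exchanges. *)
Lemma planted_conv u v q :
  planted (conv u v) q
  = esum2 (cut q) (fun p r => planted u r * planted v p).
Proof.
elim/planted_ind: q => [|i d Y q IHY IHq].
  by rewrite cut_nil !planted_nil mulr1.
rewrite planted_cons cut_cons IHq /= mulrDr mulrDl; congr (_ + _).
  by rewrite esum2_mull; apply: eq_esum2 => p r; rewrite planted_cons mulrA.
rewrite [f i * esum2 _ _]esum2_mull esum2_mulr; apply: eq_esum2 => p r.
rewrite mulrA -pass_planted !esum2_mulr; apply: eq_esum2 => i' r1.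
rewrite esum2_mull; apply: eq_esum2 => p' q'.
by rewrite planted_cat planted_cons; ring.
Qed.

Lemma conv_assoc u v w : conv (conv u v) w = conv u (conv v w).
Proof.
apply/funext => -[d X] /=; rewrite -addrA; congr (_ + _).
under [X in _ = X]eq_esum2 do rewrite mulrDr.
rewrite esum2_add; congr (_ + _).
under [RHS]eq_esum2 do rewrite esum2_mull.
rewrite (cut_coassoc _ (fun p' q' q =>
  planted u q * (planted v q' * w (Node d p')))).
apply: eq_esum2 => p q; rewrite planted_conv esum2_mulr.
by apply: eq_esum2 => p' q'; rewrite mulrA.
Qed.

Lemma conv_zerol v : conv (fun=> 0) v = v.
Proof.
apply/funext => -[d X] /=; rewrite add0r -(cut_right_nil X (fun p => v (Node d p))).
apply: eq_esum2 => p [|[i t] q]; first by rewrite planted_nil mul1r.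
by rewrite planted_cons mulr0 !mul0r.
Qed.

Lemma conv_zeror u : conv u (fun=> 0) = u.
Proof.
apply/funext => -[d X] /=; under eq_esum2 do rewrite mulr0.
by rewrite esum2_zero addr0.
Qed.

(** With [p = [::]] no root edge is contracted: the trees of [q] are expanded separately and their
    root edges keep their types. *)
Lemma planted_star al u q :
  esum3 (expand al q) (fun p o r => if p is [::] then planted u r else 0)
  = planted (star al u) q.
Proof.
elim/planted_ind: q => [|i d Y q IHY IHq]; first by rewrite expand_nil !planted_nil.
rewrite expand_cons planted_cons -IHq /= [f i * esum3 _ _]esum3_mull esum3_mulr.
apply: eq_esum3 => p o r.
under [X in _ + X = _]eq_esum2 do rewrite esum3_zero.
rewrite esum2_zero addr0 esum3_mull esum3_mull; apply: eq_esum3 => -[|x p'] o' q'.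
  by rewrite planted_cons; ring.
by rewrite !mulr0.
Qed.

(** A contraction is split into that of the root component, by [edgeless], and those inside the
    parts hanging from it, by [al]: this is [expand_coassoc] for [edgeless] and [al]. *)
Lemma expand_factor al u X h :
  esum3 (expand al X) (fun p _ q => planted u q * h p)
  = esum2 (cut X) (fun p q => planted (star al u) q * h p).
Proof.
rewrite -expand_edgeless_cut.
under [RHS]eq_esum3 do rewrite -planted_star esum3_mulr.
rewrite -{1}(star_edgelessl al).
rewrite -(expand_coassoc _ _ _ (fun p _ p' _ q' =>
  (if p' is [::] then planted u q' else 0) * h p)).
apply: eq_esum3 => p o q.
rewrite -(expand_right_nil edgeless p (fun p' => planted u q * h p')).
by apply: eq_esum3 => p' o' [|x q']; rewrite ?mul0r.
Qed.

(** The total cut gives [star al u] on both sides. The other cuts are compared by [expand_factor]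
    and by [expand_coassoc] for [al] and [edgeless], as [star al edgeless] is [al]. *)
Lemma star_conv al u v : star al (conv u v) = conv (star al u) (star al v).
Proof.
apply/funext => -[d X] /=; under eq_esum3 do rewrite mulrDr.
rewrite esum3_add; congr (_ + _).
rewrite -(expand_factor _ _ _ (fun p => star al v (Node d p))) /=.
under [RHS]eq_esum3 do rewrite esum3_mull.
have := expand_coassoc al edgeless X (fun p' o' q' o q =>
  planted u q * (al (Node d p') * v (Node (dmul d o') q'))).
rewrite star_edgelessr => E; apply: etrans (esym E).
apply: eq_esum3 => p o q; rewrite -expand_edgeless_cut esum3_mull.
by apply: eq_esum3 => p' o' q'; rewrite mulrCA.
Qed.

Fixpoint label_eval t : R :=
  let: Node _ X := t in foldr (fun x c => f x.1 * label_eval x.2 * c) 1 X.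

Lemma label_evalE d X : label_eval (Node d X) = planted label_eval X.
Proof.
elim: X => [|[i t] X IH]; first by rewrite planted_nil.
by rewrite planted_cons -IH.
Qed.

Definition antip u := star (fun t => - u t) label_eval.

(** Writing [u] as the [star] product of [- u] and [- edgeless], distributivity reduces the claim to
    the vanishing of [conv] of [label_eval] and [- edgeless]. There only the total cut and the cut
    of all the root edges contribute, and they cancel since [label_eval] is multiplicative over the
    branches at the root. *)
Lemma conv_antip u : conv (antip u) u = fun=> 0.
Proof.
have {2}-> : u = star (fun t => - u t) (fun t => - edgeless t).
  apply/funext => t; rewrite -[LHS]opprK -[X in - X]/((fun t => - u t) t).
  rewrite -[X in - X t]star_edgelessr; case: t => d X; rewrite !starE -mulN1r.
  by rewrite esum3_mull; apply: eq_esum3 => p o q; rewrite mulN1r mulrN.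
rewrite -star_conv.
suff -> : conv label_eval (fun t => - edgeless t) = fun=> 0 by rewrite star_zero.
apply/funext => -[d X]; rewrite /conv label_evalE.
rewrite -{1}(cut_left_nil X (planted label_eval)) -esum2_add.
rewrite -[RHS](esum2_zero (cut X)); apply: eq_esum2 => p q.
by rewrite mulrC mulNr mul_edgeless; case: p => [|x p]; rewrite ?subrr ?subr0.
Qed.

End Contraction.

(** * Naturality in the ring of values *)

Section Naturality.
Variables (D : Type) (iota : finType) (R R' : comNzRingType).
Variable g : {rmorphism R -> R'}.
Variable phi : iota -> iota -> iota -> iota -> R.
Variable times : D -> D -> D.
Let phi' i j k l := g (phi i j k l).
Local Notation T := (tree D iota).

Lemma rmorph_exch i j h :
  g (esum2 (exch phi i j) h) = esum2 (exch phi' i j) (fun k l => g (h k l)).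
Proof.
rewrite /esum2 /esum /exch !big_map rmorph_sum.
by apply: eq_bigr => x _; rewrite rmorphM.
Qed.

Lemma rmorph_pass i (q : seq (iota * T)) h :
  g (esum2 (pass phi i q) h) = esum2 (pass phi' i q) (fun k l => g (h k l)).
Proof.
elim: q i h => [|[j t] q IH] i h; first by rewrite !pass_nil.
by rewrite !pass_cons rmorph_exch; apply: eq_esum2 => k l; rewrite IH.
Qed.

Lemma rmorph_expand (al : T -> R) X h :
  g (esum3 (expand phi times al X) h)
  = esum3 (expand phi' times (g \o al) X) (fun p o q => g (h p o q)).
Proof.
elim/planted_ind: X h => [|i d Y X IHY IHX] h; first by rewrite !expand_nil.
rewrite !expand_cons IHY; apply: eq_esum3 => p o q.
rewrite rmorphD rmorphM IHX rmorph_pass; congr (_ + _).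
by apply: eq_esum2 => i' q1; rewrite IHX.
Qed.

Lemma rmorph_cut (X : seq (iota * T)) h :
  g (esum2 (cut phi X) h) = esum2 (cut phi' X) (fun p q => g (h p q)).
Proof.
elim/planted_ind: X h => [|i d Y X IHY IHX] h; first by rewrite !cut_nil.
rewrite !cut_cons rmorphD IHX IHY; congr (_ + _); apply: eq_esum2 => p q.
by rewrite rmorph_pass; apply: eq_esum2 => i' q1; rewrite IHX.
Qed.

Lemma rmorph_star (al be : T -> R) t :
  g (star phi times al be t) = star phi' times (g \o al) (g \o be) t.
Proof.
case: t => d X; rewrite !starE rmorph_expand.
by apply: eq_esum3 => p o q; rewrite rmorphM.
Qed.

Variable f : iota -> R.

Lemma rmorph_planted (u : T -> R) q :
  g (planted f u q) = planted (g \o f) (g \o u) q.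
Proof. by rewrite rmorph_prod; apply: eq_bigr => x _; rewrite rmorphM. Qed.

Lemma rmorph_conv (u v : T -> R) t :
  g (conv phi f u v t) = conv phi' (g \o f) (g \o u) (g \o v) t.
Proof.
case: t => d X /=; rewrite rmorphD rmorph_cut; congr (_ + _).
by apply: eq_esum2 => p q; rewrite rmorphM rmorph_planted.
Qed.

Lemma rmorph_label_eval (t : T) :
  g (label_eval f t) = label_eval (g \o f) t.
Proof.
case: t => d X; elim/planted_ind: X d => [|i e Y X IHY IHX] d /=.
  exact: rmorph1.
by rewrite !rmorphM (IHY e) (IHX d).
Qed.

Lemma rmorph_antip (u : T -> R) t :
  g (antip phi times f u t) = antip phi' times (g \o f) (g \o u) t.
Proof.
rewrite /antip rmorph_star; congr star; apply/funext => s /=.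
  by rewrite rmorphN.
exact: rmorph_label_eval.
Qed.

End Naturality.

(** * Invariance under exchange of siblings *)

Section SwapInvariance.
Variables (D L : Type).
Local Notation T := (tree D L).
Local Notation PF := (seq (L * T)).

(** Trees are planar in this encoding; these are the functions that descend to non-planar trees. *)
Definition swap_inv (W : Type) (u : T -> W) :=
  forall t t', sibling_swap t t' -> u t = u t'.

(** Swaps are defined on trees, so planted forests are compared as children of a common vertex
    [d]. *)
Definition fswap_inv (W : Type) (h : PF -> W) :=
  forall d X Y, sibling_swap (Node d X) (Node d Y) -> h X = h Y.

Lemma fswap_inv1 (W : Type) (h : PF -> W) (d : D) x y X Y :
  fswap_inv h -> h (X ++ x :: y :: Y) = h (X ++ y :: x :: Y).
Proof. by move=> ih; apply: (ih d); apply: swap_here. Qed.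

Lemma fswap_inv_cat (W : Type) (h : PF -> W) (d : D) X Y Z V :
  fswap_inv h -> h (X ++ Y ++ Z ++ V) = h (X ++ Z ++ Y ++ V).
Proof.
move=> ih; elim: Y X Z => [|y Y IHY] X Z //.
transitivity (h (X ++ y :: Z ++ Y ++ V)).
  by rewrite -cat_rcons cat_cons -cat_rcons IHY.
elim: Z X => [|z Z IHZ] X //.
rewrite !cat_cons (fswap_inv1 d) // -cat_rcons IHZ.
by rewrite cat_rcons.
Qed.

Lemma fswap_inv_ctx (W : Type) (h : PF -> W) X Y :
  fswap_inv h -> fswap_inv (fun Z => h (X ++ Z ++ Y)).
Proof.
move=> ih d Z Z' s; apply: (ih d).
suff H t t' : sibling_swap t t' ->
    sibling_swap (Node d (X ++ children t ++ Y)) (Node d (X ++ children t' ++ Y)).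
  exact: (H _ _ s).
case=> [e l1 x y l2|e l1 a t1 t2 l2 s12] /=.
  by rewrite -!catA !catA -!(catA _ (_ :: _)); apply: swap_here.
by rewrite -!catA !catA -!(catA _ (_ :: _)); apply: swap_below.
Qed.

Lemma swap_node (d : D) (t t' : T) :
  sibling_swap t t' -> sibling_swap (Node d (children t)) (Node d (children t')).
Proof. by case=> *; [apply: swap_here|apply: swap_below]. Qed.

Lemma fswap_inv_node (W : Type) (h : PF -> W) i d :
  fswap_inv h -> fswap_inv (fun X => h [:: (i, Node d X)]).
Proof.
move=> ih e X X' s; apply: (ih e).
apply: (@swap_below _ _ e [::] i _ _ [::]).
exact: (swap_node d s).
Qed.

Lemma swap_inv_node (W : Type) (u : T -> W) d :
  swap_inv u -> fswap_inv (fun X => u (Node d X)).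
Proof.
by move=> iu e X X' s; apply: iu; apply: (swap_node d s).
Qed.

Lemma swap_root (t t' : T) : sibling_swap t t' -> root_dec t = root_dec t'.
Proof. by case. Qed.

End SwapInvariance.

Section SwapExpand.
Variables (D : Type) (iota : finType) (R : comNzRingType).
Variable phi : iota -> iota -> iota -> iota -> R.
Variable times : D -> D -> D.
Hypothesis timesA : associative times.
Hypothesis timesC : commutative times.
Hypothesis exchC : exch_commutes phi.
Local Notation T := (tree D iota).
Local Notation PF := (seq (iota * T)).

(** Swapping two root edges of the forest changes the order in which they are crossed, which [exchC]
    allows. *)
Lemma pass_swap_inv i (h : iota -> PF -> R) :
  (forall k, fswap_inv (h k)) ->
  fswap_inv (fun q => esum2 (pass phi i q) h).
Proof.
move=> ih d X Y s.
suff H t t' : sibling_swap t t' ->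
    esum2 (pass phi i (children t)) h = esum2 (pass phi i (children t')) h.
  exact: (H _ _ s).
case=> [e l1 [j1 x] [j2 y] l2|e l1 a t1 t2 l2 s12] /=.
  rewrite !pass_cat; apply: eq_esum2 => k p.
  rewrite !pass_cons.
  under eq_esum2 do rewrite pass_cons.
  under [RHS]eq_esum2 do rewrite pass_cons.
  rewrite (exchC _ _ _ (fun k1 k2 l => esum2 (pass phi l l2) (fun i' q' =>
    h i' (p ++ (k1, x) :: (k2, y) :: q')))).
  apply: eq_esum2 => k1 l; apply: eq_esum2 => k2 l'; apply: eq_esum2 => i' q'.
  exact: fswap_inv1.
rewrite !pass_cat; apply: eq_esum2 => k p; rewrite !pass_cons.
apply: eq_esum2 => k1 l; apply: eq_esum2 => k2 l'.
by apply: (ih k2 d); apply: swap_below.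
Qed.

(** Siblings are expanded independently, so swapping them permutes factors, up to the commutativity
    of [omul]. A deeper swap also meets the edge above it, through [pass_swap_inv]. *)
Lemma expand_swap (al : T -> R) (h : PF -> option D -> PF -> R) t t' :
  swap_inv al -> sibling_swap t t' ->
  (forall o q, fswap_inv (fun p => h p o q)) ->
  (forall p o, fswap_inv (h p o)) ->
  esum3 (expand phi times al (children t)) h
  = esum3 (expand phi times al (children t')) h.
Proof.
move=> ial s; elim: s h => {t t'} [e l1 x y l2|e l1 i t t' l2 s IH] h hp hq /=.
  rewrite -(cat1s x (y :: l2)) -(cat1s y l2) -(cat1s y (x :: l2)) -(cat1s x l2).
  rewrite !expand_catE //; apply: eq_esum3 => p o q.
  rewrite !expand_catE //; under eq_esum3 do rewrite expand_catE //.
  under [RHS]eq_esum3 do rewrite expand_catE //.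
  rewrite esum33; apply: eq_esum3 => px ox qx.
  apply: eq_esum3 => py oy qy; apply: eq_esum3 => p' o' q'.
  rewrite !omulA // [omul times (omul times o oy) ox]omulAC //.
  rewrite (fswap_inv_cat e p py px p' (hp _ _)).
  exact: (fswap_inv_cat e q qy qx q' (hq _ _)).
rewrite -(cat1s (i, t)) -(cat1s (i, t')) !expand_catE //.
apply: eq_esum3 => p o q; rewrite !expand_catE //.
have := swap_root s; case: t t' s IH => d Y [d' Y'] s IH /= ed.
subst d'; rewrite !expand1; apply: IH => [o1 q1|p1 o1] f X X' sX.
  rewrite (swap_inv_node d ial sX); congr (_ * _ + _).
  apply: eq_esum2 => i' q2; apply: eq_esum3 => p3 o3 q3.
  exact: (fswap_inv_node i' d (fswap_inv_ctx p p3 (hp _ _)) sX).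
congr (_ * _ + _).
  apply: eq_esum3 => p3 o3 q3.
  exact: (fswap_inv_node i (dmul times d o1) (fswap_inv_ctx q q3 (hq _ _)) sX).
set g := (X in esum2 _ X = _).
rewrite -/g; apply: (@pass_swap_inv i g _ _ _ _ sX) => k f' Z Z' sZ.
apply: eq_esum3 => p3 o3 q3.
exact: (fswap_inv_ctx q q3 (hq _ _) sZ).
Qed.

Lemma star_swap_inv (al be : T -> R) :
  swap_inv al -> swap_inv be -> swap_inv (star phi times al be).
Proof.
move=> ial ibe [d X] [d' X'] s; rewrite !starE.
have /= <- := swap_root s; apply: (expand_swap ial s) => [o q|p o] e Y Y' sY.
  by rewrite (swap_inv_node d ial sY).
by rewrite (swap_inv_node _ ibe sY).
Qed.

Lemma edgeless_swap_inv : swap_inv (@edgeless D iota R).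
Proof. by move=> t t' [e [|a l1] x y l2|e [|b l1] a s s' l2]. Qed.

Lemma planted_swap_inv (f : iota -> R) (u : T -> R) :
  swap_inv u -> fswap_inv (planted f u).
Proof.
move=> iu d X Y s.
suff H t t' : sibling_swap t t' ->
    planted f u (children t) = planted f u (children t').
  exact: (H _ _ s).
case=> [e l1 [j1 x] [j2 y] l2|e l1 a t1 t2 l2 s12] /=.
  by rewrite !planted_cat !planted_cons; ring.
by rewrite !planted_cat !planted_cons (iu _ _ s12).
Qed.

Lemma conv_swap_inv (f : iota -> R) (u v : T -> R) :
  swap_inv u -> swap_inv v -> swap_inv (conv phi f u v).
Proof.
move=> iu iv [d X] [d' X'] s; have /= ed := swap_root s.
subst d'; rewrite /= (iu _ _ s); congr (_ + _).
rewrite -!(expand_edgeless_cut phi times).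
apply: (expand_swap edgeless_swap_inv s) => [o q|p o] e Y Y' sY.
  by rewrite (swap_inv_node d iv sY).
by rewrite (planted_swap_inv f iu sY).
Qed.

Lemma label_eval_swap_inv (f : iota -> R) : swap_inv (label_eval f : T -> R).
Proof.
move=> t t'; elim=> {t t'} [e l1 [j1 x] [j2 y] l2|e l1 a t1 t2 l2 s12 IH].
  by rewrite !label_evalE !planted_cat !planted_cons; ring.
by rewrite !label_evalE !planted_cat !planted_cons IH.
Qed.

Lemma antip_swap_inv (f : iota -> R) (u : T -> R) :
  swap_inv u -> swap_inv (antip phi times f u).
Proof.
move=> iu; apply: star_swap_inv; last exact: label_eval_swap_inv.
by move=> t t' s; rewrite (iu _ _ s).
Qed.

End SwapExpand.

(** * Multilinearity in the types of the edges *)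

Section WeightedSums.
Variables (K : fieldType) (W : lmodType K).

(** The analogue of [esum] for values in a [K]-module. *)
Definition wsum X (m : fsum K X) (h : X -> W) : W := \sum_(x <- m) x.1 *: h x.2.

Lemma wsum_ret X (x : X) h : wsum (fret K x) h = h x.
Proof. by rewrite /wsum big_seq1 scale1r. Qed.

Lemma wsum_bind X Y (m : fsum K X) (k : X -> fsum K Y) h :
  wsum (fbind m k) h = wsum m (fun x => wsum (k x) h).
Proof.
rewrite /wsum /fbind big_flatten big_map; apply: eq_bigr => x _.
by rewrite big_map scaler_sumr; apply: eq_bigr => y _; rewrite scalerA.
Qed.

Lemma eq_wsum X (m : fsum K X) h h' : h =1 h' -> wsum m h = wsum m h'.
Proof. by move=> e; apply: eq_bigr => x _; rewrite e. Qed.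

Lemma wsum_exch X Y (m : fsum K X) (m' : fsum K Y) h :
  wsum m (fun x => wsum m' (h x)) = wsum m' (fun y => wsum m (h^~ y)).
Proof.
rewrite /wsum; under eq_bigr do rewrite scaler_sumr.
rewrite exchange_big; apply: eq_bigr => y _.
by rewrite scaler_sumr; apply: eq_bigr => x _; rewrite !scalerA mulrC.
Qed.

Lemma wsum_linear X (m : fsum K X) k h h' :
  wsum m (fun x => k *: h x + h' x) = k *: wsum m h + wsum m h'.
Proof.
rewrite /wsum scaler_sumr -big_split; apply: eq_bigr => x _.
by rewrite scalerDr !scalerA mulrC.
Qed.

End WeightedSums.

(** * Relabelling and naming of edges *)

Section Labels.
Variable D : Type.

Definition relabel_forest L L' (g : L -> L') (X : seq (L * tree D L)) :=
  [seq (g x.1, relabel g x.2) | x <- X].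

Definition forest_labels L (X : seq (L * tree D L)) : seq L :=
  flatten [seq x.1 :: labels x.2 | x <- X].
Arguments forest_labels : simpl never.
Arguments relabel_forest : simpl never.

Lemma forest_labels_cons L i d Y (X : seq (L * tree D L)) :
  forest_labels ((i, Node d Y) :: X) = i :: forest_labels Y ++ forest_labels X.
Proof. by []. Qed.

Lemma relabel_node L L' (g : L -> L') d (X : seq (L * tree D L)) :
  relabel g (Node d X) = Node d (relabel_forest g X).
Proof. by []. Qed.

Lemma labels_node L d (X : seq (L * tree D L)) :
  labels (Node d X) = forest_labels X.
Proof. by []. Qed.

Lemma relabel_forest_cons L L' (g : L -> L') i d Y X :
  relabel_forest g ((i, Node d Y) :: X)
  = (g i, Node d (relabel_forest g Y)) :: relabel_forest g X.
Proof. by []. Qed.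

Lemma labels_relabel_forest L L' (g : L -> L') X :
  forest_labels (relabel_forest g X) = map g (forest_labels X).
Proof.
elim/planted_ind: X => [|i d Y X IHY IHX] //.
by rewrite relabel_forest_cons !forest_labels_cons IHY IHX /= map_cat.
Qed.

Lemma relabel_forest_comp L L' L'' (g : L' -> L'') (h : L -> L') X :
  relabel_forest g (relabel_forest h X) = relabel_forest (g \o h) X.
Proof.
elim/planted_ind: X => [|i d Y X IHY IHX] //.
by rewrite !relabel_forest_cons IHY IHX.
Qed.

Lemma eq_in_relabel_forest (E : eqType) L (g h : E -> L) X :
  {in forest_labels X, g =1 h} -> relabel_forest g X = relabel_forest h X.
Proof.
elim/planted_ind: X => [|i d Y X IHY IHX] // e.
rewrite !relabel_forest_cons IHY ?IHX ?e ?mem_head // => x xX;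
  by apply: e; rewrite forest_labels_cons inE mem_cat xX ?orbT.
Qed.

Lemma labels_relabel L L' (g : L -> L') (t : tree D L) :
  labels (relabel g t) = map g (labels t).
Proof. by case: t => d X; apply: labels_relabel_forest. Qed.

Lemma relabel_comp L L' L'' (g : L' -> L'') (h : L -> L') (t : tree D L) :
  relabel g (relabel h t) = relabel (g \o h) t.
Proof. by case: t => d X; rewrite !relabel_node relabel_forest_comp. Qed.

Lemma eq_in_relabel (E : eqType) L (g h : E -> L) (t : tree D E) :
  {in labels t, g =1 h} -> relabel g t = relabel h t.
Proof.
by case: t => d X e; rewrite !relabel_node (eq_in_relabel_forest e).
Qed.

(** Names are taken from the interval from [n] to [m]; consecutive intervals keep the names of
    different subforests apart. *)
Lemma named_forest (L : Type) (a0 : L) (X : seq (L * tree D L)) n :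
  exists m Y (ty : nat -> L),
    [/\ (n <= m)%N, uniq (forest_labels Y),
        {in forest_labels Y, forall k, (n <= k < m)%N}
      & relabel_forest ty Y = X].
Proof.
elim/planted_ind: X n => [|a d Y X IHY IHX] n.
  by exists n, [::], (fun=> a0).
have [m1 [Y1 [ty1 [le1 un1 in1 e1]]]] := IHY n.+1.
have [m2 [X2 [ty2 [le2 un2 in2 e2]]]] := IHX m1.
exists m2, ((n, Node d Y1) :: X2),
  (fun k => if k == n then a else if (k < m1)%N then ty1 k else ty2 k); split.
- lia.
- rewrite forest_labels_cons /= cat_uniq un1 un2 mem_cat negb_or /= andbT.
  apply/andP; split.
  + by apply/andP; split; [apply/negP => /in1|apply/negP => /in2]; lia.
  + by apply/hasPn => k /in2 k2; apply/negP => /in1; lia.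
- move=> k; rewrite forest_labels_cons inE mem_cat.
  by case/or3P => [/eqP ->|/in1|/in2]; lia.
- rewrite relabel_forest_cons eqxx -e1 -e2.
  congr ((_, Node _ _) :: _); apply: eq_in_relabel_forest => k.
    by move/in1 => k1; rewrite ifN ?ifT //; lia.
  by move/in2 => k2; rewrite !ifN //; lia.
Qed.

Lemma named_tree (L : Type) (a0 : L) (t : tree D L) :
  exists s (ty : nat -> L), uniq (labels s) /\ t = relabel ty s.
Proof.
case: t => d X; have [m [Y [ty [_ un _ <-]]]] := named_forest a0 X 0.
by exists (Node d Y), ty.
Qed.

End Labels.

Arguments forest_labels : simpl never.
Arguments relabel_forest : simpl never.

(** * Multilinear functions of the types of the edges *)

Section Multilinear.
Variables (K : fieldType) (A W : lmodType K).

Definition multilin (E : eqType) (ls : seq E) (G : (E -> A) -> W) :=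
  (forall ty ty', {in ls, ty =1 ty'} -> G ty = G ty') /\
  (forall ty e, e \in ls -> linear (fun a => G (Defs.set_type ty e a))).

Variables (iota : finType) (bas : iota -> A) (co : iota -> A -> K).
Hypothesis co_bas : forall a, a = \sum_i co i a *: bas i.

(** Types are replaced by basis vectors one edge at a time; in the induction, [l] lists the edges
    whose type is still arbitrary. *)
Lemma multilin_ext (E : eqType) (ls : seq E) (G H : (E -> A) -> W) :
  multilin ls G -> multilin ls H ->
  (forall ty, {in ls, forall e, exists i, ty e = bas i} -> G ty = H ty) ->
  G =1 H.
Proof.
move=> [exG liG] [exH liH] e ty.
suff main (l : seq E) : forall ty,
    (forall y, y \in ls -> y \notin l -> exists i, ty y = bas i) -> G ty = H ty.
  by apply: (main ls) => y ->.
elim: l => [|x l IH] {}ty hty.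
  by apply: e => y yl; apply: hty.
case xls: (x \in ls); last first.
  apply: IH => y yls yl; apply: hty => //; rewrite inE negb_or yl andbT.
  by apply: contraFneq xls => <-.
have ext (F : (E -> A) -> W) : (forall ty ty', {in ls, ty =1 ty'} -> F ty = F ty') ->
    linear (fun a => F (Defs.set_type ty x a)) ->
    F ty = \sum_i co i (ty x) *: F (Defs.set_type ty x (bas i)).
  move=> exF lF; transitivity (F (Defs.set_type ty x (ty x))).
    by apply: exF => y _; rewrite /Defs.set_type; case: eqP => [->|].
  rewrite {1}(co_bas (ty x)) (lin_sum _ _ _ lF); apply: eq_bigr => i _.
  by rewrite (linZ lF).
rewrite (ext G) ?(ext H) //; try by [apply: liG|apply: liH].
apply: eq_bigr => i _; congr (_ *: _); apply: IH => y yls yl.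
rewrite /Defs.set_type; case: eqP => [_|/eqP yx]; first by exists i.
by apply: hty => //; rewrite inE negb_or yx.
Qed.

End Multilinear.

(** * Linear maps out of the space of typed trees *)

Section TreeLift.
Variables (K : fieldType) (A : lmodType K) (D : Type).
Variables (iota : finType) (bas : iota -> A) (co : iota -> A -> K).
Hypothesis co_bas : forall a, a = \sum_i co i a *: bas i.
Hypothesis co_linear : forall i, linear (co i : A -> K^o).
Hypothesis co_dual : forall i j, co i (bas j) = (i == j)%:R.
Local Notation T := (tree D iota).

Definition basis_sum (a : A) : fsum K iota := [seq (co i a, i) | i <- enum iota].

(** The coordinates of a typed tree: each type is expanded in the basis and the result is
    distributed. *)
Fixpoint basis_expand (t : tree D A) : fsum K T :=
  let: Node d X := t in
  fbind (foldr (fun x m => fbind (basis_sum x.1) (fun i =>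
      fbind (basis_expand x.2) (fun s => fbind m (fun X' =>
        fret K ((i, s) :: X'))))) (fret K [::]) X)
    (fun X' => fret K (Node d X')).

Definition basis_expandf (X : seq (A * tree D A)) : fsum K (seq (iota * T)) :=
  foldr (fun x m => fbind (basis_sum x.1) (fun i =>
      fbind (basis_expand x.2) (fun s => fbind m (fun X' =>
        fret K ((i, s) :: X'))))) (fret K [::]) X.

Section Values.
Variable W : lmodType K.

Lemma basis_expandE d X (u : T -> W) :
  wsum (basis_expand (Node d X)) u
  = wsum (basis_expandf X) (fun Y => u (Node d Y)).
Proof.
rewrite [LHS]wsum_bind; apply: eq_wsum => Y; exact: wsum_ret.
Qed.

Lemma basis_expandf_nil (h : seq (iota * T) -> W) :
  wsum (basis_expandf [::]) h = h [::].
Proof. exact: wsum_ret. Qed.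

Lemma basis_expandf_cons a d Y X (h : seq (iota * T) -> W) :
  wsum (basis_expandf ((a, Node d Y) :: X)) h
  = wsum (basis_sum a) (fun i => wsum (basis_expandf Y) (fun Y' =>
      wsum (basis_expandf X) (fun X' => h ((i, Node d Y') :: X')))).
Proof.
rewrite [LHS]wsum_bind; apply: eq_wsum => i.
rewrite wsum_bind basis_expandE; apply: eq_wsum => Y'.
by rewrite wsum_bind; apply: eq_wsum => X'; rewrite wsum_ret.
Qed.

Lemma basis_expandf_cat X Y (h : seq (iota * T) -> W) :
  wsum (basis_expandf (X ++ Y)) h
  = wsum (basis_expandf X) (fun X' => wsum (basis_expandf Y) (fun Y' =>
      h (X' ++ Y'))).
Proof.
elim: X h => [|[a [d Z]] X IH] h; first by rewrite basis_expandf_nil.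
rewrite cat_cons !basis_expandf_cons; apply: eq_wsum => i; apply: eq_wsum => Z'.
by rewrite IH.
Qed.

Lemma basis_sumD k a b (h : iota -> W) :
  wsum (basis_sum (k *: a + b)) h
  = k *: wsum (basis_sum a) h + wsum (basis_sum b) h.
Proof.
rewrite /wsum !big_map scaler_sumr -big_split; apply: eq_bigr => i _ /=.
by rewrite co_linear scalerDl scalerA.
Qed.

Lemma basis_sum_bas i (h : iota -> W) : wsum (basis_sum (bas i)) h = h i.
Proof.
rewrite /wsum big_map big_enum (bigD1 i) //= big1 => [|j ji]; rewrite co_dual.
  by rewrite eqxx scale1r addr0.
by rewrite (negbTE ji) scale0r.
Qed.

Lemma basis_expandf_bas X (h : seq (iota * T) -> W) :
  wsum (basis_expandf (relabel_forest bas X)) h = h X.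
Proof.
elim/planted_ind: X h => [|i d Y X IHY IHX] h; first exact: basis_expandf_nil.
by rewrite relabel_forest_cons basis_expandf_cons basis_sum_bas IHY IHX.
Qed.

Lemma basis_expand_bas t (u : T -> W) :
  wsum (basis_expand (relabel bas t)) u = u t.
Proof.
by case: t => d X; rewrite relabel_node basis_expandE basis_expandf_bas.
Qed.

Lemma basis_expandf_multilin (E : eqType) (X : seq (E * tree D E)) h :
  uniq (forest_labels X) ->
  multilin (forest_labels X)
    (fun ty : E -> A => wsum (basis_expandf (relabel_forest ty X)) h : W).
Proof.
move=> un; split=> [ty ty' e|ty e eX k a b].
  by rewrite (eq_in_relabel_forest e).
elim/planted_ind: X h un eX => [|x d Y X IHY IHX] h //.
rewrite forest_labels_cons cons_uniq inE mem_cat cat_uniq.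
case/and3P; rewrite negb_or => /andP[xY xX] unY /andP[YX unX].
have off (Z : seq (E * tree D E)) c : e \notin forest_labels Z ->
    relabel_forest (Defs.set_type ty e c) Z = relabel_forest ty Z.
  move=> eZ; apply: eq_in_relabel_forest => y yZ; rewrite /Defs.set_type ifN //.
  by apply: contraNneq eZ => <-.
rewrite !relabel_forest_cons !basis_expandf_cons.
rewrite mem_cat; case/or3P => [/eqP ex|eY|eX].
- by subst x; rewrite !off // /Defs.set_type eqxx basis_sumD.
- have eX : e \notin forest_labels X by apply: contra YX => eX; apply/hasP; exists e.
  have xe : x != e by apply: contraNneq xY => ->.
  rewrite !(off X) // /Defs.set_type !(ifN _ _ xe).
  rewrite -wsum_linear; apply: eq_wsum => i; exact: IHY.
- have eY : e \notin forest_labels Y by apply: contra YX => eY; apply/hasP; exists e.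
  have xe : x != e by apply: contraNneq xX => ->.
  rewrite !(off Y) // /Defs.set_type !(ifN _ _ xe).
  rewrite -wsum_linear; apply: eq_wsum => i; rewrite -wsum_linear.
  apply: eq_wsum => Y'; exact: IHX.
Qed.

Lemma basis_expandf_swap (h : seq (iota * T) -> W) (t t' : tree D A) :
  sibling_swap t t' -> fswap_inv h ->
  wsum (basis_expandf (children t)) h = wsum (basis_expandf (children t')) h.
Proof.
move=> s; elim: s h => {t t'} [e l1 x y l2|e l1 a t t' l2 s IH] h ih.
  rewrite /= !basis_expandf_cat; apply: eq_wsum => X.
  rewrite -(cat1s x (y :: l2)) -(cat1s y l2) -(cat1s y (x :: l2)) -(cat1s x l2).
  rewrite !basis_expandf_cat.
  under eq_wsum do rewrite basis_expandf_cat.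
  under [RHS]eq_wsum do rewrite basis_expandf_cat.
  rewrite wsum_exch; apply: eq_wsum => Y; apply: eq_wsum => Z.
  by apply: eq_wsum => V; rewrite (fswap_inv_cat e).
rewrite /= !basis_expandf_cat; apply: eq_wsum => X.
have := swap_root s; case: t t' s IH => d Y [d' Y'] s IH /= ed; subst d'.
rewrite !basis_expandf_cons; apply: eq_wsum => i; apply: IH => f Z Z' sZ.
apply: eq_wsum => V.
exact: (fswap_inv_node i d (fswap_inv_ctx X V ih) sZ).
Qed.

Lemma basis_expand_swap (u : T -> W) t t' :
  swap_inv u -> sibling_swap t t' ->
  wsum (basis_expand t) u = wsum (basis_expand t') u.
Proof.
move=> iu s; have := swap_root s; case: t t' s => d X [d' X'] s /= ed; subst d'.
rewrite !basis_expandE; apply: (basis_expandf_swap s).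
exact: swap_inv_node.
Qed.

(** The linear map with value [u] on basis-typed trees; swap-invariance of [u] and multilinearity of
    the coordinates make it respect the relations [tree_rel]. *)
Definition tree_lift (u : T -> W) : gtrees A D -> W :=
  qlift (S := @tree_rel K A D) (mlift (fun t => wsum (basis_expand t) u)).

Section Lift.
Variable u : T -> W.
Hypothesis iu : swap_inv u.

Lemma tree_lift_rel z :
  tree_rel z -> mlift (fun t : tree D A => wsum (basis_expand t) u) z = 0.
Proof.
set g := mlift _; have lg : linear g by apply: mlift_linear.
case=> [t t' s|s ty e k a b un es].
  by rewrite (linB lg) /g !mliftU (basis_expand_swap iu s) subrr.
rewrite !(linB lg) (linZ lg) /g !mliftU.
case: s un es => d X un es; rewrite !relabel_node !basis_expandE.
have [_ /(_ ty e es k a b)] := basis_expandf_multilin (fun Y => u (Node d Y)) un.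
by move=> ->; rewrite addrAC addrK subrr.
Qed.

Lemma tree_lift_linear : linear (tree_lift u).
Proof. exact: qlift_linear (mlift_linear _) tree_lift_rel. Qed.

Lemma tree_lift_bas t : tree_lift u (tree_class (relabel bas t)) = u t.
Proof.
rewrite /tree_lift tree_class.unlock (qliftE (mlift_linear _) tree_lift_rel).
by rewrite mliftU basis_expand_bas.
Qed.

End Lift.
End Values.

Lemma tree_class_swap (t t' : tree D A) :
  sibling_swap t t' -> tree_class t = tree_class t'.
Proof.
move=> s; rewrite tree_class.unlock; apply/qclass_eq.
rewrite -[X in spanned _ X]addr0 -[X in X + _]scale1r.
by apply: spannedD; [apply: tree_rel_swap|apply: spanned0].
Qed.

Lemma relabel_swap L L' (g : L -> L') (t t' : tree D L) :
  sibling_swap t t' -> sibling_swap (relabel g t) (relabel g t').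
Proof.
elim=> {t t'} [e l1 x y l2|e l1 a t t' l2 s IH] /=; rewrite !map_cat /=.
  exact: swap_here.
exact: swap_below.
Qed.

Lemma tree_class_multilin (E : eqType) (s : tree D E) :
  uniq (labels s) -> multilin (labels s) (fun ty : E -> A => tree_class (relabel ty s)).
Proof.
move=> un; split=> [ty ty' e|ty e es k a b]; first by rewrite (eq_in_relabel e).
(* [tree_rel_lin] has edges named by natural numbers, so each edge is renamed by its position in
   [labels s]. *)
pose nm x := index x (labels s); pose s' := relabel nm s.
have un' : uniq (labels s').
  rewrite labels_relabel map_inj_in_uniq // => x y xs ys /(congr1 (nth e (labels s))).
  by rewrite !nth_index.
have es' : nm e \in labels s' by rewrite labels_relabel map_f.
have tyE c : relabel (Defs.set_type ty e c) s
    = relabel (Defs.set_type (fun k => ty (nth e (labels s) k)) (nm e) c) s'.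
  rewrite relabel_comp; apply: eq_in_relabel => x xs; rewrite /Defs.set_type /=.
  rewrite /nm nth_index //; congr (if _ then _ else _); apply/eqP/eqP => [-> //|].
  by move/(congr1 (nth e (labels s))); rewrite !nth_index.
rewrite !tyE tree_class.unlock -qclass_linear; apply/qclass_eq.
rewrite opprD addrA -[X in spanned _ X]addr0 -[X in X + _]scale1r.
by apply: spannedD; [apply: tree_rel_lin|apply: spanned0].
Qed.

(** Any tree is a typing of a named one, and its class is multilinear in the types, so that
    [multilin_ext] reduces the claim to basis typings. *)
Lemma gtrees_ext (W : lmodType K) (g h : gtrees A D -> W) :
  linear g -> linear h ->
  (forall t : T, g (tree_class (relabel bas t)) = h (tree_class (relabel bas t))) ->
  g =1 h.
Proof.
move=> lg lh e x; rewrite -[x]qreprK.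
have lq := @qclass_linear _ _ (@tree_rel K A D).
rewrite -[LHS]/((g \o qclass _) _) -[RHS]/((h \o qclass _) _).
rewrite (malg_lin_sum _ (linear_comp lg lq)) (malg_lin_sum _ (linear_comp lh lq)).
have tcE (t : tree D A) : qclass (@tree_rel K A D) << t >> = tree_class t.
  by rewrite tree_class.unlock.
apply: eq_mlift => t; rewrite /comp tcE; have [s [ty [un ->]]] := named_tree (0 : A) t.
have lin g' : linear g' -> multilin (labels s)
    (fun ty : nat -> A => g' (tree_class (relabel ty s)) : W).
  move=> lg'; have [ex li] := tree_class_multilin un; split=> [? ? ee|? ? ee].
    by rewrite (ex _ _ ee).
  exact: linear_comp lg' (li _ _ ee).
apply: (multilin_ext co_bas (lin _ lg) (lin _ lh)) => {}ty hty.
suff [t' ->] : exists t', relabel ty s = relabel bas t' by apply: e.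
case: s hty {un lin} => d X; rewrite labels_node => hty.
suff [X' eX] : exists X', relabel_forest ty X = relabel_forest bas X'.
  by exists (Node d X'); rewrite !relabel_node eX.
elim/planted_ind: X hty => [|i d' Y X IHY IHX] hty; first by exists [::].
have [|Y' eY] := IHY; first by move=> j jY; apply: hty;
  rewrite forest_labels_cons inE mem_cat jY orbT.
have [|X' eX] := IHX; first by move=> j jY; apply: hty;
  rewrite forest_labels_cons inE mem_cat jY !orbT.
have [|k ek] := hty i; first by rewrite forest_labels_cons mem_head.
by exists ((k, Node d' Y') :: X'); rewrite !relabel_forest_cons eY eX ek.
Qed.

End TreeLift.

(** * Exchanges along named edges *)

Section ForestFold.
Variables (D L W : Type) (n : W) (c : L -> D -> W -> W -> W).

Fixpoint tree_fold (t : tree D L) : W :=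
  let: Node _ X := t in
  foldr (fun x w => c x.1 (root_dec x.2) (tree_fold x.2) w) n X.

Definition forest_fold (X : seq (L * tree D L)) : W :=
  foldr (fun x w => c x.1 (root_dec x.2) (tree_fold x.2) w) n X.

Lemma forest_fold_cons i d Y X :
  forest_fold ((i, Node d Y) :: X) = c i d (forest_fold Y) (forest_fold X).
Proof. by []. Qed.

End ForestFold.

Section Sublists.
Variables (T : eqType) (R : zmodType).

(** Sets of edges are encoded by sublists, so that sums over them split along concatenation of
    forests; [big_subs_set] returns to finite sets. *)
Fixpoint subs (s : seq T) : seq (seq T) :=
  if s is x :: s' then subs s' ++ [seq x :: J | J <- subs s'] else [:: [::]].

Lemma big_subs_cons x s (G : seq T -> R) :
  \sum_(J <- subs (x :: s)) G J
  = \sum_(J <- subs s) G J + \sum_(J <- subs s) G (x :: J).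
Proof. by rewrite /= big_cat big_map. Qed.

Lemma big_subs_cat s s' (G : seq T -> R) :
  \sum_(J <- subs (s ++ s')) G J
  = \sum_(J <- subs s) \sum_(J' <- subs s') G (J ++ J').
Proof.
elim: s G => [|x s IH] G; first by rewrite big_seq1.
by rewrite cat_cons !big_subs_cons !IH.
Qed.

Lemma mem_subs s J : J \in subs s -> {subset J <= s}.
Proof.
elim: s J => [|x s IH] J /=; first by rewrite inE => /eqP ->.
rewrite mem_cat => /orP[/IH sJ y /sJ ys|/mapP[J' /IH sJ' ->] y].
  by rewrite inE ys orbT.
by rewrite !inE => /orP[->//|/sJ' ->]; rewrite orbT.
Qed.

Lemma big_subs_none s (G : seq T -> R) : uniq s ->
  \sum_(J <- subs s | ~~ has (mem J) s) G J = G [::].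
Proof.
elim: s => [|x s IH] /=; first by rewrite big_seq1.
case/andP => xs us; rewrite big_cat big_map /= -[RHS](IH us).
rewrite [X in _ + X]big1 ?addr0 => [|J]; last by rewrite mem_head.
rewrite big_seq_cond [RHS]big_seq_cond; apply: eq_bigl => J /=.
case Js: (J \in subs s) => //=.
suff -> : x \in J = false by [].
by apply: contraNF xs; apply: (mem_subs Js).
Qed.

End Sublists.

(** * Sequences of exchanges and their reordering *)

Section Runs.
Variables (D : Type) (iota : finType) (R : comNzRingType) (E : eqType).
Variable phi : iota -> iota -> iota -> iota -> R.
Implicit Types (G : (E -> iota) -> R) (ty : E -> iota) (L : seq (E * E)).

Definition upd ty e i : E -> iota := fun x => if x == e then i else ty x.

(** The pair [xe] is an upper edge followed by a lower one. The modified typing is handed to [G], so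
    that in [runs] the head of the list acts first. *)
Definition exch_op (xe : E * E) G ty : R :=
  esum2 (exch phi (ty xe.1) (ty xe.2)) (fun k l => G (upd (upd ty xe.2 k) xe.1 l)).

Definition runs L G : (E -> iota) -> R := foldr exch_op G L.

Lemma runs_cat L L' G : runs (L ++ L') G = runs L (runs L' G).
Proof. exact: foldr_cat. Qed.

(** The exchanges modify only edges of [S], so the continuations have to agree only at typings that
    keep their initial values outside [S]. *)
Lemma runs_ext (S : pred E) L G G' ty ty' :
  all (fun xe => S xe.1 && S xe.2) L ->
  {in S, ty =1 ty'} ->
  (forall t t', {in S, t =1 t'} -> {in predC S, t =1 ty} ->
    {in predC S, t' =1 ty'} -> G t = G' t') ->
  runs L G ty = runs L G' ty'.
Proof.
elim: L ty ty' => [|[x e] L IH] ty ty' /= => [_ e1 e2|]; first exact: e2.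
case/andP => /andP[Sx Se] SL e1 e2; rewrite /exch_op /= (e1 x Sx) (e1 e Se).
apply: eq_esum2 => k l; apply: IH => // [y yS|t t' tt' tS t'S].
  by rewrite /upd (e1 y yS).
apply: e2 => // y yS; [rewrite tS|rewrite t'S] => //; rewrite /upd.
  by rewrite !ifN //; apply: contraNneq yS => ->.
by rewrite !ifN //; apply: contraNneq yS => ->.
Qed.

Lemma eq_runs L G G' ty : G =1 G' -> runs L G ty = runs L G' ty.
Proof.
move=> e; apply: (@runs_ext predT) => // [|t t' tt' _ _]; first exact/allP.
by have -> : t = t' by apply/funext => y; apply: tt'.
Qed.

Lemma runs_sum L I (r : seq I) (P : pred I) (G : I -> (E -> iota) -> R) ty :
  runs L (fun t => \sum_(i <- r | P i) G i t) ty
  = \sum_(i <- r | P i) runs L (G i) ty.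
Proof.
elim: L ty => [|xe L IH] ty //=; rewrite /exch_op.
under eq_esum2 do rewrite IH.
rewrite /esum2 /esum exchange_big /=.
by apply: eq_bigr => y _; rewrite mulr_sumr.
Qed.

Lemma runs_mull L c G ty : runs L (fun t => c * G t) ty = c * runs L G ty.
Proof.
elim: L ty => [|xe L IH] ty //=; rewrite /exch_op.
under eq_esum2 do rewrite IH.
by rewrite esum2_mull.
Qed.

(** Both runs start from [ty] and touch disjoint sets of edges, so that they can be performed on a
    single typing. *)
Lemma runs_merge (S S' : pred E) L L' (G : (E -> iota) -> (E -> iota) -> R) ty :
  all (fun xe => S xe.1 && S xe.2) L -> all (fun xe => S' xe.1 && S' xe.2) L' ->
  (forall x, S x -> ~~ S' x) ->
  (forall t1 t1' t2 t2', {in S, t1 =1 t1'} -> {in S', t2 =1 t2'} ->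
     G t1 t2 = G t1' t2') ->
  runs L (fun t1 => runs L' (G t1) ty) ty = runs (L ++ L') (fun t => G t t) ty.
Proof.
move=> SL SL' dis exG; rewrite runs_cat.
apply: (runs_ext SL) => // t t' tt' tS t'S.
apply: (runs_ext SL') => [y yS'|u u' uu' uS' u'S'].
  by rewrite t'S //; apply/negP => /dis; rewrite -[S' y]/(y \in S') yS'.
apply: exG => // y yS; rewrite u'S' ?tt' //; exact: dis.
Qed.

Section Reordering.
Variable I : pred E.
Hypothesis exchC : exch_commutes phi.

(** If the upper edges coincide this is [exchC]; otherwise the four edges are distinct and the two
    sums are independent. *)
Lemma exch_opC x e x' e' G : I x -> I x' -> ~~ I e -> ~~ I e' -> e != e' ->
  exch_op (x, e) (exch_op (x', e') G) = exch_op (x', e') (exch_op (x, e) G).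
Proof.
move=> Ix Ix' Ie Ie' ee'; apply/funext => ty; rewrite /exch_op /=.
have neq y z : I y -> ~~ I z -> (y == z) = false.
  by move=> Iy; apply: contraNF => /eqP <-.
have ne := (neq x e Ix Ie, neq x e' Ix Ie', neq x' e Ix' Ie, neq x' e' Ix' Ie',
  negbTE ee').
have ne' : ((e == x) = false) * ((e' == x) = false) * ((e == x') = false)
    * ((e' == x') = false) * ((e' == e) = false).
  by rewrite ![_ == x]eq_sym ![_ == x']eq_sym [e' == e]eq_sym !ne.
have [xx'|xx'] := eqVneq x x'.
  subst x'; rewrite /upd !eqxx !ne !ne'.
  pose h k k' l' := G (upd (upd (upd ty e k) e' k') x l').
  transitivity (esum2 (exch phi (ty x) (ty e)) (fun k l =>
    esum2 (exch phi l (ty e')) (fun k' l' => h k k' l'))).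
    apply: eq_esum2 => k l; apply: eq_esum2 => k' l'; congr G.
    by apply/funext => y; rewrite /upd; case: (y == x); case: (y == e').
  rewrite exchC; apply: eq_esum2 => k' l; apply: eq_esum2 => k l'; congr G.
  apply/funext => y; rewrite /upd; case: (eqVneq y x) => // _.
  by case: (eqVneq y e') => [->|//]; rewrite ne'.
rewrite /upd !ne !ne' ![x' == x]eq_sym (negbTE xx') esum22.
apply: eq_esum2 => k' l'; apply: eq_esum2 => k l; congr G.
apply/funext => y; case: (eqVneq y x') => [->|_].
  by rewrite eq_sym (negbTE xx') ne.
by case: (eqVneq y e') => [->|//]; rewrite !ne'.
Qed.

(** Exchanges with different lower edges commute by [exch_opC]. The first exchange of [L] is thus
    brought to the head of [L'], across exchanges with other lower edges, and the tails are treated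
    by induction. *)
Lemma runs_perm L L' G :
  all (fun xe => I xe.1 && ~~ I xe.2) L -> all (fun xe => I xe.1 && ~~ I xe.2) L' ->
  (forall e, filter (fun xe => xe.2 == e) L = filter (fun xe => xe.2 == e) L') ->
  runs L G = runs L' G.
Proof.
elim: L L' => [|[x e] L IH] L' aL aL' eL.
  case: L' aL' eL => [|[x e] L'] // _ /(_ e).
  by rewrite /= eqxx.
have [L1 [L2 [eL' L1e]]] : exists L1 L2, L' = L1 ++ (x, e) :: L2 /\
    all (fun xe => xe.2 != e) L1.
  have: filter (fun xe => xe.2 == e) L' = (x, e) :: filter (fun xe => xe.2 == e) L.
    by rewrite -eL /= eqxx.
  elim: L' {aL' eL} => [|[y e'] L' IH'] //=.
  case: (eqVneq e' e) => [-> [-> _]|e'e /IH' [L1 [L2 [-> aL1]]]].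
    by exists [::], L'.
  by exists ((y, e') :: L1), L2; rewrite /= e'e.
move: aL => /= /andP[/andP[Ix Ie] aL].
move: aL'; rewrite eL' all_cat /= => /and3P[aL1 _ aL2].
have -> : runs (L1 ++ (x, e) :: L2) G = runs ((x, e) :: L1 ++ L2) G.
  elim: L1 L1e aL1 {eL'} => [|[y e'] L1 IH1] //= /andP[e'e L1e] /andP[/andP[Iy Ie'] aL1].
  by rewrite IH1 //= exch_opC // eq_sym.
rewrite /=; congr exch_op; apply: IH => // [|e']; first by rewrite all_cat aL1.
have := eL e'; rewrite eL' !filter_cat /=.
case: (eqVneq e e') => [ee'|//].
have -> : filter (fun xe => xe.2 == e') L1 = [::].
  rewrite -ee'; apply/eqP; rewrite -(negbK (_ == _)) -has_filter.
  by rewrite -all_predC.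
by case.
Qed.

End Reordering.
End Runs.

(** * Deletion, contraction and exchanges in a forest with named edges *)

Section NamedForests.
Variables (D : Type) (E : eqType).
Variable times : D -> D -> D.
Local Notation NF := (seq (E * tree D E)).
Implicit Types (J I : pred E) (X Y Z : NF) (d : D) (x y e : E).

Lemma eq_in_forest_fold W n (c c' : E -> D -> W -> W -> W) X :
  (forall x, x \in forest_labels X -> forall d u w, c x d u w = c' x d u w) ->
  forest_fold n c X = forest_fold n c' X.
Proof.
elim/planted_ind: X => [|x d Y X IHY IHX] // e.
rewrite !forest_fold_cons e ?mem_head // IHY ?IHX // => y yX; apply: e;
  by rewrite forest_labels_cons inE mem_cat yX ?orbT.
Qed.

(* The component of the root and the other components after the edges outside I
   are deleted. *)
Definition del I : NF -> NF * seq (tree D E) :=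
  forest_fold ([::], [::]) (fun x d u w =>
    if I x then ((x, Node d u.1) :: w.1, u.2 ++ w.2)
    else (w.1, Node d u.1 :: u.2 ++ w.2)).

(* What the root absorbs, and its children, after the edges of I are
   contracted. *)
Definition con I : NF -> option D * NF :=
  forest_fold (None, [::]) (fun x d u w =>
    if I x then (Some (dmul times (dmul times d u.1) w.1), u.2 ++ w.2)
    else (w.1, (x, Node (dmul times d u.1) u.2) :: w.2)).

(* The root edges of the contracted forest, and the exchanges of types to be
   performed. *)
Definition ops I : NF -> seq E * seq (E * E) :=
  forest_fold ([::], [::]) (fun x d u w =>
    (if I x then u.1 ++ w.1 else x :: w.1,
     u.2 ++ (if I x then [seq (x, r) | r <- u.1] else [::]) ++ w.2)).

Lemma del_cons I x d Y X : del I ((x, Node d Y) :: X) =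
  if I x then ((x, Node d (del I Y).1) :: (del I X).1, (del I Y).2 ++ (del I X).2)
  else ((del I X).1, Node d (del I Y).1 :: (del I Y).2 ++ (del I X).2).
Proof. by []. Qed.

Lemma con_cons I x d Y X : con I ((x, Node d Y) :: X) =
  if I x then (Some (dmul times (dmul times d (con I Y).1) (con I X).1),
               (con I Y).2 ++ (con I X).2)
  else ((con I X).1,
        (x, Node (dmul times d (con I Y).1) (con I Y).2) :: (con I X).2).
Proof. by []. Qed.

Lemma ops_cons I x d Y X : ops I ((x, Node d Y) :: X) =
  (if I x then (ops I Y).1 ++ (ops I X).1 else x :: (ops I X).1,
   (ops I Y).2 ++ (if I x then [seq (x, r) | r <- (ops I Y).1] else [::])
     ++ (ops I X).2).
Proof. by []. Qed.

Lemma eq_in_del I I' X : {in forest_labels X, I =1 I'} -> del I X = del I' X.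
Proof. by move=> e; apply: eq_in_forest_fold => x xX d y w; rewrite e. Qed.

Lemma eq_in_con I I' X : {in forest_labels X, I =1 I'} -> con I X = con I' X.
Proof. by move=> e; apply: eq_in_forest_fold => x xX d y w; rewrite e. Qed.

Lemma eq_in_ops I I' X : {in forest_labels X, I =1 I'} -> ops I X = ops I' X.
Proof. by move=> e; apply: eq_in_forest_fold => x xX d y w; rewrite e. Qed.

Lemma con_roots I X : [seq z.1 | z <- (con I X).2] = (ops I X).1.
Proof.
elim/planted_ind: X => [|x d Y X IHY IHX] //.
by rewrite con_cons ops_cons; case: (I x); rewrite /= ?map_cat IHX ?IHY.
Qed.

Lemma forest_labels_cat X Y :
  forest_labels (X ++ Y) = forest_labels X ++ forest_labels Y.
Proof. by rewrite /forest_labels map_cat flatten_cat. Qed.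

Lemma flabels_cons (L : Type) t (F : seq (tree D L)) :
  flabels (t :: F) = labels t ++ flabels F.
Proof. by []. Qed.

Lemma flabels_cat (L : Type) (F F' : seq (tree D L)) :
  flabels (F ++ F') = flabels F ++ flabels F'.
Proof. by rewrite /flabels map_cat flatten_cat. Qed.

Lemma labels_con I X :
  forest_labels (con I X).2 = filter (predC I) (forest_labels X).
Proof.
elim/planted_ind: X => [|x d Y X IHY IHX] //.
rewrite con_cons forest_labels_cons /= filter_cat.
case: (I x) => /=; first by rewrite forest_labels_cat IHX IHY.
by rewrite forest_labels_cons IHX IHY.
Qed.

Lemma labels_del I X :
  perm_eq (forest_labels (del I X).1 ++ flabels (del I X).2)
    (filter I (forest_labels X)).
Proof.
elim/planted_ind: X => [|x d Y X IHY IHX] //.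
rewrite del_cons forest_labels_cons /= filter_cat; case: (I x).
  rewrite forest_labels_cons cat_cons perm_cons flabels_cat perm_catACA.
  exact: perm_cat.
rewrite flabels_cons labels_node flabels_cat perm_catCA catA perm_catACA.
exact: perm_cat.
Qed.

Lemma ops_all I X : {in forest_labels X, forall x, I x} ->
  ops I X = ([::], [::]).
Proof.
elim/planted_ind: X => [|x d Y X IHY IHX] // a.
rewrite ops_cons IHY ?IHX ?a ?mem_head // => y yX; apply: a;
  by rewrite forest_labels_cons inE mem_cat yX ?orbT.
Qed.

Lemma del_all I X : {in forest_labels X, forall x, I x} ->
  del I X = (X, [::]).
Proof.
elim/planted_ind: X => [|x d Y X IHY IHX] // a.
rewrite del_cons IHY ?IHX ?a ?mem_head // => y yX; apply: a;
  by rewrite forest_labels_cons inE mem_cat yX ?orbT.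
Qed.

Lemma mem_labels_con I X e :
  (e \in forest_labels (con I X).2) = (e \in forest_labels X) && ~~ I e.
Proof. by rewrite labels_con mem_filter andbC. Qed.

Lemma mem_labels_del1 I X e :
  e \in forest_labels (del I X).1 -> (e \in forest_labels X) && I e.
Proof.
by move=> ed; have := perm_mem (labels_del I X) e;
   rewrite mem_cat ed mem_filter andbC.
Qed.

Lemma mem_labels_del2 I X e :
  e \in flabels (del I X).2 -> (e \in forest_labels X) && I e.
Proof.
by move=> ed; have := perm_mem (labels_del I X) e;
   rewrite mem_cat ed orbT mem_filter andbC.
Qed.

Lemma mem_roots I X e : e \in (ops I X).1 -> (e \in forest_labels X) && ~~ I e.
Proof.
elim/planted_ind: X e => [|x d Y X IHY IHX] e //.
rewrite ops_cons forest_labels_cons inE mem_cat; case Ix: (I x) => /=.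
  by rewrite mem_cat => /orP[/IHY|/IHX] /andP[-> ->]; rewrite !orbT.
rewrite inE => /orP[/eqP ->|/IHX /andP[-> ->]]; last by rewrite !orbT.
by rewrite eqxx Ix.
Qed.

Lemma ops_in I X : all (fun xe => [&& xe.1 \in forest_labels X,
  xe.2 \in forest_labels X, I xe.1 & ~~ I xe.2]) (ops I X).2.
Proof.
elim/planted_ind: X => [|x d Y X IHY IHX] //.
rewrite ops_cons /= !all_cat; apply/and3P; split.
- apply: sub_all IHY => -[a b] /= /and4P[aY bY -> ->].
  by rewrite forest_labels_cons !inE !mem_cat aY bY !orbT.
- case Ix: (I x) => //; apply/allP => -[a b] /mapP[r /mem_roots /andP[rY Ir]].
  move=> [-> ->] /=; rewrite Ix Ir forest_labels_cons mem_head.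
  by rewrite !inE !mem_cat rY !orbT.
- apply: sub_all IHX => -[a b] /= /and4P[aY bY -> ->].
  by rewrite forest_labels_cons !inE !mem_cat aY bY !orbT.
Qed.

End NamedForests.

(** * The expansion of a named forest as a sum over sets of edges *)

Section Linking.
Variables (D : Type) (E : eqType) (iota : finType) (R : comNzRingType).
Variable phi : iota -> iota -> iota -> iota -> R.
Variable times : D -> D -> D.
Local Notation NF := (seq (E * tree D E)).
Local Notation T := (tree D iota).
Local Notation PF := (seq (iota * T)).
Implicit Types (J I : pred E) (X Y Z : NF) (d : D) (x y e : E).
Implicit Types (ty t : E -> iota).

Lemma pass_named x Z ty (h : iota -> PF -> R) : uniq (x :: forest_labels Z) ->
  esum2 (pass phi (ty x) (relabel_forest ty Z)) h
  = runs phi [seq (x, r) | r <- [seq z.1 | z <- Z]]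
      (fun t => h (t x) (relabel_forest t Z)) ty.
Proof.
rewrite cons_uniq => /andP[]; elim: Z ty h => [|[y [d Y]] Z IH] ty h; first by rewrite pass_nil.
rewrite forest_labels_cons inE mem_cat !negb_or cons_uniq mem_cat negb_or cat_uniq.
case/and3P=> xy xY xZ /andP[/andP[yY yZ] /and3P[uY YZ uZ]].
rewrite relabel_forest_cons pass_cons /= /exch_op; apply: eq_esum2 => k l.
set ty' := upd _ x l.
have -> : l = ty' x by rewrite /ty' /upd eqxx.
have -> : relabel_forest ty Z = relabel_forest ty' Z.
  apply: eq_in_relabel_forest => z zZ; rewrite /ty' /upd /= !ifN //.
    by apply: contraNneq yZ => <-.
  by apply: contraNneq xZ => <-.
rewrite IH //.
apply: (@runs_ext _ _ _ _ [pred z | (z == x) || (z \in forest_labels Z)]) => //.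
  apply/allP => -[a b] /mapP[r /mapP[[r' s] rs ->] [-> ->]] /=.
  rewrite eqxx; apply/orP; right; apply/flatten_mapP; exists (r', s) => //=.
  exact: mem_head.
move=> t t' tt' tS t'S.
have e : t' =1 t.
  move=> z; case zS: (z \in [pred z | (z == x) || (z \in forest_labels Z)]).
    by rewrite tt'.
  by rewrite tS ?t'S // inE /= -[_ || _]/(z \in [pred z | (z == x) || (z \in forest_labels Z)]) zS.
have {e} -> : t' = t by apply/funext.
rewrite relabel_forest_cons; congr (h _ ((_, Node _ _) :: _)).
  rewrite tS; last by rewrite inE /= negb_or eq_sym xy.
  by rewrite /ty' /upd /= eqxx ifN // eq_sym.
apply: eq_in_relabel_forest => z zY; rewrite tS.
  rewrite /ty' /upd /= !ifN //; first by apply: contraNneq yY => <-.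
  by apply: contraNneq xY => <-.
rewrite inE /= negb_or; apply/andP; split; first by apply: contraNneq xY => <-.
by apply: contra YZ => zZ; apply/hasP; exists z.
Qed.

Section Expand.
Variable al : T -> R.

(** The summand of [expand] for the set [I], read off the typing [t] reached after the exchanges. *)
Definition term I X (h : PF -> option D -> PF -> R) t : R :=
  (\prod_(s <- (del I X).2) al (relabel t s)) *
  h (relabel_forest t (del I X).1) (con times I X).1
    (relabel_forest t (con times I X).2).

Lemma eq_in_prod_relabel t t' (F : seq (tree D E)) :
  {in flabels F, t =1 t'} ->
  \prod_(s <- F) al (relabel t s) = \prod_(s <- F) al (relabel t' s).
Proof.
elim: F => [|s F IH] e; first by rewrite !big_nil.
rewrite !big_cons IH => [|x xF]; last first.
  by apply: e; rewrite flabels_cons mem_cat xF orbT.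
rewrite (eq_in_relabel (h := t')) // => x xs.
by apply: e; rewrite flabels_cons mem_cat xs.
Qed.

Lemma eq_in_term I X h t t' : {in forest_labels X, t =1 t'} ->
  term I X h t = term I X h t'.
Proof.
move=> e; rewrite /term (eq_in_prod_relabel (t' := t')) => [|x].
  congr (_ * h _ _ _); apply: eq_in_relabel_forest => x.
    by case/mem_labels_del1/andP => xX _; apply: e.
  by rewrite mem_labels_con => /andP[xX _]; apply: e.
by case/mem_labels_del2/andP => xX _; apply: e.
Qed.

(** A set of edges splits into its part [J1] below the first edge, its part [J2] in the remaining
    forest, and possibly the first edge itself. The recursion of [expand] nests the runs of these
    parts, which [runs_merge] makes into one. *)
Lemma expand_named X ty h : uniq (forest_labels X) ->
  esum3 (expand phi times al (relabel_forest ty X)) h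
  = \sum_(J <- subs (forest_labels X))
      runs phi (ops (mem J) X).2 (term (mem J) X h) ty.
Proof.
elim/planted_ind: X ty h => [|x d Y X IHY IHX] ty h.
  by rewrite expand_nil big_seq1 /= /term big_nil mul1r.
rewrite forest_labels_cons cons_uniq mem_cat negb_or cat_uniq.
case/andP => /andP[xY xX] /and3P[uY YX uX].
have dYX z : z \in forest_labels Y -> z \notin forest_labels X.
  by move=> zY; apply: contra YX => zX; apply/hasP; exists z.
rewrite relabel_forest_cons expand_cons IHY //.
rewrite big_subs_cons !big_subs_cat -big_split.
apply: eq_big_seq => J1 sJ1; rewrite -big_split.
have J1X z : z \in forest_labels X -> z \notin J1.
  by apply: contraL => /(mem_subs sJ1) /dYX.
have xJ1 : x \notin J1 by apply: contra xY => /(mem_subs sJ1).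
set LY := (ops (mem J1) Y).2; set RY := (ops (mem J1) Y).1.
set Lx := [seq (x, r) | r <- RY].
set kY := (del (mem J1) Y).1; set oY := (con times (mem J1) Y).1.
set CY := (con times (mem J1) Y).2.
pose P1 t := \prod_(s <- (del (mem J1) Y).2) al (relabel t s).
(* [GA] is the summand when [x] is outside the set and [GB] when it is inside. The typing [t1]
   serves [x] and the edges of [Y], and [t2] those of [X]. *)
pose GA (J2 : seq E) t1 t2 := P1 t1 * al (Node d (relabel_forest t1 kY)) *
  term (mem J2) X (fun p o q => h p o
    ((t1 x, Node (dmul times d oY) (relabel_forest t1 CY)) :: q)) t2.
pose GB (J2 : seq E) t1 t2 := P1 t1 *
  term (mem J2) X (fun p o q => h ((t1 x, Node d (relabel_forest t1 kY)) :: p)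
    (Some (dmul times (dmul times d oY) o)) (relabel_forest t1 CY ++ q)) t2.
pose V (G : seq E -> (E -> iota) -> (E -> iota) -> R) t1 :=
  \sum_(J2 <- subs (forest_labels X)) runs phi (ops (mem J2) X).2 (G J2 t1) ty.
pose S := [pred z | (z == x) || (z \in forest_labels Y)].
have LYS : all (fun xe => S xe.1 && S xe.2) LY.
  by apply/allP => -[u v] /(allP (ops_in _ _)) /= /and4P[-> -> _ _]; rewrite !orbT.
have LxS : all (fun xe => S xe.1 && S xe.2) Lx.
  apply/allP => -[u v] /mapP[r /mem_roots /andP[rY _] [-> ->]] /=.
  by rewrite eqxx rY orbT.
have SX z : S z -> z \notin forest_labels X.
  by case/orP => [/eqP -> //|]; apply: dYX.
have L2X (J2 : seq E) : all (fun xe => (xe.1 \in forest_labels X) && (xe.2 \in forest_labels X))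
    (ops (mem J2) X).2.
  by apply/allP => -[u v] /(allP (ops_in _ _)) /= /and4P[-> -> _ _].
have eqY t1 t1' (Z : NF) : {in S, t1 =1 t1'} ->
    {subset forest_labels Z <= forest_labels Y} ->
    relabel_forest t1 Z = relabel_forest t1' Z.
  move=> e sZ; apply: eq_in_relabel_forest => z /sZ zY; apply: e.
  by rewrite inE /= zY orbT.
have skY : {subset forest_labels kY <= forest_labels Y}.
  by move=> z /mem_labels_del1 /andP[].
have sCY : {subset forest_labels CY <= forest_labels Y}.
  by move=> z; rewrite mem_labels_con => /andP[].
have xS : x \in S by rewrite inE /= eqxx.
have eqP1 t1 t1' : {in S, t1 =1 t1'} -> P1 t1 = P1 t1'.
  move=> e; apply: eq_in_prod_relabel => z /mem_labels_del2 /andP[zY _].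
  by apply: e; rewrite inE /= zY orbT.
have exA (J2 : seq E) t1 t1' t2 t2' : {in S, t1 =1 t1'} ->
    {in forest_labels X, t2 =1 t2'} -> GA J2 t1 t2 = GA J2 t1' t2'.
  move=> e1 e2; rewrite /GA (eqP1 t1 t1') // (eqY t1 t1' kY) // (eqY t1 t1' CY) //.
  by rewrite (e1 x xS) (eq_in_term _ _ e2).
have exB (J2 : seq E) t1 t1' t2 t2' : {in S, t1 =1 t1'} ->
    {in forest_labels X, t2 =1 t2'} -> GB J2 t1 t2 = GB J2 t1' t2'.
  move=> e1 e2; rewrite /GB (eqP1 t1 t1') // (eqY t1 t1' kY) // (eqY t1 t1' CY) //.
  by rewrite (e1 x xS) (eq_in_term _ _ e2).
transitivity (runs phi LY (fun t1 => V GA t1 + runs phi Lx (V GB) t1) ty).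
  apply: (@runs_ext _ _ _ _ (mem (forest_labels Y))) => //.
    by apply/allP => -[u v] /(allP (ops_in _ _)) /= /and4P[-> -> _ _].
  move=> t1 t1' e1 t1Y t1'Y.
  have {e1 t1'Y}<- : t1 = t1'.
    apply/funext => z; case zY: (z \in forest_labels Y); first exact: e1.
    by rewrite t1Y ?t1'Y // inE /= zY.
  have t1x : t1 x = ty x by apply: t1Y; rewrite inE.
  rewrite /term -/(P1 t1) -/kY -/CY -/oY mulrDr; congr (_ + _).
    rewrite IHX // mulrA mulr_sumr; apply: eq_bigr => J2 _.
    by rewrite -runs_mull -t1x.
  rewrite -t1x pass_named; last first.
    rewrite /= labels_con mem_filter negb_and xY orbT /=.
    exact: filter_uniq.
  rewrite con_roots -/RY -/Lx -runs_mull.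
  apply: (@runs_ext _ _ _ _ [pred z | (z == x) || (z \in forest_labels CY)]) => //.
    apply/allP => -[u v] /mapP[r rY [-> ->]] /=; rewrite eqxx /=.
    have /andP[rY1 rJ] := mem_roots rY.
    by rewrite mem_labels_con rY1 rJ orbT.
  move=> t t' tt' tS t'S.
  have {tt' t'S}<- : t = t'.
    apply/funext => z; case zS: (z \in [pred z | (z == x) || (z \in forest_labels CY)]).
      exact: tt'.
    by rewrite tS ?t'S // inE /= -[_ || _]/(z \in [pred z | (z == x) || (z \in forest_labels CY)]) zS.
  have tJ z : z \in forest_labels Y -> z \in J1 -> t1 z = t z.
    move=> zY zJ; rewrite tS // inE /= negb_or mem_labels_con /= zJ andbF andbT.
    by apply: contraNneq xY => <-.
  have -> : P1 t1 = P1 t.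
    apply: eq_in_prod_relabel => z /mem_labels_del2 /andP[]; exact: tJ.
  have -> : relabel_forest t1 kY = relabel_forest t kY.
    apply: eq_in_relabel_forest => z /mem_labels_del1 /andP[]; exact: tJ.
  rewrite IHX // mulr_sumr; apply: eq_bigr => J2 _.
  by rewrite -runs_mull.
have rD L G G' : runs phi L (fun t => G t + G' t) ty = runs phi L G ty + runs phi L G' ty.
  pose F (b : bool) := if b then G else G'.
  transitivity (runs phi L (fun t => \sum_(b <- [:: true; false]) F b t) ty).
    by apply: eq_runs => t; rewrite big_cons big_seq1.
  by rewrite runs_sum big_cons big_seq1.
rewrite rD -runs_cat /V !runs_sum -big_split; apply: eq_big_seq => J2 sJ2.
have J2Y z : z \in forest_labels Y -> z \notin J2.
  by apply: contraL => /(mem_subs sJ2); apply: contraL; apply: dYX.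
have xJ2 : x \notin J2 by apply: contra xX => /(mem_subs sJ2).
have eY1 : {in forest_labels Y, mem (J1 ++ J2) =1 mem J1}.
  by move=> z /J2Y zJ /=; rewrite mem_cat (negbTE zJ) orbF.
have eX1 : {in forest_labels X, mem (J1 ++ J2) =1 mem J2}.
  by move=> z /J1X zJ /=; rewrite mem_cat (negbTE zJ).
have eY2 : {in forest_labels Y, mem (x :: J1 ++ J2) =1 mem J1}.
  move=> z zY /=; rewrite inE mem_cat (negbTE (J2Y z zY)) orbF.
  by case: eqP => // zx; rewrite -zx zY in xY.
have eX2 : {in forest_labels X, mem (x :: J1 ++ J2) =1 mem J2}.
  move=> z zX /=; rewrite inE mem_cat (negbTE (J1X z zX)).
  by case: eqP => // zx; rewrite -zx zX in xX.
rewrite (@runs_merge _ _ _ phi S (mem (forest_labels X)) _ _ (GA J2) ty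
  LYS (L2X J2) SX (exA J2)).
have LYxS : all (fun xe => S xe.1 && S xe.2) (LY ++ Lx) by rewrite all_cat LYS.
rewrite (@runs_merge _ _ _ phi S (mem (forest_labels X)) _ _ (GB J2) ty
  LYxS (L2X J2) SX (exB J2)).
have nx1 : mem (J1 ++ J2) x = false by rewrite /= mem_cat (negbTE xJ1) (negbTE xJ2).
have nx2 : mem (x :: J1 ++ J2) x by rewrite /= mem_head.
congr (_ + _).
  rewrite !ops_cons nx1 /= (eq_in_ops eY1) (eq_in_ops eX1); apply: eq_runs => t.
  rewrite /GA /term del_cons con_cons nx1 (eq_in_del eY1) (eq_in_del eX1).
  rewrite (eq_in_con _ eY1) (eq_in_con _ eX1) /= big_cons big_cat /=.
  by rewrite /P1 -/kY; ring.
rewrite !ops_cons nx2 /= (eq_in_ops eY2) (eq_in_ops eX2) -catA; apply: eq_runs => t.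
rewrite /GB /term del_cons con_cons nx2 (eq_in_del eY2) (eq_in_del eX2).
rewrite (eq_in_con _ eY2) (eq_in_con _ eX2) /= big_cat /=.
rewrite /relabel_forest map_cat -/(relabel_forest t _) /P1.
by rewrite mulrA.
Qed.

End Expand.
End Linking.

(** * Cuts and contractions of named forests *)

Section NamedCuts.
Variables (D : Type) (E : eqType).
Local Notation NF := (seq (E * tree D E)).
Implicit Types (J I : pred E) (X Y Z : NF) (d : D) (x e : E).
Implicit Types (t : tree D E) (F : seq (tree D E)).

(** The second component of the fold records that no edge at all is cut, the condition to be met
    below a cut edge. *)
Definition admis J X : bool :=
  (forest_fold (true, true) (fun x _ u w =>
    ((if J x then u.2 else u.1) && w.1, [&& ~~ J x, u.2 & w.2])) X).1.

(* The planted forest of the parts cut off. *)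
Definition cutq J X : NF :=
  (forest_fold ([::], [::]) (fun x d u w =>
    ((x, Node d u.1) :: w.1, if J x then (x, Node d u.1) :: w.2 else u.2 ++ w.2)) X).2.

Lemma admis_cons J x d Y X : admis J ((x, Node d Y) :: X) =
  (if J x then ~~ has J (forest_labels Y) else admis J Y) && admis J X.
Proof.
rewrite /admis forest_fold_cons /=; congr ((if _ then _ else _) && _).
elim/planted_ind: Y => [|y e Y Z IHY IHZ] //.
by rewrite forest_labels_cons forest_fold_cons /= has_cat !negb_or IHY IHZ.
Qed.

Lemma cutq_cons J x d Y X : cutq J ((x, Node d Y) :: X) =
  if J x then (x, Node d Y) :: cutq J X else cutq J Y ++ cutq J X.
Proof.
rewrite /cutq forest_fold_cons /=; congr (if _ then (_, Node _ _) :: _ else _).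
elim/planted_ind: Y => [|y e Y Z IHY IHZ] //.
by rewrite forest_fold_cons /= IHY IHZ.
Qed.

Lemma eq_in_cutq J J' X : {in forest_labels X, J =1 J'} -> cutq J X = cutq J' X.
Proof.
by move=> e; congr (_.2); apply: eq_in_forest_fold => x xX d u w; rewrite e.
Qed.

Lemma eq_in_admis J J' X : {in forest_labels X, J =1 J'} -> admis J X = admis J' X.
Proof.
by move=> e; congr (_.1); apply: eq_in_forest_fold => x xX d u w; rewrite e.
Qed.

Lemma cutq_subseq J X : subseq (forest_labels (cutq J X)) (forest_labels X).
Proof.
elim/planted_ind: X => [|x d Y X IHY IHX] //.
rewrite cutq_cons; case: (J x).
  by rewrite !forest_labels_cons -!cat_cons; apply: cat_subseq.
rewrite forest_labels_cat forest_labels_cons.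
by apply: subseq_trans (subseq_cons _ _); apply: (cat_subseq IHY IHX).
Qed.

Lemma cutq_roots J X : admis J X ->
  [seq z.1 | z <- cutq J X] = (ops (predC J) X).1.
Proof.
elim/planted_ind: X => [|x d Y X IHY IHX] //.
rewrite admis_cons cutq_cons ops_cons /=; case: (J x) => /= /andP[aY aX].
  by rewrite IHX.
by rewrite map_cat IHX // IHY.
Qed.

(** No cut edge lies below another one, so that contracting the uncut edges brings every cut edge to
    the root. *)
Lemma admis_mem_roots J X e : admis J X -> e \in forest_labels X -> J e ->
  e \in (ops (predC J) X).1.
Proof.
elim/planted_ind: X => [|x d Y X IHY IHX] //.
rewrite admis_cons ops_cons forest_labels_cons inE mem_cat /=.
case Jx: (J x) => /= /andP[aY aX].
  rewrite inE; case: eqP => //= _ /orP[eY Je|eX Je]; last exact: IHX.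
  by case/hasP: aY; exists e.
rewrite mem_cat; case/or3P => [/eqP ->|eY|eX] Je.
- by rewrite Jx in Je.
- by rewrite IHY.
- by rewrite IHX ?orbT.
Qed.

Lemma roots_subseq I X : subseq (ops I X).1 (forest_labels X).
Proof.
elim/planted_ind: X => [|x d Y X IHY IHX] //.
rewrite ops_cons forest_labels_cons; case: (I x).
  by apply: subseq_trans (subseq_cons _ _); apply: (cat_subseq IHY IHX).
rewrite /= eqxx; exact: subseq_trans IHX (suffix_subseq _ _).
Qed.

Lemma path_to_cons e d0 x d Y X :
  path_to e (Node d0 ((x, Node d Y) :: X))
  = (if e \in forest_labels Y then x :: path_to e (Node d Y) else [::])
    ++ path_to e (Node d0 X).
Proof. by []. Qed.

Lemma path_to_none e t : e \notin labels t -> path_to e t = [::].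
Proof.
case: t => d0 X; rewrite labels_node.
elim: X => [|[x [d Y]] X IH] //.
rewrite forest_labels_cons inE mem_cat !negb_or => /and3P[_ eY eX].
by rewrite path_to_cons (negbTE eY) IH.
Qed.

Lemma fpath_to_none e F : e \notin flabels F -> fpath_to e F = [::].
Proof.
elim: F => [|t F IH] //; rewrite flabels_cons mem_cat negb_or => /andP[et eF].
by rewrite /fpath_to /= path_to_none // -/(fpath_to e F) IH.
Qed.

Lemma fpath_to_cons e t F : fpath_to e (t :: F) = path_to e t ++ fpath_to e F.
Proof. by []. Qed.

Lemma fpath_to_cat e F F' : fpath_to e (F ++ F') = fpath_to e F ++ fpath_to e F'.
Proof. by rewrite /fpath_to map_cat flatten_cat. Qed.

Definition ops_at e (L : seq (E * E)) := [seq xe <- L | xe.2 == e].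

Lemma ops_at_none e I X : e \notin forest_labels X -> ops_at e (ops I X).2 = [::].
Proof.
move=> eX; apply/eqP; rewrite -[_ == _]negbK -has_filter; apply/negP => /hasP[[x y]].
move/(allP (ops_in _ _)) => /= /and4P[_ yX _ _] /eqP ye.
by rewrite -ye yX in eX.
Qed.

Lemma ops_at_link e x s : uniq s ->
  ops_at e [seq (x, r) | r <- s] = if e \in s then [:: (x, e)] else [::].
Proof.
elim: s => [|r s IH] //= /andP[rs us]; rewrite inE IH // [e == r]eq_sym.
by case: eqP => [<-|] //=; rewrite (negbTE rs).
Qed.

(** A cut edge crosses the edges above it starting with the nearest one, whence the reversed
    path. *)
Lemma ops_at_cut e d0 J X : uniq (forest_labels X) -> admis J X ->
  e \in forest_labels X -> J e ->
  ops_at e (ops (predC J) X).2 = [seq (x, e) | x <- rev (path_to e (Node d0 X))].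
Proof.
elim/planted_ind: X d0 => [|x d Y X IHY IHX] d0 //.
rewrite forest_labels_cons cons_uniq mem_cat negb_or cat_uniq.
case/andP => /andP[xY xX] /and3P[uY YX uX].
have dYX z : z \in forest_labels Y -> z \notin forest_labels X.
  by move=> zY; apply: contra YX => zX; apply/hasP; exists z.
rewrite admis_cons inE mem_cat => /andP[aY aX] eYX Je.
rewrite path_to_cons ops_cons [X in ops_at e X]/= /ops_at !filter_cat.
rewrite -!/(ops_at _ _); case/or3P: eYX => [/eqP ex|eY|eX].
- rewrite -ex in xY xX *; rewrite (@path_to_none e (Node d0 X)) // Je.
  by rewrite (negbTE xY) !ops_at_none.
- have Jx : J x = false.
    apply: negbTE; apply/negP => Jx; rewrite Jx in aY.
    by move: aY => /hasP; apply; exists e.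
  rewrite (@path_to_none e (Node d0 X)) ?labels_node ?dYX // cats0 eY.
  rewrite Jx in aY *; rewrite (IHY d) // ops_at_link; last first.
    exact: subseq_uniq (roots_subseq _ _) uY.
  rewrite admis_mem_roots // (ops_at_none _ (dYX e eY)) cats0.
  by rewrite rev_cons map_rcons cats1.
- have eY : e \notin forest_labels Y by apply: contraL eX => /dYX.
  rewrite (negbTE eY) (ops_at_none _ eY) -(IHX d0) //.
  case: (J x) => //; rewrite ops_at_link; last first.
    exact: subseq_uniq (roots_subseq _ _) uY.
  by case: ifP => // /mem_roots /andP[]; rewrite (negbTE eY).
Qed.

Lemma del1_cons I x d Y X : (del I ((x, Node d Y) :: X)).1 =
  if I x then (x, Node d (del I Y).1) :: (del I X).1 else (del I X).1.
Proof. by rewrite del_cons; case: (I x). Qed.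

Lemma del2_cons I x d Y X : (del I ((x, Node d Y) :: X)).2 =
  if I x then (del I Y).2 ++ (del I X).2
  else Node d (del I Y).1 :: (del I Y).2 ++ (del I X).2.
Proof. by rewrite del_cons; case: (I x). Qed.

(** Once [e] is kept together with [I], it lies in the root component exactly when all the edges
    above it are in [I], that is, when it is a root edge of the contraction. *)
Lemma mem_del_roots e I X : ~~ I e ->
  (e \in forest_labels (del [pred z | (z == e) || I z] X).1)
  = (e \in (ops I X).1).
Proof.
move=> Ie; elim/planted_ind: X => [|x d Y X IHY IHX] //.
rewrite del_cons ops_cons /=; case: (eqVneq x e) => [->|xe] /=.
  by rewrite (negbTE Ie) forest_labels_cons !inE eqxx.
case: (I x) => /=; first by rewrite forest_labels_cons inE eq_sym (negbTE xe) !mem_cat IHY IHX.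
by rewrite inE eq_sym (negbTE xe).
Qed.

(** The other edges outside [I] being deleted, [e] lies in at most one of the components, so that at
    most one of the two paths is nonempty. *)
Lemma ops_at_contract e d0 I X : uniq (forest_labels X) -> ~~ I e ->
  let DX := del [pred z | (z == e) || I z] X in
  ops_at e (ops I X).2
  = [seq (x, e) | x <- rev (path_to e (Node d0 DX.1) ++ fpath_to e DX.2)].
Proof.
move=> + Ie; set I' := [pred z | _]; cbv zeta.
have none Z : e \notin forest_labels Z ->
    (forall d, path_to e (Node d (del I' Z).1) = [::]) /\ fpath_to e (del I' Z).2 = [::].
  move=> eZ; split=> [d|]; [apply: path_to_none|apply: fpath_to_none].
    by apply: contra eZ => /mem_labels_del1 /andP[].
  by apply: contra eZ => /mem_labels_del2 /andP[].
elim/planted_ind: X d0 => [|x d Y X IHY IHX] d0 //.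
rewrite forest_labels_cons cons_uniq mem_cat negb_or cat_uniq.
case/andP => /andP[xY xX] /and3P[uY YX uX].
have dYX z : z \in forest_labels Y -> z \notin forest_labels X.
  by move=> zY; apply: contra YX => zX; apply/hasP; exists z.
have uR : uniq (ops I Y).1 by apply: subseq_uniq (roots_subseq _ _) uY.
rewrite ops_cons del1_cons del2_cons [X in ops_at e X]/= /ops_at !filter_cat.
rewrite -!/(ops_at _ _).
have -> : I' x = (x == e) || I x by []; case: (eqVneq x e) => [xe|xe].
  rewrite xe in xY xX *; rewrite (negbTE Ie) !ops_at_none //.
  have [nX fX] := none _ xX; have [nY fY] := none _ xY.
  rewrite path_to_cons nX fpath_to_cat fX fY ifN //.
  by apply: contra xY => /mem_labels_del1 /andP[].
case eY: (e \in forest_labels Y).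
  have [nX fX] := none _ (dYX _ eY); rewrite (ops_at_none _ (dYX _ eY)) (IHY d) //.
  case Ix: (I x); last first.
    by rewrite orFb nX fpath_to_cons fpath_to_cat fX !cats0.
  rewrite orFb path_to_cons nX fpath_to_cat fX !cats0 ops_at_link // mem_del_roots //.
  case: ifP => eR.
    have eC : e \notin flabels (del I' Y).2.
      apply/negP => eC.
      have : uniq (forest_labels (del I' Y).1 ++ flabels (del I' Y).2).
        by rewrite (perm_uniq (labels_del _ _)) filter_uniq.
      rewrite cat_uniq => /and3P[_ /hasP[]]; exists e => //.
      by rewrite /= mem_del_roots.
    by rewrite (fpath_to_none eC) !cats0 rev_cons map_rcons cats1.
  by rewrite path_to_none ?labels_node ?mem_del_roots ?eR // cats0.
have [nY fY] := none _ (negbT eY); rewrite (ops_at_none _ (negbT eY)) orFb.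
case Ix: (I x).
  rewrite ops_at_link // ifN; last first.
    by apply: contraFN eY => /mem_roots /andP[].
  rewrite path_to_cons ifN ?fpath_to_cat ?fY ?(IHX d0) //.
  by apply: contraFN eY => /mem_labels_del1 /andP[].
by rewrite fpath_to_cons fpath_to_cat nY fY (IHX d0).
Qed.

Lemma delete_edges_cons (c : pred E) d x t X :
  delete_edges c (Node d ((x, t) :: X))
  = let r := delete_edges c t in let r' := delete_edges c (Node d X) in
    if c x then (Node d (children r'.1), r.1 :: r.2 ++ r'.2)
    else (Node d ((x, r.1) :: children r'.1), r.2 ++ r'.2).
Proof. by rewrite /=; case: (c x). Qed.

Lemma delete_edgesE (c : pred E) d X :
  delete_edges c (Node d X)
  = (Node d (del (predC c) X).1, (del (predC c) X).2).
Proof.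
elim/planted_ind: X d => [|x e Y X IHY IHX] d //.
rewrite delete_edges_cons IHY IHX del1_cons del2_cons.
have -> : predC c x = ~~ c x by []; by case: (c x).
Qed.

Lemma leaf_paths_cons (P : pred (seq E)) d0 x t X : P [::] ->
  all P (leaf_paths (Node d0 ((x, t) :: X)))
  = all (fun p => P (x :: p)) (leaf_paths t) && all P (leaf_paths (Node d0 X)).
Proof.
move=> P0 /=; rewrite all_cat all_map; congr (_ && _).
by case: X => //=; rewrite P0.
Qed.

Lemma leaf_paths_neq0 d X : leaf_paths (Node d X) <> [::].
Proof.
elim/planted_ind: X d => [|x e Y X IHY IHX] d //.
rewrite -[leaf_paths _]/([seq x :: p | p <- leaf_paths (Node e Y)]
  ++ flatten [seq [seq z.1 :: p | p <- leaf_paths z.2] | z <- X]).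
by case: (leaf_paths (Node e Y)) (IHY e).
Qed.

Lemma admisE J d X :
  all (fun p => (count J p <= 1)%N) (leaf_paths (Node d X)) = admis J X.
Proof.
elim/planted_ind: X d => [|x e Y X IHY IHX] d //.
rewrite leaf_paths_cons // IHX admis_cons; congr (_ && _).
case Jx: (J x); last first.
  by rewrite -(IHY e); apply: eq_all => p; rewrite /= Jx.
(* Below a cut edge the bound becomes 0 on every path to a leaf; as these paths cover all edges, no
   edge is cut there. *)
have -> : all (fun p => count J (x :: p) <= 1)%N (leaf_paths (Node e Y))
    = all (fun p => count J p == 0)%N (leaf_paths (Node e Y)).
  by apply: eq_all => p; rewrite /= Jx add1n ltnS leqn0.
move: e {IHX IHY X Jx}; elim/planted_ind: Y => [|y a Y X IHY IHX] e //.
rewrite leaf_paths_cons // IHX forest_labels_cons -cat1s !has_cat has_seq1.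
rewrite !negb_or.
rewrite andbA; congr (_ && _); rewrite -(IHY a).
case Jy: (J y); last by apply: eq_all => p; rewrite /= Jy.
have := @leaf_paths_neq0 a Y; case: (leaf_paths (Node a Y)) => [|p s] n0.
  by case: n0.
by rewrite [all _ _]/= Jy.
Qed.

Variable times : D -> D -> D.
Hypothesis timesA : associative times.

Lemma contract_edges_cons I d x t X :
  contract_edges times I (Node d ((x, t) :: X))
  = let s := contract_edges times I t in
    if I x then
      let r := contract_edges times I (Node (times d (root_dec s)) X) in
      Node (root_dec r) (children s ++ children r)
    else
      let r := contract_edges times I (Node d X) in
      Node (root_dec r) ((x, s) :: children r).
Proof. by rewrite /=; case: (I x). Qed.

(** [contract_edges] multiplies the decorations by a left fold whereas [con] groups them by
    subtrees; associativity reconciles the two. *)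
Lemma contract_edgesE I d X :
  contract_edges times I (Node d X)
  = Node (dmul times d (con times I X).1) (con times I X).2.
Proof.
elim/planted_ind: X d => [|x e Y X IHY IHX] d //.
rewrite contract_edges_cons con_cons; cbv zeta; rewrite IHY.
case: (I x); rewrite IHX //.
by case: (con times I X).1 => //= a; rewrite timesA.
Qed.

End NamedCuts.

(** * The sum over the cuts of a named forest *)

Section LinkingCuts.
Variables (D : Type) (E : eqType) (iota : finType) (R : comNzRingType).
Variable phi : iota -> iota -> iota -> iota -> R.
Local Notation NF := (seq (E * tree D E)).
Local Notation T := (tree D iota).
Local Notation PF := (seq (iota * T)).
Implicit Types (J I : pred E) (X Y Z : NF) (d : D) (x y e : E).
Implicit Types (ty t : E -> iota).

Definition cut_term J X (h : PF -> PF -> R) t : R :=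
  h (relabel_forest t (del (predC J) X).1) (relabel_forest t (cutq J X)).

Lemma eq_in_cut_term J X h t t' : {in forest_labels X, t =1 t'} ->
  cut_term J X h t = cut_term J X h t'.
Proof.
move=> e; rewrite /cut_term; congr h; apply: eq_in_relabel_forest => x.
  by case/mem_labels_del1/andP => xX _; apply: e.
by move/(mem_subseq (cutq_subseq J X)); apply: e.
Qed.

(** The splitting of a set of edges is that of [expand_named]; when the first edge is cut,
    admissibility leaves only the empty set below it. *)
Lemma cut_named X ty h : uniq (forest_labels X) ->
  esum2 (cut phi (relabel_forest ty X)) h
  = \sum_(J <- subs (forest_labels X) | admis (mem J) X)
      runs phi (ops (predC (mem J)) X).2 (cut_term (mem J) X h) ty.
Proof.
elim/planted_ind: X ty h => [|x d Y X IHY IHX] ty h.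
  by rewrite cut_nil big_mkcond big_seq1.
rewrite forest_labels_cons cons_uniq mem_cat negb_or cat_uniq.
case/andP => /andP[xY xX] /and3P[uY YX uX].
have dYX z : z \in forest_labels Y -> z \notin forest_labels X.
  by move=> zY; apply: contra YX => zX; apply/hasP; exists z.
rewrite relabel_forest_cons cut_cons IHY // IHX //.
rewrite [RHS]big_mkcond big_subs_cons !big_subs_cat addrC.
have L2X (J2 : seq E) : all (fun xe => (xe.1 \in forest_labels X)
    && (xe.2 \in forest_labels X)) (ops (predC (mem J2)) X).2.
  by apply/allP => -[u v] /(allP (ops_in _ _)) /= /and4P[-> -> _ _].
congr (_ + _).
  rewrite big_mkcond; apply: eq_big_seq => J1 sJ1.
  have J1X z : z \in forest_labels X -> z \notin J1.
    by apply: contraL => /(mem_subs sJ1) /dYX.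
  have xJ1 : x \notin J1 by apply: contra xY => /(mem_subs sJ1).
  have eadm (J2 : seq E) : J2 \in subs (forest_labels X) ->
    [/\ {in forest_labels Y, mem (J1 ++ J2) =1 mem J1},
        {in forest_labels X, mem (J1 ++ J2) =1 mem J2}
      & mem (J1 ++ J2) x = false].
    move=> sJ2; split=> [z zY|z /J1X zJ|] /=; rewrite mem_cat.
    - case zJ2: (z \in J2); rewrite ?orbF //.
      by have := dYX z zY; rewrite (mem_subs sJ2 zJ2).
    - by rewrite (negbTE zJ).
    - rewrite (negbTE xJ1); apply: contraNF xX; exact: (mem_subs sJ2).
  case a1: (admis (mem J1) Y); last first.
    rewrite big1_seq // => J2 /= /eadm [eY _ nx].
    by rewrite admis_cons nx (eq_in_admis eY) a1.
  set LY := (ops (predC (mem J1)) Y).2; set RY := (ops (predC (mem J1)) Y).1.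
  set Lx := [seq (x, r) | r <- RY]; set kY := (del (predC (mem J1)) Y).1.
  set qY := cutq (mem J1) Y.
  pose S := [pred z | (z == x) || (z \in forest_labels Y)].
  pose G (J2 : seq E) t1 t2 := cut_term (mem J2) X (fun p q =>
    h ((t1 x, Node d (relabel_forest t1 kY)) :: p) (relabel_forest t1 qY ++ q)) t2.
  pose V t1 := \sum_(J2 <- subs (forest_labels X) | admis (mem J2) X)
    runs phi (ops (predC (mem J2)) X).2 (G J2 t1) ty.
  have LYxS : all (fun xe => S xe.1 && S xe.2) (LY ++ Lx).
    rewrite all_cat; apply/andP; split.
      by apply/allP => -[u v] /(allP (ops_in _ _)) /= /and4P[-> -> _ _]; rewrite !orbT.
    apply/allP => -[u v] /mapP[r /mem_roots /andP[rY _] [-> ->]] /=.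
    by rewrite eqxx rY orbT.
  have SX z : S z -> z \notin forest_labels X.
    by case/orP => [/eqP -> //|]; apply: dYX.
  have xS : x \in S by rewrite inE /= eqxx.
  have eqY t1 t1' (Z : NF) : {in S, t1 =1 t1'} ->
      {subset forest_labels Z <= forest_labels Y} ->
      relabel_forest t1 Z = relabel_forest t1' Z.
    move=> e sZ; apply: eq_in_relabel_forest => z /sZ zY; apply: e.
    by rewrite inE /= zY orbT.
  have exG (J2 : seq E) t1 t1' t2 t2' : {in S, t1 =1 t1'} ->
      {in forest_labels X, t2 =1 t2'} -> G J2 t1 t2 = G J2 t1' t2'.
    move=> e1 e2; rewrite /G (eqY t1 t1' kY) //; last first.
      by move=> z /mem_labels_del1 /andP[].
    rewrite (eqY t1 t1' qY) //; last exact/mem_subseq/cutq_subseq.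
    by rewrite (e1 x xS) (eq_in_cut_term _ _ e2).
  transitivity (runs phi LY (runs phi Lx V) ty).
    apply: (@runs_ext _ _ _ _ (mem (forest_labels Y))) => //.
      by apply/allP => -[u v] /(allP (ops_in _ _)) /= /and4P[-> -> _ _].
    move=> t1 t1' e1 t1Y t1'Y.
    have {e1 t1'Y}<- : t1 = t1'.
      apply/funext => z; case zY: (z \in forest_labels Y); first exact: e1.
      by rewrite t1Y ?t1'Y // inE /= zY.
    have t1x : t1 x = ty x by apply: t1Y; rewrite inE.
    rewrite /cut_term -/kY -/qY -t1x pass_named; last first.
      rewrite cons_uniq (subseq_uniq (cutq_subseq _ _) uY) andbT.
      by apply: contra xY; apply/mem_subseq/cutq_subseq.
    rewrite /qY (cutq_roots a1) -/RY -/Lx -/qY.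
    apply: (@runs_ext _ _ _ _ [pred z | (z == x) || (z \in RY)]) => //.
      by apply/allP => -[u v] /mapP[r rY [-> ->]] /=; rewrite eqxx rY orbT.
    move=> t t' tt' tS t'S.
    have {tt' t'S}<- : t = t'.
      apply/funext => z; case zS: (z \in [pred z | (z == x) || (z \in RY)]).
        exact: tt'.
      by rewrite tS ?t'S // inE /= -[_ || _]/(z \in [pred z | (z == x) || (z \in RY)]) zS.
    have -> : relabel_forest t1 kY = relabel_forest t kY.
      apply: eq_in_relabel_forest => z /mem_labels_del1 /andP[zY zJ].
      rewrite tS // inE /= negb_or; apply/andP; split.
        by apply: contraNneq xY => <-.
      by apply/negP => /mem_roots /andP[_]; rewrite zJ.
    by rewrite IHX.
  rewrite -runs_cat /V runs_sum big_mkcond; apply: eq_big_seq => J2 sJ2.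
  have [eY eX nx] := eadm _ sJ2.
  have eY' : {in forest_labels Y, predC (mem (J1 ++ J2)) =1 predC (mem J1)}.
    by move=> z zY /=; have /= -> := eY z zY.
  have eX' : {in forest_labels X, predC (mem (J1 ++ J2)) =1 predC (mem J2)}.
    by move=> z zX /=; have /= -> := eX z zX.
  have px : predC (mem (J1 ++ J2)) x by rewrite /predC /= -[_ \in _]/(mem (J1 ++ J2) x) nx.
  rewrite admis_cons nx (eq_in_admis eY) (eq_in_admis eX) a1 andTb; case: ifP => // _.
  rewrite (@runs_merge _ _ _ phi S (mem (forest_labels X)) _ _ (G J2) ty
    LYxS (L2X J2) SX (exG J2)).
  rewrite ops_cons px (eq_in_ops eY') (eq_in_ops eX') -catA; apply: eq_runs => t.
  rewrite /G /cut_term del_cons cutq_cons nx px (eq_in_del eY') (eq_in_del eX').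
  rewrite (eq_in_cutq eY) (eq_in_cutq eX).
  by rewrite /relabel_forest map_cat.
(* The first edge is cut: its contribution is written as a sum over the sets [J1] that meet no edge
   of [Y], to be matched with the admissible ones. *)
rewrite -(big_subs_none (fun J1 : seq E => \sum_(J2 <- subs (forest_labels X) | admis (mem J2) X)
    runs phi (ops (predC (mem J2)) X).2 (cut_term (mem J2) X (fun p' q' =>
      h p' ((ty x, Node d (relabel_forest ty Y)) :: q'))) ty) uY).
rewrite big_mkcond; apply: eq_big_seq => J1 sJ1; case: ifP => nJ1; last first.
  rewrite big1_seq // => J2 /andP[_ sJ2]; rewrite admis_cons.
  have -> : mem (x :: J1 ++ J2) x by rewrite /= mem_head.
  case: ifP => // /andP[/hasPn nJ _].
  move/negbT: nJ1; rewrite negbK => /hasP[z zY /= zJ].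
  by have := nJ z zY; rewrite /= inE mem_cat zJ orbT.
have J1nil : J1 = [::].
  case: J1 sJ1 nJ1 => // z J1 /mem_subs sJ1 /negP []; apply/hasP; exists z.
    by apply: sJ1; apply: mem_head.
  exact: mem_head.
rewrite {}J1nil in sJ1 nJ1 *; rewrite big_mkcond; apply: eq_big_seq => J2 sJ2.
rewrite cat0s.
have xJ2 : x \notin J2 by apply: contra xX => /(mem_subs sJ2).
have nY : {in forest_labels Y, forall z, predC (mem (x :: J2)) z}.
  move=> z zY /=; rewrite inE negb_or; apply/andP; split.
    by apply: contraNneq xY => <-.
  by apply: contra (dYX z zY); apply: (mem_subs sJ2).
have eX : {in forest_labels X, mem (x :: J2) =1 mem J2}.
  by move=> z zX /=; rewrite inE; case: eqP => // zx; rewrite -zx zX in xX.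
have eX' : {in forest_labels X, predC (mem (x :: J2)) =1 predC (mem J2)}.
  by move=> z zX /=; have /= -> := eX z zX.
have nx : mem (x :: J2) x by rewrite /= mem_head.
have px : predC (mem (x :: J2)) x = false by rewrite /= mem_head.
have hY : has (mem (x :: J2)) (forest_labels Y) = false.
  by apply/negbTE/hasPn => z /nY.
rewrite admis_cons nx hY (eq_in_admis eX) andTb; case: ifP => // _.
rewrite ops_cons px (ops_all nY) (eq_in_ops eX').
apply: (@runs_ext _ _ _ _ (mem (forest_labels X))) => // t t' tt' tX t'X.
have {tt' t'X}<- : t = t'.
  apply/funext => z; case zX: (z \in forest_labels X); first exact: tt'.
  by rewrite tX ?t'X // inE /= zX.
rewrite /cut_term del_cons cutq_cons nx px (eq_in_del eX') (eq_in_cutq eX).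
rewrite relabel_forest_cons -tX ?inE //; congr (h _ ((_, Node _ _) :: _)).
by apply: eq_in_relabel_forest => z zY; rewrite tX // inE /= dYX.
Qed.

End LinkingCuts.

(** * Products over the trees of a forest *)

Section ForestProduct.
Variables (D : Type) (E : eqType) (iota : finType) (R : comNzRingType).
Variable phi : iota -> iota -> iota -> iota -> R.
Variable O : pred E -> tree D E -> seq (E * E).
Variable w : pred E -> tree D E -> (E -> iota) -> R.
Hypothesis eqO : forall J J' s, {in labels s, J =1 J'} -> O J s = O J' s.
Hypothesis eqw : forall J J' s t t', {in labels s, J =1 J'} ->
  {in labels s, t =1 t'} -> w J s t = w J' s t'.
Hypothesis inO : forall J s,
  all (fun xe => (xe.1 \in labels s) && (xe.2 \in labels s)) (O J s).

(** The trees have disjoint sets of edges, so a choice of a set in each tree is a set of edges of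
    the forest, and the separate runs combine by [runs_merge]. *)
Lemma forest_product F ty : uniq (flabels F) ->
  \prod_(s <- F) \sum_(J <- subs (labels s)) runs phi (O (mem J) s) (w (mem J) s) ty
  = \sum_(J <- subs (flabels F))
      runs phi (flatten [seq O (mem J) s | s <- F])
        (fun t => \prod_(s <- F) w (mem J) s t) ty.
Proof.
elim: F => [|s F IH]; first by rewrite big_nil big_seq1 /= big_nil.
rewrite flabels_cons cat_uniq => /and3P[us sF uF].
have dsF z : z \in labels s -> z \notin flabels F.
  by move=> zY; apply: contra sF => zX; apply/hasP; exists z.
rewrite big_cons big_subs_cat IH // mulr_suml; apply: eq_big_seq => J1 sJ1.
rewrite mulr_sumr; apply: eq_big_seq => J2 sJ2.
have e1 : {in labels s, mem (J1 ++ J2) =1 mem J1}.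
  move=> z zs /=; rewrite mem_cat; case zJ2: (z \in J2); rewrite ?orbF //.
  by have := dsF z zs; rewrite (mem_subs sJ2 zJ2).
have e2 : {in flabels F, mem (J1 ++ J2) =1 mem J2}.
  move=> z zF /=; rewrite mem_cat; case zJ1: (z \in J1) => //.
  by have := dsF z (mem_subs sJ1 zJ1); rewrite zF.
have inF u : u \in F -> {subset labels u <= flabels F}.
  by move=> uF' z zu; apply/flatten_mapP; exists u.
rewrite /= (eqO e1).
have -> : [seq O (mem (J1 ++ J2)) u | u <- F] = [seq O (mem J2) u | u <- F].
  apply/eq_in_map => u /inF sub; apply: eqO => z /sub; exact: e2.
rewrite mulrC -runs_mull.
transitivity (runs phi (O (mem J1) s) (fun t1 =>
    runs phi (flatten [seq O (mem J2) u | u <- F])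
      (fun t2 => w (mem J1) s t1 * \prod_(u <- F) w (mem J2) u t2) ty) ty).
  by apply: eq_runs => t; rewrite runs_mull mulrC.
rewrite (@runs_merge _ _ _ phi (mem (labels s)) (mem (flabels F)) _ _
  (fun t1 t2 => w (mem J1) s t1 * \prod_(u <- F) w (mem J2) u t2)) //.
- apply: eq_runs => t; rewrite big_cons; congr (_ * _).
    by apply: eqw => // z zs; rewrite e1.
  rewrite big_seq [RHS]big_seq; apply: eq_bigr => u /inF sub.
  by apply: eqw => // z /sub zF; rewrite e2.
- exact: inO.
- apply/allP => -[a b] /flattenP[_ /mapP[u /inF sub ->] /(allP (inO _ _)) /= /andP[au bu]].
  by rewrite !sub.
- move=> t1 t1' t2 t2' et1 et2; congr (_ * _); first exact: eqw.
  by rewrite big_seq [RHS]big_seq; apply: eq_bigr => u /inF sub;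
    apply: eqw => // z /sub; apply: et2.
Qed.

End ForestProduct.

(** * Chains of exchanges *)

Section TensorMapLemmas.
Variable K : fieldType.
Implicit Types U V W : lmodType K.

Lemma tens_linl U V (v : V) : linear (fun u : U => u ⊗ v).
Proof. exact: (tens_bilin U V).1. Qed.

Lemma tens_linr U V (u : U) : linear (fun v : V => u ⊗ v).
Proof. exact: (tens_bilin U V).2. Qed.

Lemma tmap_bilin U V U' V' (g : U -> U') (h : V -> V') :
  linear g -> linear h -> bilin (fun u v => g u ⊗ h v).
Proof.
move=> lg lh; split=> [v a x y|u a x y]; first by rewrite lg tens_linl.
by rewrite lh tens_linr.
Qed.

Lemma tmap_linear U V U' V' (g : U -> U') (h : V -> V') :
  linear g -> linear h -> linear (tmap g h).
Proof. by move=> lg lh; apply: tlift_linear (tmap_bilin lg lh). Qed.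

Lemma tmapE U V U' V' (g : U -> U') (h : V -> V') u v :
  linear g -> linear h -> tmap g h (u ⊗ v) = g u ⊗ h v.
Proof. by move=> lg lh; apply: tlift_tens (tmap_bilin lg lh) u v. Qed.

Lemma tflip_bilin U V : bilin (fun (u : U) (v : V) => v ⊗ u).
Proof. by split=> [v a x y|u a x y]; rewrite ?tens_linl ?tens_linr. Qed.

Lemma tflip_linear U V : linear (@tflip K U V).
Proof. exact: tlift_linear (tflip_bilin U V). Qed.

Lemma tflipE U V (u : U) (v : V) : tflip (u ⊗ v) = v ⊗ u.
Proof. exact: tlift_tens (tflip_bilin U V) u v. Qed.

Lemma tassoc_bilin1 U V W (w : W) : bilin (fun (u : U) (v : V) => u ⊗ (v ⊗ w)).
Proof. by split=> [v a x y|u a x y]; rewrite ?tens_linl ?tens_linr. Qed.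

Lemma tassoc_bilin2 U V W :
  bilin (fun (z : U ⊗ V) (w : W) => tlift (fun u v => u ⊗ (v ⊗ w)) z).
Proof.
split=> [w|z]; first exact: tlift_linear (tassoc_bilin1 U V w).
by apply: tlift_param_linear => u v a x y; rewrite !tens_linr.
Qed.

Lemma tassoc_linear U V W : linear (@tassoc K U V W).
Proof. exact: tlift_linear (tassoc_bilin2 U V W). Qed.

Lemma tassocE U V W (u : U) (v : V) (w : W) : tassoc ((u ⊗ v) ⊗ w) = u ⊗ (v ⊗ w).
Proof.
by rewrite /tassoc (tlift_tens (tassoc_bilin2 _ _ _)) (tlift_tens (tassoc_bilin1 _ _ _)).
Qed.

Lemma tassocV_bilin1 U V W (u : U) : bilin (fun (v : V) (w : W) => (u ⊗ v) ⊗ w).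
Proof.
split=> [w a x y|v a x y]; last by rewrite tens_linr.
by rewrite tens_linr tens_linl.
Qed.

Lemma tassocV_bilin2 U V W :
  bilin (fun (u : U) (z : V ⊗ W) => tlift (fun v w => (u ⊗ v) ⊗ w) z).
Proof.
split=> [z|u]; last exact: tlift_linear (tassocV_bilin1 V W u).
by apply: tlift_param_linear => v w a x y; rewrite !tens_linl.
Qed.

Lemma tassocV_linear U V W : linear (@tassocV K U V W).
Proof. exact: tlift_linear (tassocV_bilin2 U V W). Qed.

Lemma tassocVE U V W (u : U) (v : V) (w : W) :
  tassocV (u ⊗ (v ⊗ w)) = (u ⊗ v) ⊗ w.
Proof.
by rewrite /tassocV (tlift_tens (tassocV_bilin2 _ _ _)) (tlift_tens (tassocV_bilin1 _ _ _)).
Qed.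

Lemma tscalel_bilin U V (g : U -> K) : linear (g : U -> K^o) ->
  bilin (fun (u : U) (v : V) => g u *: v).
Proof.
move=> lg; split=> [v a x y|u a x y].
  by rewrite (lg a x y) scalerDl scalerA.
by rewrite scalerDr !scalerA mulrC.
Qed.

Lemma tscalelE U V (g : U -> K) (u : U) (v : V) : linear (g : U -> K^o) ->
  tscalel g (u ⊗ v) = g u *: v.
Proof. by move=> lg; apply: tlift_tens (tscalel_bilin _ lg) u v. Qed.

Lemma tscalel_linear U V (g : U -> K) : linear (g : U -> K^o) ->
  linear (@tscalel K U V g).
Proof. by move=> lg; apply: tlift_linear (tscalel_bilin _ lg). Qed.

Lemma op12_linear U V U' V' W (g : U ⊗ V -> U' ⊗ V') :
  linear g -> linear (@op12 K U V U' V' W g).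
Proof.
move=> lg; apply: linear_comp (@tassoc_linear _ _ _) _.
apply: linear_comp (tmap_linear lg (@linear_id _ _)) (@tassocV_linear _ _ _).
Qed.

End TensorMapLemmas.

(** * Chains of [Phi] evaluated on multilinear functions *)

Section Tsum.
Variables (K : fieldType) (A : lmodType K).

Fixpoint mlist (W : lmodType K) n (g : seq A -> W) : Prop :=
  if n is m.+1 then
    (forall l, linear (fun a => g (a :: l))) /\
    (forall a, mlist m (fun l => g (a :: l)))
  else True.

Lemma tsum_param_linear (X W : lmodType K) n (g : X -> seq A -> W) (z : tpow A n) :
  (forall l, linear (fun x => g x l)) -> linear (fun x => tsum (g x) z).
Proof.
elim: n g z => [|n IH] g z lg.
  by move=> a x y /=; rewrite lg scalerDr !scalerA mulrC.
apply: (@tlift_param_linear K X A (tpow A n) W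
  (fun x u v => tsum (fun l => g x (u :: l)) v)) => u v.
by apply: IH.
Qed.

Lemma tsum_bilin (W : lmodType K) n (g : seq A -> W) : mlist n.+1 g ->
  (forall h : seq A -> W, mlist n h -> linear (fun z : tpow A n => tsum h z)) ->
  bilin (fun a (z : tpow A n) => tsum (fun l => g (a :: l)) z).
Proof.
case=> lg mg lin; split=> [z|a]; last exact: lin (mg a).
exact: (@tsum_param_linear A W n (fun a l => g (a :: l)) z lg).
Qed.

Lemma tsum_linear (W : lmodType K) n (g : seq A -> W) :
  mlist n g -> linear (fun z : tpow A n => tsum g z).
Proof.
elim: n g => [|n IH] g mg.
  by move=> a x y /=; rewrite scalerDl scalerA.
exact: tlift_linear (tsum_bilin mg IH).
Qed.

Lemma tsum_tens (W : lmodType K) n (g : seq A -> W) a (z : tpow A n) :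
  mlist n.+1 g -> tsum g (a ⊗ z : tpow A n.+1) = tsum (fun l => g (a :: l)) z.
Proof.
move=> mg; exact: tlift_tens (tsum_bilin mg (@tsum_linear W n)) a z.
Qed.

Lemma eq_tsum (W : lmodType K) n (g h : seq A -> W) (z : tpow A n) :
  g =1 h -> tsum g z = tsum h z.
Proof. by move=> e; congr (tsum _ z); apply/funext. Qed.

Variables (Phi : A ⊗ A -> A ⊗ A).
Hypothesis lPhi : linear Phi.

Lemma Phi_chain_linear k : linear (@Phi_chain K A Phi k).
Proof.
elim: k => [|k IH] //=; apply: linear_comp (op12_linear lPhi) _.
exact: tmap_linear.
Qed.

Lemma Phi_chain_cons k a (Z : tpow A k.+1) :
  Phi_chain Phi (a ⊗ Z : tpow A k.+2) = op12 Phi (a ⊗ Phi_chain Phi Z).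
Proof. by rewrite /= tmapE //; apply: Phi_chain_linear. Qed.

(* [chain_value l a g] is the value of the multilinear map g at the result of
   moving an edge of type a up a path of edges of types l. *)
Definition chain_value (W : lmodType K) (l : seq A) (a : A) (g : seq A -> W) : W :=
  tsum g (Phi_chain Phi (tpure l a)).

(** The effect on [g] of the topmost exchange, between the upper edge of type [a] and the moving
    type [x] at the head of the list; the value on the empty list is a default. *)
Definition pass_value (W : lmodType K) a (g : seq A -> W) (l : seq A) : W :=
  if l is x :: r then tlift (fun y v => g (y :: v :: r)) (Phi (a ⊗ x)) else 0.

Section Values.
Variable W : lmodType K.
Implicit Types (g : seq A -> W) (a : A).

Lemma mlist_bilin k g r : mlist k.+2 g -> bilin (fun y v => g (y :: v :: r)).
Proof.
move=> [lg1 mg1]; split=> [v|y]; first exact: lg1.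
by case: (mg1 y) => lg2 _; apply: lg2.
Qed.

Lemma mlist_tlift n (G : A -> A -> seq A -> W) (z : A ⊗ A) :
  (forall y v, mlist n (G y v)) -> mlist n (fun l => tlift (fun y v => G y v l) z).
Proof.
elim: n G => [|n IH] G mG //=; split=> [l|b].
  apply: (@tlift_param_linear K A A A W (fun b y v => G y v (b :: l))) => y v.
  by case: (mG y v).
by apply: (IH (fun y v l => G y v (b :: l))) => y v; case: (mG y v) => _ /(_ b).
Qed.

Lemma mlist_pass_value k a g : mlist k.+2 g -> mlist k.+1 (pass_value a g).
Proof.
move=> mg; split=> [l|x].
  exact: linear_comp (tlift_linear (mlist_bilin l mg))
    (linear_comp lPhi (@tens_linr _ _ _ a)).
apply: (@mlist_tlift k (fun y v r => g (y :: v :: r))) => y v.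
by case: mg => _ /(_ y) [_ /(_ v)].
Qed.

Lemma chain_value_nil a g : mlist 1 g -> chain_value [::] a g = g [:: a].
Proof. by move=> mg; rewrite /chain_value tsum_tens //= scale1r. Qed.

Lemma tsum_op12 k g a (Z : tpow A k.+1) : mlist k.+2 g ->
  tsum g (op12 Phi (a ⊗ Z) : tpow A k.+2) = tsum (pass_value a g) Z.
Proof.
move=> mg; have ls := tsum_linear mg; have ls' := tsum_linear (mlist_pass_value a mg).
apply: (@tensor_ext _ A (tpow A k) W
  (fun Z => tsum g (op12 Phi (a ⊗ Z) : tpow A k.+2))
  (fun Z => tsum (pass_value a g) (Z : tpow A k.+1)) _ _ _ Z) => [||x w].
- exact: linear_comp ls (linear_comp (op12_linear lPhi) (@tens_linr _ _ _ a)).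
- exact: ls'.
rewrite (tsum_tens _ _ (mlist_pass_value a mg)) /op12 tassocVE tmapE //.
apply: (@tensor_ext _ A A W
  (fun z => tsum g (tassoc (z ⊗ w) : tpow A k.+2))
  (fun z => tsum (fun l => tlift (fun y v => g (y :: v :: l)) z) w) _ _ _
  (Phi (a ⊗ x))) => [||y v].
- exact: linear_comp ls (linear_comp (@tassoc_linear _ _ _ _) (@tens_linl _ _ _ w)).
- apply: (@tsum_param_linear (A ⊗ A)%type W k
    (fun z l => tlift (fun y v => g (y :: v :: l)) z)) => l.
  exact: tlift_linear (mlist_bilin l mg).
rewrite tassocE (tsum_tens _ _ mg) tsum_tens; last by case: mg => _ /(_ y).
by apply: eq_tsum => l; rewrite (tlift_tens (mlist_bilin l mg)).
Qed.

(** In [Phi_chain] the exchange with the first edge of the path comes last, so it can be transferred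
    to [g]. *)
Lemma chain_value_cons a1 l a g : mlist (size l).+2 g ->
  chain_value (a1 :: l) a g = chain_value l a (pass_value a1 g).
Proof. by move=> mg; rewrite /chain_value -tsum_op12 // -Phi_chain_cons. Qed.

Lemma chain_value_linear (E : eqType) (s : seq E) e (ty : E -> A) x g :
  uniq (e :: s) -> x \in e :: s -> mlist (size s).+1 g ->
  linear (fun a => chain_value [seq Defs.set_type ty x a y | y <- s]
                                 (Defs.set_type ty x a e) g).
Proof.
elim: s g => [|y s IH] g us xs mg k a b.
  move: xs; rewrite mem_seq1 => /eqP ->; rewrite /= !chain_value_nil //.
  by rewrite /Defs.set_type eqxx; case: mg => lg _; apply: lg.
have sz c : size [seq Defs.set_type ty x c y | y <- s] = size s by rewrite size_map.
rewrite !map_cons !chain_value_cons ?sz //.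
move: us; rewrite cons_uniq inE negb_or cons_uniq => /andP[/andP[ey es] /andP[ys us]].
case: (eqVneq x y) => [xy|xy].
  have tyE c : [seq Defs.set_type ty x c y | y <- s] = [seq ty y | y <- s].
    apply/eq_in_map => z zs; rewrite /Defs.set_type ifN //.
    by apply: contraNneq ys => zx; rewrite -xy -zx.
  have eE c : Defs.set_type ty x c e = ty e by rewrite /Defs.set_type xy (negbTE ey).
  rewrite !tyE !eE.
  have yE c : Defs.set_type ty x c y = c by rewrite /Defs.set_type xy eqxx.
  rewrite !yE.
  apply: (@tsum_param_linear A W _ (fun c => pass_value c g)) => -[|z l] c c' c'' /=.
    by rewrite scaler0 addr0.
  by rewrite tens_linl lPhi (tlift_linear (mlist_bilin l mg)).
have yE c : Defs.set_type ty x c y = ty y.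
  by rewrite /Defs.set_type eq_sym (negbTE xy).
rewrite !yE; apply: IH; last exact: mlist_pass_value.
  by rewrite cons_uniq es us.
by move: xs; rewrite !inE (negbTE xy).
Qed.

End Values.

Variables (iota : finType) (bas : iota -> A).
Variable phi : iota -> iota -> iota -> iota -> K.
Hypothesis Phi_bas : forall i j,
  Phi (bas i ⊗ bas j) = \sum_k \sum_l phi i j k l *: (bas k ⊗ bas l).
Variable R : comAlgType K.
Let phiR i j k l : R := (phi i j k l)%:A.

(** [chain_value] in coordinates: [h] receives the final type of the moving edge and the new types
    of the path. *)
Fixpoint chain (js : seq iota) (j : iota) (h : iota -> seq iota -> R) : R :=
  if js is i :: js' then
    chain js' j (fun k ks => esum2 (exch phiR i k) (fun k' l => h k' (l :: ks)))
  else h j [::].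

Lemma eq_chain js j h h' :
  (forall k ks, size ks = size js -> h k ks = h' k ks) ->
  chain js j h = chain js j h'.
Proof.
elim: js h h' => [|i js IH] h h' e /=; first exact: e.
by apply: IH => k ks sk; apply: eq_esum2 => k' l; apply: e; rewrite /= sk.
Qed.

Lemma exch_scale i j (h : iota -> iota -> R) :
  esum2 (exch phiR i j) h = \sum_k \sum_l phi i j k l *: h k l.
Proof.
rewrite /esum2 /esum big_map big_enum /= pair_bigA /=.
by apply: eq_bigr => -[k l] _ /=; rewrite /phiR -scalerAl mul1r.
Qed.

Lemma chain_value_bas js j (g : seq A -> R) : mlist (size js).+1 g ->
  chain_value [seq bas i | i <- js] (bas j) g
  = chain js j (fun k ks => g (bas k :: [seq bas i | i <- ks])).
Proof.
elim: js g => [|i js IH] g mg; first by rewrite /= chain_value_nil.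
rewrite map_cons chain_value_cons ?size_map // IH; last exact: mlist_pass_value.
apply: eq_chain => k ks sks; rewrite exch_scale /=.
set b := fun y v => g _; have lb : bilin b by apply: (mlist_bilin _ mg).
have ll := tlift_linear lb.
rewrite Phi_bas (lin_sum _ _ _ ll); apply: eq_bigr => k' _.
rewrite (lin_sum _ _ _ ll); apply: eq_bigr => l _.
by rewrite (linZ ll) (tlift_tens lb).
Qed.

Section States.
Variable E : eqType.
Implicit Types (t : E -> iota) (e x y : E) (s : seq E).

Definition retag t s (l : seq iota) : E -> iota :=
  fun y => if y \in s then nth (t y) l (index y s) else t y.

Lemma chain_runs s e t (G : (E -> iota) -> R) : uniq (e :: s) ->
  chain [seq t x | x <- s] (t e) (fun k ks => G (retag t (e :: s) (k :: ks)))
  = runs phiR [seq (x, e) | x <- rev s] G t.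
Proof.
elim: s G => [|x s IH] G us /=.
  congr G; apply/funext => y; rewrite /retag inE; case: eqP => //= ->.
  by rewrite eqxx.
move: us; rewrite cons_uniq inE negb_or cons_uniq => /andP[/andP[ex es] /andP[xs us]].
rewrite rev_cons map_rcons -cats1 runs_cat -IH; last by rewrite cons_uniq es.
apply: eq_chain => k ks _; rewrite /= /exch_op /=.
have xe : (x == e) = false by rewrite eq_sym (negbTE ex).
have -> : retag t (e :: s) (k :: ks) x = t x.
  by rewrite /retag inE xe (negbTE xs).
have -> : retag t (e :: s) (k :: ks) e = k.
  by rewrite /retag mem_head /= eqxx.
apply: eq_esum2 => k' l; congr G; apply/funext => y.
rewrite /retag /upd !inE /=; case: (eqVneq y x) => [->|yx].
  by rewrite ?xe ?[e == x]eq_sym ?xe /= ?eqxx.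
case: (eqVneq y e) => [->|ye] /=; first by rewrite ?eqxx.
by [].
Qed.

End States.
End Tsum.

(** * Successive treatment of the edges, as a run of exchanges *)

Section Steps.
Variables (K : fieldType) (A : lmodType K) (Phi : A ⊗ A -> A ⊗ A).
Hypothesis lPhi : linear Phi.
Variable E : finType.
Implicit Types (ty : E -> A) (s ls : seq E) (e x y : E).

Section Values.
Variable W : lmodType K.
Implicit Types (G : (E -> A) -> W).

(** The step common to cuts and contractions: the moving edge is retyped as well, even when it is
    about to be cut. *)
Definition exchange_step s e G ty : W :=
  chain_value Phi [seq ty x | x <- s] (ty e) (fun l => G (retype ty (e :: s) l)).

Lemma mlist_retype ls s G ty : multilin ls G -> uniq s -> {subset s <= ls} ->
  forall n pre, (size pre + n <= size s)%N ->
  mlist n (fun l => G (retype ty s (pre ++ l))).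
Proof.
move=> [exG lG] us sl; elim=> [|n IH] pre le //=; split=> [l|a]; last first.
  have -> : (fun l => G (retype ty s (pre ++ a :: l)))
      = (fun l => G (retype ty s (rcons pre a ++ l))).
    by apply/funext => l; rewrite cat_rcons.
  by apply: IH; rewrite size_rcons addSnnS.
have lt : (size pre < size s)%N by apply: leq_trans le; rewrite addnS ltnS leq_addr.
have [x xs ix] : exists2 x, x \in s & index x s = size pre.
  case: s us lt {sl le IH} => // e s us lt.
  by exists (nth e (e :: s) (size pre)); rewrite ?mem_nth ?index_uniq.
have retE c : retype ty s (pre ++ c :: l)
    = Defs.set_type (retype ty s (pre ++ 0 :: l)) x c.
  apply/funext => y; rewrite /Defs.set_type /retype.
  case: (eqVneq y x) => [->|yx]; first by rewrite xs ix nth_cat ltnn subnn.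
  case: ifP => // ys; rewrite !nth_cat; case: ifP => // /negbT.
  rewrite -leqNgt => li; have : (0 < index y s - size pre)%N.
    rewrite subn_gt0 ltn_neqAle li andbT -ix; apply: contraNneq yx => e.
    by rewrite -(nth_index y xs) e nth_index.
  by case: (index y s - size pre)%N.
by move=> k a b; rewrite (retE (k *: a + b)) (retE a) (retE b); apply/lG/sl.
Qed.

(** The type of an edge taking part is read by the chain alone, since [retype] overwrites it; that
    of any other edge is read by [G] alone. *)
Lemma exchange_step_multilin ls s e G : multilin ls G -> uniq (e :: s) ->
  {subset e :: s <= ls} -> multilin ls (exchange_step s e G).
Proof.
move=> mG us sl; have [exG lG] := mG; split=> [ty ty' tt'|ty x xl].
  have em : [seq ty x | x <- s] = [seq ty' x | x <- s].
    by apply/eq_in_map => x xs; apply: tt'; apply: sl; rewrite inE xs orbT.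
  rewrite /exchange_step em (tt' e); last by apply: sl; apply: mem_head.
  congr chain_value; apply/funext => l; apply: exG => y yl; rewrite /retype.
  by rewrite tt'.
case xs: (x \in e :: s).
  have eG c l : G (retype (Defs.set_type ty x c) (e :: s) l) = G (retype ty (e :: s) l).
    congr G; apply/funext => y; rewrite /retype /Defs.set_type.
    by case: ifP => // ys; rewrite ifN //; apply: contraFneq ys => ->.
  have := chain_value_linear lPhi ty us xs (mlist_retype ty mG us sl (pre := [::]) (leqnn _)).
  rewrite /= => H; move=> k a b; rewrite /exchange_step.
  have E1 c : (fun l => G (retype (Defs.set_type ty x c) (e :: s) l))
      = (fun l => G (retype ty (e :: s) l)) by apply/funext => l; apply: eG.
  by rewrite !E1; apply: H.
have em c : [seq Defs.set_type ty x c y | y <- s] = [seq ty y | y <- s].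
  apply/eq_in_map => y ys; rewrite /Defs.set_type ifN //.
  by apply: contraFneq xs => <-; rewrite inE ys orbT.
have ee c : Defs.set_type ty x c e = ty e.
  by rewrite /Defs.set_type ifN //; apply: contraFneq xs => <-; apply: mem_head.
have eG c l : retype (Defs.set_type ty x c) (e :: s) l
    = Defs.set_type (retype ty (e :: s) l) x c.
  apply/funext => y; rewrite /retype /Defs.set_type.
  by case: (eqVneq y x) => [->|//]; rewrite xs.
move=> k a b; rewrite /exchange_step !em !ee.
apply: (@tsum_param_linear K A A W _
  (fun c l => G (retype (Defs.set_type ty x c) (e :: s) l))) => l c c' c''.
by rewrite !eG; apply: lG.
Qed.

Definition weigh (f : A -> K) e G ty : W := f (ty e) *: G ty.

Lemma weigh_multilin (f : A -> K) ls e G : linear (f : A -> K^o) ->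
  multilin ls G -> e \notin ls -> multilin (e :: ls) (weigh f e G).
Proof.
move=> lf [exG lG] el; split=> [ty ty' tt'|ty x xl k a b].
  rewrite /weigh tt' ?mem_head // (exG ty ty') // => x xl.
  by apply: tt'; rewrite inE xl orbT.
rewrite /weigh; move: xl; rewrite inE => /orP[/eqP ->|xl].
  have eG c : G (Defs.set_type ty e c) = G ty.
    by apply: exG => y yl; rewrite /Defs.set_type ifN //; apply: contraNneq el => <-.
  have ee c : Defs.set_type ty e c e = c by rewrite /Defs.set_type eqxx.
  by rewrite !eG !ee (lf k a b) scalerDl scalerA.
have ee c : Defs.set_type ty x c e = ty e.
  by rewrite /Defs.set_type ifN //; apply: contraNneq el => ->.
by rewrite !ee (lG ty x xl) scalerDr !scalerA mulrC.
Qed.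

Lemma tsum_scale n (h : seq A -> W) c (z : tpow A n) :
  tsum (fun l => c *: h l) z = c *: tsum h z.
Proof.
have lin : linear (fun x : K^o => tsum (fun l => (x : K) *: h l) z).
  apply: (@tsum_param_linear K A (K^o) W n (fun (x : K^o) l => (x : K) *: h l)).
  by move=> l a x y; rewrite scalerDl scalerA.
have c1 : (c *: (1 : K^o) : K^o) = c by apply: mulr1.
have := linZ lin c (1 : K^o); rewrite c1 => ->.
by congr (_ *: _); apply: eq_tsum => l; rewrite scale1r.
Qed.

(** As [G] does not depend on the type of [e], applying [f] to the first tensor factor amounts to
    storing that factor as the type of [e] and weighing it afterwards. *)
Lemma cut_stepE (D : Type) (F : seq (tree D E)) (f : A -> K) ls e G ty :
  linear (f : A -> K^o) -> multilin ls G -> e \notin ls ->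
  uniq (fpath_to e F) -> {subset fpath_to e F <= ls} ->
  cut_step Phi F f e G ty = exchange_step (fpath_to e F) e (weigh f e G) ty.
Proof.
move=> lf mG el; rewrite /cut_step; move: (fpath_to e F) => s us sl.
have es : e \notin s by apply: contra el => /sl.
have ues : uniq (e :: s) by rewrite /= es.
have mW := weigh_multilin lf mG el.
have mlW : mlist (size s).+1 (fun l => weigh f e G (retype ty (e :: s) l)).
  apply: (mlist_retype ty mW ues _ (pre := [::])) => // x.
  by rewrite !inE => /orP[->//|/sl ->]; rewrite orbT.
have mlG : mlist (size s) (fun l => G (retype ty s l)).
  exact: (mlist_retype ty mG us sl (pre := [::])).
rewrite /exchange_step /chain_value.
have sz : size [seq ty x | x <- s] = size s by rewrite size_map.
move: (tpure _ _); rewrite sz => z; move: (Phi_chain _ _) => {}z.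
apply: (@tensor_ext K A (tpow A (size s)) W
  (fun z => tsum (fun l => G (retype ty s l)) (tscalel f z))
  (fun z => tsum (fun l => weigh f e G (retype ty (e :: s) l))
     (z : tpow A (size s).+1)) _ _ _ z) => [||a w].
- exact: linear_comp (tsum_linear mlG) (tscalel_linear lf).
- exact: tsum_linear mlW.
rewrite tscalelE // (linZ (tsum_linear mlG)) tsum_tens // -tsum_scale.
apply: eq_tsum => l; rewrite /weigh; congr (f _ *: _).
  by rewrite /retype mem_head /= eqxx.
case: mG => exG _; apply: exG => y yl; rewrite /retype inE.
have ye : (y == e) = false by apply: contraNF el => /eqP <-.
by rewrite ye /= [e == y]eq_sym ye.
Qed.

End Values.

Variables (iota : finType) (bas : iota -> A).
Variable phi : iota -> iota -> iota -> iota -> K.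
Hypothesis Phi_bas : forall i j,
  Phi (bas i ⊗ bas j) = \sum_k \sum_l phi i j k l *: (bas k ⊗ bas l).
Variable R : comAlgType K.
Let phiR i j k l : R := (phi i j k l)%:A.
Implicit Types (t : E -> iota).

Lemma exchange_step_bas ls s e (G : (E -> A) -> R) t : multilin ls G -> uniq (e :: s) ->
  {subset e :: s <= ls} ->
  exchange_step s e G (bas \o t)
  = runs phiR [seq (x, e) | x <- rev s] (fun t => G (bas \o t)) t.
Proof.
move=> mG us sl; rewrite /exchange_step (map_comp bas t) -[(bas \o t) e]/(bas (t e)).
have ml : mlist (size [seq t x | x <- s]).+1
    (fun l => G (retype (bas \o t) (e :: s) l)).
  by rewrite size_map; apply: (mlist_retype _ mG us sl (pre := [::])).
rewrite (chain_value_bas lPhi Phi_bas (t e) ml) -chain_runs //.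
apply: eq_chain => k ks; rewrite size_map => sks; congr G; apply/funext => y.
rewrite /retype /comp /retag -map_cons; case: ifP => // ys.
have ly : (index y (e :: s) < size (k :: ks))%N.
  by move: ys; rewrite -index_mem /= sks.
by rewrite (nth_map (t y)).
Qed.

Definition links (p : E -> seq E) (es : seq E) : seq (E * E) :=
  flatten [seq [seq (x, e) | x <- rev (p e)] | e <- es].

Lemma foldr_gstep ls (p : E -> seq E) es (G : (E -> A) -> R) : multilin ls G ->
  {in es, forall e, uniq (e :: p e) /\ {subset e :: p e <= ls}} ->
  multilin ls (foldr (fun e => exchange_step (p e) e) G es) /\
  forall t, foldr (fun e => exchange_step (p e) e) G es (bas \o t)
    = runs phiR (links p es) (fun t => G (bas \o t)) t.
Proof.
move=> mG; elim: es => [|e es IH] H //=.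
have [|mF eF] := IH; first by move=> x xs; apply: H; rewrite inE xs orbT.
have [ue se] := H e (mem_head _ _); split; first exact: exchange_step_multilin.
move=> t; rewrite (exchange_step_bas _ mF) // runs_cat.
by congr runs; apply/funext => t'; apply: eF.
Qed.

(** The weights are collected at the end: the paths avoid the cut edges, so the exchanges made for
    the other cut edges leave the final type of [e] unchanged. *)
Lemma foldr_cut_step (D : Type) (F : seq (tree D E)) (f : A -> K) ls es
    (G : (E -> A) -> R) :
  linear (f : A -> K^o) -> multilin ls G -> uniq es ->
  {in es, forall e, [/\ e \notin ls, uniq (fpath_to e F)
                      & {subset fpath_to e F <= ls}]} ->
  multilin (es ++ ls) (foldr (cut_step Phi F f) G es) /\
  forall t, foldr (cut_step Phi F f) G es (bas \o t)
    = runs phiR (links (fun e => fpath_to e F) es)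
        (fun t => (\prod_(e <- es) f (bas (t e))) *: G (bas \o t)) t.
Proof.
move=> lf mG; elim: es => [|e es IH] /= us H.
  by split=> // t; rewrite big_nil scale1r.
case/andP: us => ees us.
have [//||mF eF] := IH; first by move=> x xs; apply: H; rewrite inE xs orbT.
have [el up sp] := H e (mem_head _ _).
have el' : e \notin es ++ ls by rewrite mem_cat negb_or ees.
have sp' : {subset fpath_to e F <= es ++ ls}.
  by move=> x /sp xl; rewrite mem_cat xl orbT.
have stepE ty : cut_step Phi F f e (foldr (cut_step Phi F f) G es) ty
    = exchange_step (fpath_to e F) e (weigh f e (foldr (cut_step Phi F f) G es)) ty.
  exact: cut_stepE lf mF el' up sp'.
have mW := weigh_multilin lf mF el'.
have ue : uniq (e :: fpath_to e F).
  by rewrite /= up andbT; apply: contra el => /sp.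
have se : {subset e :: fpath_to e F <= e :: es ++ ls}.
  by move=> x; rewrite !inE => /orP[->//|/sp' ->]; rewrite orbT.
split.
  have [ex li] := exchange_step_multilin mW ue se; split=> [ty ty' tt'|ty x xl k a b].
    by rewrite !stepE; apply: ex.
  by rewrite !stepE; apply: li.
move=> t; rewrite stepE (exchange_step_bas _ mW) // runs_cat; congr runs.
apply/funext => t'; rewrite /weigh /= eF -mulr_algl -runs_mull.
apply: (@runs_ext _ _ _ _ (predC1 e)) => //.
  apply/allP => -[x y] /flatten_mapP[z zs /mapP[x']].
  rewrite mem_rev => x'p [-> ->] /=.
  have [|zl _ spz] := H z; first by rewrite inE zs orbT.
  apply/andP; split; first by apply: contraNneq el => <-; apply: spz.
  by apply: contraNneq ees => <-.
move=> u u' uu' uS u'S.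
have ue' : u e = t' e by apply: uS; rewrite !inE negbK.
have -> : u' = u.
  apply/funext => y; case: (eqVneq y e) => [->|ye].
    by rewrite ue' u'S // !inE negbK.
  by rewrite uu' // !inE.
by rewrite big_cons mulr_algl scalerA ue'.
Qed.

End Steps.

Section MultilinearMaps.
Variables (K : fieldType) (A : lmodType K) (E : eqType).
Implicit Types (ls : seq E).

Lemma eq_mem_multilin (W : lmodType K) ls ls' (G : (E -> A) -> W) :
  ls =i ls' -> multilin ls G -> multilin ls' G.
Proof.
move=> e [exG lG]; split=> [ty ty' tt'|ty x]; last by rewrite -e; apply: lG.
by apply: exG => x; rewrite e; apply: tt'.
Qed.

Lemma sum_multilin (W : lmodType K) I (r : seq I) (P : pred I) ls
    (G : I -> (E -> A) -> W) :
  (forall i, P i -> multilin ls (G i)) ->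
  multilin ls (fun ty => \sum_(i <- r | P i) G i ty).
Proof.
move=> mG; split=> [ty ty' tt'|ty x xl k a b].
  by apply: eq_bigr => i Pi; case: (mG i Pi) => + _; apply.
rewrite scaler_sumr -big_split; apply: eq_bigr => i Pi.
by case: (mG i Pi) => _; apply.
Qed.

Lemma comp_multilin (U W : lmodType K) ls (g : U -> W) (G : (E -> A) -> U) :
  linear g -> multilin ls G -> multilin ls (fun ty => g (G ty)).
Proof.
move=> lg [exG lG]; split=> [ty ty' tt'|ty x xl]; first by rewrite (exG ty ty').
exact: linear_comp lg (lG ty x xl).
Qed.

Lemma bilin_multilin (U V W : lmodType K) (b : U -> V -> W) ls ls'
    (G : (E -> A) -> U) (H : (E -> A) -> V) :
  bilin b -> multilin ls G -> multilin ls' H -> ~~ has (mem ls) ls' ->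
  multilin (ls ++ ls') (fun ty => b (G ty) (H ty)).
Proof.
move=> [lb1 lb2] [exG lG] [exH lH] dis.
have off ty x c y : y != x -> Defs.set_type ty x c y = ty y :> A.
  by move=> yx; rewrite /Defs.set_type (negbTE yx).
split=> [ty ty' tt'|ty x]; first congr b.
- by apply: exG => x xl; apply: tt'; rewrite mem_cat xl.
- by apply: exH => x xl; apply: tt'; rewrite mem_cat xl orbT.
rewrite mem_cat => /orP[xl|xl] k a c.
  have E1 e : H (Defs.set_type ty x e) = H ty.
    apply: exH => y yl; apply: off; apply: contraNneq dis => yx.
    by apply/hasP; exists y => //=; rewrite yx.
  by rewrite !E1 (lG ty x xl) lb1.
have E1 e : G (Defs.set_type ty x e) = G ty.
  apply: exG => y yl; apply: off; apply: contraNneq dis => yx.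
  by apply/hasP; exists x => //=; rewrite -yx.
by rewrite !E1 (lH ty x xl) lb2.
Qed.

Lemma forest_of_multilin (D : Type) (F : seq (tree D E)) :
  uniq (flabels F) -> multilin (flabels F) (fun ty : E -> A => forest_of F ty).
Proof.
elim: F => [|s F IH]; first by move=> _; split=> // ty ty' _; rewrite /forest_of !big_nil.
rewrite flabels_cons cat_uniq => /and3P[us sF uF].
have -> : (fun ty : E -> A => forest_of (s :: F) ty)
    = (fun ty => sgen (tree_class (relabel ty s)) * forest_of F ty).
  by apply/funext => ty; rewrite /forest_of big_cons.
apply: (bilin_multilin (b := @GRing.mul (Sym (gtrees A D)))) => //.
- exact: mul_bilin.
- exact: comp_multilin (@sgen_linear K (gtrees A D)) (tree_class_multilin A us).
- exact: IH.
Qed.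

End MultilinearMaps.

(** * Paths in a forest and the exchanges of one edge *)

Section Paths.
Variables (D : Type) (E : eqType).
Implicit Types (X Y : seq (E * tree D E)) (F : seq (tree D E)) (s : tree D E) (e : E).

Lemma path_to_subseq e s : subseq (path_to e s) (labels s).
Proof.
case: s => d X; rewrite labels_node; elim/planted_ind: X d => [|x d' Y X IHY IHX] d //.
rewrite path_to_cons forest_labels_cons -cat_cons; apply: cat_subseq => //.
case: ifP => _; last exact: sub0seq.
by rewrite /= eqxx; apply: IHY.
Qed.

Lemma notin_path_to e s : uniq (labels s) -> e \notin path_to e s.
Proof.
case: s => d X; rewrite labels_node; elim/planted_ind: X d => [|x d' Y X IHY IHX] d //.
rewrite forest_labels_cons cons_uniq mem_cat negb_or cat_uniq.
case/andP => /andP[xY xX] /and3P[uY YX uX].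
rewrite path_to_cons mem_cat negb_or IHX // andbT; case: ifP => // eY.
rewrite inE negb_or IHY // andbT; apply: contraTneq eY => ->; exact: xY.
Qed.

Lemma fpath_to_subseq e F : subseq (fpath_to e F) (flabels F).
Proof.
elim: F => [|s F IH] //; rewrite fpath_to_cons flabels_cons.
by apply: cat_subseq => //; apply: path_to_subseq.
Qed.

Lemma uniq_fpath_to e F : uniq (flabels F) -> uniq (e :: fpath_to e F).
Proof.
move=> uF; rewrite cons_uniq (subseq_uniq (fpath_to_subseq e F) uF) andbT.
elim: F uF => [|s F IH] //; rewrite flabels_cons cat_uniq => /and3P[us _ uF].
by rewrite fpath_to_cons mem_cat negb_or notin_path_to ?IH.
Qed.

Lemma restrict_cons I s F : restrict (s :: F) I
  = (delete_edges (predC I) s).1 :: (delete_edges (predC I) s).2 ++ restrict F I.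
Proof. by rewrite /restrict /=; case: (delete_edges _ s). Qed.

Lemma del_predCC (I : pred E) X : del (predC (predC I)) X = del I X.
Proof. by apply: eq_in_del => x _ /=; rewrite negbK. Qed.

Lemma labels_restrict I F : perm_eq (flabels (restrict F I)) (filter I (flabels F)).
Proof.
elim: F => [|[d X] F IH] //.
rewrite restrict_cons delete_edgesE del_predCC !flabels_cons flabels_cat filter_cat.
by rewrite catA; apply: perm_cat => //; apply: labels_del.
Qed.

Lemma labels_contract times I F : associative times ->
  flabels (contract times F I) = filter (predC I) (flabels F).
Proof.
move=> tA; elim: F => [|[d X] F IH] //.
rewrite /contract map_cons -/(contract times F I).
rewrite contract_edgesE // !flabels_cons filter_cat IH; congr (_ ++ _).
exact: labels_con.
Qed.

Lemma ops_at_forest e (I : pred E) F : uniq (flabels F) -> ~~ I e ->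
  ops_at e (flatten [seq (ops I (children s)).2 | s <- F])
  = [seq (x, e) | x <- rev (fpath_to e (restrict F [pred z | (z == e) || I z]))].
Proof.
move=> + Ie; set I' := [pred z | _].
have sub (G : seq (tree D E)) : {subset flabels (restrict G I') <= flabels G}.
  by move=> z; rewrite (perm_mem (labels_restrict I' G) z) mem_filter => /andP[].
elim: F => [|[d X] F IH] //; rewrite flabels_cons cat_uniq => /and3P[us sF uF].
rewrite restrict_cons delete_edgesE del_predCC /= /ops_at filter_cat -!/(ops_at _ _).
rewrite IH // fpath_to_cons fpath_to_cat catA rev_cat map_cat.
rewrite (ops_at_contract d us Ie); case eX: (e \in forest_labels X).
  have -> : fpath_to e (restrict F I') = [::].
    apply: fpath_to_none; apply: contra sF => /sub eF.
    by apply/hasP; exists e.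
  by rewrite cats0.
rewrite [path_to e _]path_to_none ?[fpath_to e (del _ _).2]fpath_to_none ?cats0 //.
  by apply: contraFN eX => /mem_labels_del2 /andP[].
by apply: contraFN eX => /mem_labels_del1 /andP[].
Qed.

Lemma ops_at_links e (p : E -> seq E) es : uniq es ->
  ops_at e (flatten [seq [seq (x, e) | x <- rev (p e)] | e <- es])
  = if e \in es then [seq (x, e) | x <- rev (p e)] else [::].
Proof.
elim: es => [|e' es IH] //= /andP[ees us].
rewrite /ops_at filter_cat -!/(ops_at _ _) IH // inE.
case: (eqVneq e e') => [ee'|ee'] /=.
  rewrite -ee' in ees *; rewrite (negbTE ees) cats0; apply/all_filterP.
  by apply/allP => -[x y] /mapP[z _ [_ ->]] /=.
rewrite -[RHS]cat0s; congr (_ ++ _); apply/eqP; rewrite -[_ == _]negbK -has_filter.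
by apply/hasPn => -[x y] /mapP[z _ [_ ->]] /=; rewrite eq_sym.
Qed.

End Paths.

Section SetSums.
Variables (E : finType) (R : zmodType).

Lemma size_subs (T : eqType) (L : seq T) : size (subs L) = (2 ^ size L)%N.
Proof. by elim: L => //= x L IH; rewrite size_cat size_map IH expnS mul2n addnn. Qed.

Lemma filter_subs (T : eqType) (a : pred T) (L : seq T) : filter a L \in subs L.
Proof.
elim: L => //= x L IH; rewrite mem_cat; case: (a x); last by rewrite IH.
by rewrite map_f ?orbT.
Qed.

(** Sublists give all subsets, and there are as many of both, so every subset is obtained exactly
    once. *)
Lemma big_subs_set (L : seq E) (H : {set E} -> R) : perm_eq L (enum E) ->
  \sum_(J <- subs L) H [set x in J] = \sum_(I : {set E}) H I.
Proof.
move=> pL; rewrite -(big_map (fun J : seq E => [set x in J]) xpredT H).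
have mem_s : {subset enum {set E} <= [seq [set x in J] | J : seq E <- subs L]}.
  move=> I _; apply/mapP; exists (filter (mem I) L); first exact: filter_subs.
  by apply/setP => x; rewrite /= in_set mem_filter (perm_mem pL) mem_enum andbT.
rewrite -[RHS]big_enum; apply: perm_big; apply: uniq_perm.
- apply: (leq_size_uniq (enum_uniq {set E}) mem_s).
  rewrite size_map size_subs (perm_size pL) -!cardE -cardsT -card_powerset.
  rewrite powersetT cardsT.
  by rewrite leqnn.
- exact: enum_uniq.
- move=> I; have eI : I \in enum {set E} by rewrite mem_enum.
  by rewrite (mem_s I eI) eI.
Qed.

End SetSums.

(** * The formulas for the coproducts *)

Section Formulas.
Variables (K : fieldType) (A : lmodType K) (Phi : A ⊗ A -> A ⊗ A).
Hypothesis lPhi : linear Phi.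
Variables (D : Type) (iota : finType) (bas : iota -> A) (co : iota -> A -> K).
Hypothesis co_bas : forall a, a = \sum_i co i a *: bas i.
Variable phi : iota -> iota -> iota -> iota -> K.
Hypothesis Phi_bas : forall i j,
  Phi (bas i ⊗ bas j) = \sum_k \sum_l phi i j k l *: (bas k ⊗ bas l).
Local Notation H := (Sym (gtrees A D)).
Local Notation R := (H ⊗ H)%type.
Let phiR i j k l : R := (phi i j k l)%:A.
Hypothesis exchC : exch_commutes phiR.

Definition btree (t : tree D iota) : H := sgen (tree_class (relabel bas t)).
Definition btreel t : R := btree t ⊗ 1.
Definition btreer t : R := 1 ⊗ btree t.

Lemma uniq_labels_mem (E : eqType) (F : seq (tree D E)) s :
  s \in F -> uniq (flabels F) -> uniq (labels s).
Proof.
elim: F => [|s' F IH] //; rewrite inE flabels_cons cat_uniq => /orP[/eqP ->|sF].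
  by case/andP.
by case/and3P => _ _; apply: IH.
Qed.

Lemma eq_restrict (E : eqType) (F : seq (tree D E)) (I I' : pred E) :
  I =1 I' -> restrict F I = restrict F I'.
Proof.
move=> e; elim: F => [|[d X] F IH] //; rewrite !restrict_cons IH !delete_edgesE.
by rewrite !del_predCC (eq_in_del (in1W e)).
Qed.

Section NamedForest.
Variable E : Type.
Implicit Types (t : E -> iota) (G : seq (tree D E)).

Lemma forest_ofE G t : forest_of G (bas \o t) = \prod_(s <- G) btree (relabel t s).
Proof. by apply: eq_bigr => s _; rewrite /btree relabel_comp. Qed.

Lemma tens_forest_of G G' t :
  forest_of G (bas \o t) ⊗ forest_of G' (bas \o t)
  = \prod_(s <- G) btreel (relabel t s) * \prod_(s <- G') btreer (relabel t s) :> R.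
Proof.
have [_ mL eL] := alg_morph_inl H H; have [_ mR eR] := alg_morph_inr H H.
rewrite -(big_morph _ mL eL) -(big_morph _ mR eR) -!forest_ofE tensM.
by rewrite mulr1 mul1r.
Qed.

End NamedForest.

Section Contraction.
Variable times : D -> D -> D.
Hypothesis timesA : associative times.
Variable delta : H -> R.
Hypothesis mdelta : alg_morph delta.
Hypothesis delta_btree : forall t, delta (btree t) = star phiR times btreel btreer t.

Let w (E : eqType) (J : pred E) (s : tree D E) (t : E -> iota) : R :=
  term times btreel J (children s) (fun p o q =>
    btreel (Node (root_dec s) p) * btreer (Node (dmul times (root_dec s) o) q)) t.

Let O (E : eqType) (J : pred E) (s : tree D E) := (ops J (children s)).2.

Let weighted (E : eqType) (J : pred E) (F : seq (tree D E)) (t : E -> iota) :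
  \prod_(s <- F) w J s t
  = forest_of (restrict F J) (bas \o t) ⊗ forest_of (contract times F J) (bas \o t).
Proof.
rewrite tens_forest_of; elim: F => [|[d X] F IH]; first by rewrite !big_nil mulr1.
rewrite restrict_cons /contract map_cons -/(contract times F J) !big_cons IH.
rewrite delete_edgesE del_predCC contract_edgesE // big_cat /w /term -!relabel_node /=; ring.
Qed.

Let inO (E : eqType) (J : pred E) (s : tree D E) :
  all (fun xe => (xe.1 \in labels s) && (xe.2 \in labels s)) (O J s).
Proof.
case: s => d X; rewrite labels_node; apply/allP => -[x e].
by move/(allP (ops_in _ _)) => /= /and4P[-> ->].
Qed.

Let eqO (E : eqType) (J J' : pred E) (s : tree D E) :
  {in labels s, J =1 J'} -> O J s = O J' s.
Proof. by case: s => d X; rewrite labels_node /O => e; rewrite (eq_in_ops e). Qed.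

Let eqw (E : eqType) (J J' : pred E) (s : tree D E) t t' :
  {in labels s, J =1 J'} -> {in labels s, t =1 t'} -> w J s t = w J' s t'.
Proof.
case: s => d X; rewrite labels_node => eJ et.
by rewrite /w (eq_in_term _ _ _ _ et) /term /= (eq_in_del eJ) (eq_in_con _ eJ).
Qed.

(** Both sides are multilinear in the types, so basis typings suffice. The left side is then a
    product over the trees, turned into a sum of runs over sets of edges by [expand_named] and
    [forest_product]; each summand on the right is a run in the order of [enum], and [runs_perm]
    identifies the two. *)
Lemma contraction_formula : is_contraction_coproduct Phi times delta.
Proof.
move=> E F ty pF; have uF : uniq (flabels F) by rewrite (perm_uniq pF) enum_uniq.
pose ct (I : {set E}) (ty : E -> A) : R := contract_tensor Phi F times I ty.
suff main ty' : delta (forest_of F ty') = \sum_(I : {set E}) ct I ty' by exact (main ty).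
pose p (I : {set E}) e := fpath_to e (restrict F (mem (e |: I))).
pose G0 (I : {set E}) (ty : E -> A) : R := 
  forest_of (restrict F (mem I)) ty ⊗ forest_of (contract times F (mem I)) ty.
have inE' x : x \in enum E by rewrite mem_enum.
have mG0 I : multilin (enum E) (G0 I).
  have pr := labels_restrict (mem I) F; have pc := labels_contract (mem I) F timesA.
  have ur : uniq (flabels (restrict F (mem I))) by rewrite (perm_uniq pr) filter_uniq.
  have uc : uniq (flabels (contract times F (mem I))) by rewrite pc filter_uniq.
  apply: (@eq_mem_multilin _ _ _ _
    (flabels (restrict F (mem I)) ++ flabels (contract times F (mem I)))).
    move=> x; rewrite inE' mem_cat (perm_mem pr) pc !mem_filter (perm_mem pF) inE'.
    by rewrite !andbT /= orbN.
  apply: bilin_multilin (forest_of_multilin A ur) (forest_of_multilin A uc) _.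
    exact: tens_bilin.
  apply/hasPn => x; rewrite pc mem_filter => /andP[xI _].
  by rewrite /= (perm_mem pr) mem_filter; apply: contra xI => /andP[].
have up I : {in enum (~: I), forall e,
    uniq (e :: p I e) /\ {subset e :: p I e <= enum E}}.
  move=> e _; split=> //; apply: uniq_fpath_to.
  by rewrite (perm_uniq (labels_restrict _ _)) filter_uniq.
(* [contract_step] is convertible to [exchange_step], so [foldr_gstep] applies to
   [contract_tensor]. *)
have fold I : multilin (enum E) (ct I) /\ _ := foldr_gstep lPhi Phi_bas (mG0 I) (up I).
move: ty' {ty}; apply: (multilin_ext co_bas (ls := enum E)
  (G := fun ty => delta (forest_of F ty))
  (H := fun ty => \sum_(I : {set E}) ct I ty)).
- apply: (@eq_mem_multilin _ _ _ _ (flabels F)); first exact: perm_mem pF.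
  by apply: comp_multilin (forest_of_multilin A uF); case: mdelta.
- by apply: sum_multilin => I _; have [+ _] := fold I.
move=> ty tyb; have [t et] := choice (fun e => tyb e (inE' e)).
have {ty tyb et} -> : ty = bas \o t by apply/funext.
have [_ mD eD] := mdelta; rewrite forest_ofE (big_morph _ mD eD).
transitivity (\prod_(s <- F) \sum_(J <- subs (labels s))
    runs phiR (O (mem J) s) (w (mem J) s) t).
  rewrite big_seq [RHS]big_seq; apply: eq_bigr => -[d X] sF.
  rewrite delta_btree relabel_node starE expand_named //.
  by have := uniq_labels_mem sF uF; rewrite labels_node.
rewrite (@forest_product _ _ _ _ phiR (@O E) (@w E)) //; first last.
- by move=> J J' s t1 t2; apply: eqw.
- by move=> J J' s; apply: eqO.
rewrite -(big_subs_set (fun I => ct I (bas \o t)) pF).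
apply: eq_big_seq => J _; set I := [set x in J].
have eI (s : tree D E) : {in labels s, mem J =1 mem I} by move=> x _; rewrite /= inE.
transitivity (runs phiR (links (p I) (enum (~: I))) (fun t0 => G0 I (bas \o t0)) t).
  have -> : (fun t0 => G0 I (bas \o t0)) = (fun t0 => \prod_(s <- F) w (mem J) s t0).
    apply/funext => t0; rewrite /G0 -weighted; apply: eq_bigr => s _.
    by apply/esym/eqw.
  congr (_ _); apply: (runs_perm (I := mem J)).
  - exact: exchC.
  - apply/allP => xe /flatten_mapP[[d X] _ /(allP (ops_in _ _)) /and4P[_ _ -> ->]] //.
  - apply/allP => -[x e] /flatten_mapP[e' e'I /mapP[x']].
    move: e'I; rewrite mem_enum !inE mem_rev => e'J xp [-> ->] /=; rewrite e'J andbT.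
    have := mem_subseq (fpath_to_subseq _ _) xp.
    rewrite (perm_mem (labels_restrict _ _)) mem_filter /= !inE => /andP[/orP[/eqP xe|//] _].
    have [|+ _] := up I e'; first by rewrite mem_enum !inE.
    by rewrite cons_uniq => /andP[/negP[]]; rewrite -{1}xe.
  (* In both lists the exchanges with lower edge [e] follow the path of [e] upwards if [e] is
     outside [J], and are absent otherwise. *)
  - move=> e; rewrite -!/(ops_at e _) ops_at_links ?enum_uniq // mem_enum !inE.
    case eJ: (e \in J) => /=.
      apply/eqP; rewrite -[_ == _]negbK -has_filter; apply/negP => /hasP[[x y]].
      case/flatten_mapP => -[d X] _ /(allP (ops_in _ _)) /and4P[_ _ _ /= yJ] /eqP ye.
      by rewrite ye eJ in yJ.
    rewrite (ops_at_forest uF) /= ?eJ //; congr [seq _ | _ <- rev _].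
    by rewrite /p; congr fpath_to; apply: eq_restrict => z; rewrite /= !inE.
by have [_ e] := fold I; rewrite -e.
Qed.

End Contraction.

End Formulas.

(** * Admissible cuts of forests *)

Section AdmissibleCuts.
Variables (D : Type) (E : eqType).
Implicit Types (X Y : seq (E * tree D E)) (F : seq (tree D E)) (b : seq bool).
Implicit Types (J : pred E) (e : E).

Lemma cutq_trees J X : admis J X -> [seq x.2 | x <- cutq J X] = (del (predC J) X).2.
Proof.
elim/planted_ind: X => [|x d Y X IHY IHX] //.
rewrite admis_cons cutq_cons del2_cons /= => /andP[aY /IHX eX].
case: (J x) aY => [/hasPn nY|aY]; last by rewrite map_cat IHY // eX.
by rewrite /= eX (@del_all _ _ (predC J) Y).
Qed.

Lemma cutq_labels J X : admis J X ->
  [seq x.1 | x <- cutq J X] = filter J (forest_labels X).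
Proof.
elim/planted_ind: X => [|x d Y X IHY IHX] //.
rewrite admis_cons cutq_cons forest_labels_cons /= filter_cat => /andP[aY /IHX eX].
case: (J x) aY => [nY|aY]; last by rewrite map_cat IHY // eX.
have -> : filter J (forest_labels Y) = [::].
  by apply/eqP; rewrite -[_ == _]negbK -has_filter.
by rewrite /= eX.
Qed.

Lemma admissible_cons (y : bool) b d X F J : admissible (Node d X :: F) (y :: b) J
  = (if y then ~~ has J (forest_labels X) else admis J X) && admissible F b J.
Proof. by rewrite -(admisE J d X) -(labels_node d X). Qed.

Lemma cutP_cons (y : bool) b d X F J : cutP (Node d X :: F) (y :: b) J
  = (if y then [:: Node d X] else (del (predC J) X).2) ++ cutP F b J.
Proof. by have := congr1 snd (delete_edgesE J d X); rewrite /cutP /= => ->. Qed.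

Lemma cutR_cons (y : bool) b d X F J : cutR (Node d X :: F) (y :: b) J
  = (if y then [::] else [:: Node d (del (predC J) X).1]) ++ cutR F b J.
Proof. by have := congr1 fst (delete_edgesE J d X); rewrite /cutR /= => ->; case: y. Qed.

Lemma filter_hasN (a : pred E) s : ~~ has a s -> filter (predC a) s = s.
Proof. by rewrite -all_predC => /all_filterP. Qed.

Lemma labels_cut F b J : size b = size F -> admissible F b J ->
  perm_eq (flabels (cutP F b J) ++ flabels (cutR F b J))
    (filter (predC J) (flabels F)).
Proof.
elim: F b => [|[d X] F IH] [|y b] // [/IH {}IH].
rewrite admissible_cons cutP_cons cutR_cons => /andP[aX /IH pF].
rewrite flabels_cons labels_node filter_cat !flabels_cat perm_catACA.
apply: perm_cat => //; case: y aX => aX.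
  by rewrite flabels_cons labels_node !cats0 (filter_hasN aX).
by rewrite flabels_cons labels_node cats0 perm_catC; apply: labels_del.
Qed.

Lemma ops_at_cut_forest e F b J : uniq (flabels F) -> size b = size F ->
  admissible F b J -> J e ->
  ops_at e (flatten [seq (ops (predC J) (children s)).2 | s <- F])
  = [seq (x, e) | x <- rev (fpath_to e F)].
Proof.
move=> uF + + Je; elim: F b uF => [|[d X] F IH] [|y b] //.
rewrite flabels_cons cat_uniq => /and3P[uX XF uF] [/(IH _ uF) {}IH].
rewrite admissible_cons => /andP[aX /IH {}IH].
rewrite fpath_to_cons [flatten _]/= /ops_at filter_cat -!/(ops_at e _) IH.
rewrite rev_cat map_cat; case eX: (e \in forest_labels X); last first.
  by rewrite path_to_none ?labels_node ?eX // cats0 ops_at_none ?eX.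
rewrite [fpath_to e F]fpath_to_none; last first.
  by apply: contra XF => eF; apply/hasP; exists e; rewrite ?labels_node.
rewrite /= cats0; case: y aX => aX; last exact: ops_at_cut.
by case/hasP: aX; exists e.
Qed.

(** By [ops_at_cut_forest] the path consists of upper edges of exchanges, which are never cut. *)
Lemma fpath_to_cut e F b J x : uniq (flabels F) -> size b = size F ->
  admissible F b J -> J e -> x \in fpath_to e F -> ~~ J x.
Proof.
move=> uF sF aF Je xe.
have : (x, e) \in ops_at e (flatten [seq (ops (predC J) (children s)).2 | s <- F]).
  by rewrite (ops_at_cut_forest uF sF aF Je) map_f // mem_rev.
rewrite mem_filter => /andP[_ /flatten_mapP[[d X] _ /(allP (ops_in _ _))]].
by case/and4P.
Qed.

(** The tuple records the term chosen in each factor; for cuts it tells which trees get the total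
    cut. *)
Lemma prod_add_tuple (R : comNzRingType) (T : Type) (u v : T -> R) (s : seq T) :
  \prod_(x <- s) (u x + v x)
  = \sum_(b : (size s).-tuple bool)
      \prod_(x <- zip b s) (if x.1 then u x.2 else v x.2).
Proof.
elim: s => [|x s IH].
  rewrite big_nil (big_pred1 [tuple]) ?big_nil // => b.
  exact/esym/eqP/tuple0.
rewrite big_cons IH mulr_sumr.
rewrite (reindex (fun y : bool * (size s).-tuple bool => [tuple of y.1 :: y.2])) /=.
  rewrite -(pair_bigA _ (fun (y : bool) (b : (size s).-tuple bool) =>
    \prod_(z <- zip (y :: b) (x :: s)) (if z.1 then u z.2 else v z.2))) /=.
  rewrite big_bool /= -big_split; apply: eq_bigr => b _.
  by rewrite !big_cons /= mulrDl.
exists (fun b : (size s).+1.-tuple bool => (thead b, [tuple of behead b])) => [[y b] _|b _] /=.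
  by congr pair; apply: val_inj.
by rewrite -tuple_eta.
Qed.

End AdmissibleCuts.

Section RunSums.
Variables (iota : finType) (R : comNzRingType) (E : eqType).
Variable phi : iota -> iota -> iota -> iota -> R.
Implicit Types (G : (E -> iota) -> R) (L : seq (E * E)).

Lemma runs_zero L t : runs phi L (fun=> 0) t = 0.
Proof.
rewrite -[RHS](mul0r (runs phi L (fun=> 0) t)) -runs_mull.
by apply: eq_runs => t'; rewrite mul0r.
Qed.

Lemma runs_add L G G' t :
  runs phi L (fun t => G t + G' t) t = runs phi L G t + runs phi L G' t.
Proof.
have := runs_sum phi L (index_enum bool) xpredT (fun b : bool => if b then G else G') t.
by rewrite big_bool /= => <-; apply: eq_runs => t'; rewrite big_bool.
Qed.

End RunSums.

(** * The formula for the cut coproduct *)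

Section CutFormula.
Variables (K : fieldType) (A : lmodType K) (Phi : A ⊗ A -> A ⊗ A).
Hypothesis lPhi : linear Phi.
Variables (D : Type) (iota : finType) (bas : iota -> A) (co : iota -> A -> K).
Hypothesis co_bas : forall a, a = \sum_i co i a *: bas i.
Variable phi : iota -> iota -> iota -> iota -> K.
Hypothesis Phi_bas : forall i j,
  Phi (bas i ⊗ bas j) = \sum_k \sum_l phi i j k l *: (bas k ⊗ bas l).
Local Notation H := (Sym (gtrees A D)).
Local Notation R := (H ⊗ H)%type.
Let phiR i j k l : R := (phi i j k l)%:A.
Hypothesis exchC : exch_commutes phiR.
Variable f : A -> K.
Hypothesis lf : linear (f : A -> K^o).
Let fR i : R := (f (bas i))%:A.
Variable Delta : H -> R.
Hypothesis mDelta : alg_morph Delta.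
Local Notation btreel := (@btreel K A D iota bas).
Local Notation btreer := (@btreer K A D iota bas).
Hypothesis Delta_btree : forall t,
  Delta (btree bas t) = conv phiR fR btreel btreer t.

Section Terms.
Variable E : eqType.
Implicit Types (J : pred E) (s : tree D E) (t : E -> iota) (F : seq (tree D E)).

Let O J s := (ops (predC J) (children s)).2.
(** [u] is the contribution of the total cut of [s], allowed only when [J] has no edge in [s], and
    [v] that of the cuts by edges. *)
Let u J s t : R := if has J (labels s) then 0 else btreel (relabel t s).
Let v J s t : R :=
  if admis J (children s) then cut_term J (children s) (fun p q =>
    planted fR btreel q * btreer (Node (root_dec s) p)) t else 0.

Let inO J s : all (fun xe => (xe.1 \in labels s) && (xe.2 \in labels s)) (O J s).
Proof.
case: s => d X; rewrite labels_node; apply/allP => -[x e].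
by move/(allP (ops_in _ _)) => /= /and4P[-> ->].
Qed.

Let eqO J J' s : {in labels s, J =1 J'} -> O J s = O J' s.
Proof.
case: s => d X; rewrite labels_node /O => e; congr (_.2); apply: eq_in_ops => x xX.
by rewrite /= e.
Qed.

Let equv J J' s t t' : {in labels s, J =1 J'} -> {in labels s, t =1 t'} ->
  u J s t + v J s t = u J' s t' + v J' s t'.
Proof.
case: s => d X; rewrite /u /v labels_node => eJ et.
rewrite (eq_in_has eJ) (eq_in_admis eJ) (eq_in_relabel (h := t')); last first.
  by rewrite labels_node.
congr (_ + _); case: ifP => // _; rewrite (eq_in_cut_term _ _ et) /cut_term.
rewrite (eq_in_cutq eJ) (@eq_in_del _ _ _ (predC J')) // => x xX.
by rewrite /= eJ.
Qed.

(** The total cut is attributed to the empty set of edges, so that both terms of [conv] are sums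
    over the same sets. *)
Lemma tree_cut_sum s t : uniq (labels s) ->
  Delta (btree bas (relabel t s))
  = \sum_(J <- subs (labels s)) runs phiR (O (mem J) s)
      (fun t => u (mem J) s t + v (mem J) s t) t.
Proof.
case: s => d X; rewrite labels_node => uX.
rewrite Delta_btree relabel_node /conv cut_named // -relabel_node.
under [RHS]eq_bigr do rewrite runs_add.
rewrite big_split; congr (_ + _).
  rewrite -(big_subs_none (fun=> btreel (relabel t (Node d X))) uX) big_mkcond.
  apply: eq_bigr => J _; rewrite /u labels_node.
  case: ifP => [nJ|/negbFE ->]; last by rewrite runs_zero.
  rewrite (negbTE nJ) /O ops_all //= => x xX; apply/negP => xJ.
  by case/hasP: nJ; exists x.
rewrite big_mkcond; apply: eq_bigr => J _; rewrite /v /=.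
by case: ifP => // _; rewrite runs_zero.
Qed.

Lemma forest_cut_sum F t : uniq (flabels F) ->
  Delta (forest_of F (bas \o t))
  = \sum_(J <- subs (flabels F)) \sum_(b : (size F).-tuple bool)
      runs phiR (flatten [seq (ops (predC (mem J)) (children s)).2 | s <- F])
        (fun t => \prod_(x <- zip b F) if x.1 then u (mem J) x.2 t else v (mem J) x.2 t) t.
Proof.
move=> uF; have [_ mD eD] := mDelta; rewrite forest_ofE (big_morph _ mD eD).
transitivity (\prod_(s <- F) \sum_(J <- subs (labels s))
    runs phiR (O (mem J) s) (fun t => u (mem J) s t + v (mem J) s t) t).
  rewrite big_seq [RHS]big_seq; apply: eq_bigr => s sF.
  exact: tree_cut_sum (uniq_labels_mem sF uF).
rewrite (@forest_product _ _ _ _ phiR O (fun J s t => u J s t + v J s t)) //.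
apply: eq_bigr => J _; rewrite -runs_sum; apply: eq_runs => t'.
exact: prod_add_tuple.
Qed.

Lemma cut_weight F (b : seq bool) J t : size b = size F ->
  \prod_(x <- zip b F) (if x.1 then u J x.2 t else v J x.2 t)
  = if admissible F b J then
      \prod_(e <- filter J (flabels F)) fR (t e)
      * (forest_of (cutP F b J) (bas \o t) ⊗ forest_of (cutR F b J) (bas \o t))
    else 0.
Proof.
elim: F b => [|[d X] F IH] [|y b] //.
  by rewrite /= !big_nil mul1r tens_forest_of !big_nil mulr1.
case=> /IH {}IH; rewrite [zip _ _]/= big_cons IH admissible_cons.
case: (admissible F b J); last by rewrite mulr0 andbF.
rewrite andbT cutP_cons cutR_cons flabels_cons labels_node filter_cat.
rewrite !tens_forest_of !big_cat /=; case: y; rewrite /= /u /v ?labels_node.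
  case: ifP => nJ; first by rewrite mul0r.
  have -> : filter J (forest_labels X) = [::].
    by apply/eqP; rewrite -[_ == _]negbK -has_filter nJ.
  by rewrite !big_nil mul1r big_seq1; ring.
rewrite [children _]/=; case: ifP => aJ; last by rewrite mul0r.
rewrite big_seq1 /cut_term /planted /relabel_forest big_map big_split /=.
rewrite -(cutq_labels aJ) -(cutq_trees aJ) !big_map -relabel_node /relabel_forest.
ring.
Qed.

Lemma forest_cut_formula F t : uniq (flabels F) ->
  Delta (forest_of F (bas \o t))
  = \sum_(b : (size F).-tuple bool)
      \sum_(J <- subs (flabels F) | admissible F b (mem J))
        runs phiR (flatten [seq (ops (predC (mem J)) (children s)).2 | s <- F])
          (fun t => \prod_(e <- filter (mem J) (flabels F)) fR (t e)
             * (forest_of (cutP F b (mem J)) (bas \o t)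
                  ⊗ forest_of (cutR F b (mem J)) (bas \o t))) t.
Proof.
move=> uF; rewrite forest_cut_sum // exchange_big; apply: eq_bigr => b _.
rewrite [RHS]big_mkcond; apply: eq_bigr => J _; case: ifP => aJ.
  by apply: eq_runs => t'; rewrite cut_weight ?size_tuple // aJ.
rewrite -[RHS](runs_zero phiR (flatten [seq O (mem J) s | s <- F]) t).
by apply: eq_runs => t'; rewrite cut_weight ?size_tuple // aJ.
Qed.

End Terms.

(** The reduction to basis typings and the reordering are those of [contraction_formula]; in
    addition, the tuple [b] selects the total cuts and [foldr_cut_step] gathers the values of
    [f]. *)
Lemma cut_formula : is_cut_coproduct Phi f Delta.
Proof.
move=> E F ty pF; have uF : uniq (flabels F) by rewrite (perm_uniq pF) enum_uniq.
have inE' x : x \in enum E by rewrite mem_enum.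
pose ct (b : seq bool) (c : {set E}) (ty : E -> A) : R := cut_tensor Phi F f b c ty.
suff main ty' : Delta (forest_of F ty') = \sum_(b : (size F).-tuple bool)
    \sum_(c : {set E} | admissible F b (mem c)) ct b c ty' by exact (main ty).
pose G0 (b : seq bool) (c : {set E}) (ty : E -> A) : R :=
  forest_of (cutP F b (mem c)) ty ⊗ forest_of (cutR F b (mem c)) ty.
pose ls (b : seq bool) (c : {set E}) :=
  flabels (cutP F b (mem c)) ++ flabels (cutR F b (mem c)).
have pls (b : (size F).-tuple bool) (c : {set E}) : admissible F b (mem c) ->
    perm_eq (ls b c) (filter (predC (mem c)) (flabels F)).
  by apply: labels_cut; rewrite size_tuple.
have mls (b : (size F).-tuple bool) (c : {set E}) x : admissible F b (mem c) ->
    (x \in ls b c) = (x \notin c).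
  by move=> /pls pb; rewrite (perm_mem pb) mem_filter (perm_mem pF) inE' andbT.
have mG0 (b : (size F).-tuple bool) (c : {set E}) : admissible F b (mem c) ->
    multilin (ls b c) (G0 b c).
  move=> /pls pb; have : uniq (ls b c) by rewrite (perm_uniq pb) filter_uniq.
  rewrite cat_uniq => /and3P[uP dis uR].
  apply: bilin_multilin (forest_of_multilin A uP) (forest_of_multilin A uR) dis.
  exact: tens_bilin.
have fold (b : (size F).-tuple bool) (c : {set E}) : admissible F b (mem c) ->
    multilin (enum E) (ct b c) /\
    forall t, ct b c (bas \o t)
      = runs phiR (links (fun e => fpath_to e F) (enum c))
          (fun t => \prod_(e <- enum c) f (bas (t e)) *: G0 b c (bas \o t)) t.
  move=> ac; have [|m e] := foldr_cut_step lPhi Phi_bas (F := F) lf (mG0 b c ac) (enum_uniq c).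
    move=> e; rewrite mem_enum => ec; rewrite mls // ec.
    have /andP[_ ue] := uniq_fpath_to e uF; split=> // x xe; rewrite mls //.
    by apply: fpath_to_cut uF _ ac ec xe; rewrite size_tuple.
  split=> //; apply: eq_mem_multilin m => x.
  by rewrite inE' mem_cat mem_enum mls // orbN.
move: ty' {ty}; apply: (multilin_ext co_bas (ls := enum E)
  (G := fun ty => Delta (forest_of F ty))
  (H := fun ty => \sum_(b : (size F).-tuple bool)
    \sum_(c : {set E} | admissible F b (mem c)) ct b c ty)).
- apply: (@eq_mem_multilin _ _ _ _ (flabels F)); first exact: perm_mem pF.
  by apply: comp_multilin (forest_of_multilin A uF); case: mDelta.
- apply: sum_multilin => b _; apply: sum_multilin => c ac.
  by have [+ _] := fold b c ac.
move=> ty tyb; have [t et] := choice (fun e => tyb e (inE' e)).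
have {ty tyb et} -> : ty = bas \o t by apply/funext.
rewrite forest_cut_formula //; apply: eq_bigr => b _.
rewrite [RHS]big_mkcond.
rewrite -(big_subs_set (fun c : {set E} => if admissible F b (mem c)
  then ct b c (bas \o t) else 0) pF).
rewrite big_mkcond; apply: eq_big_seq => J sJ; set c := [set x in J].
have -> : (mem J : pred E) = mem c by apply/funext => x; rewrite /= inE.
case: ifP => // ac; have [_ ->] := fold b c ac.
transitivity (runs phiR (links (fun e => fpath_to e F) (enum c))
  (fun t => \prod_(e <- filter (mem c) (flabels F)) fR (t e) * G0 b c (bas \o t)) t).
  congr (_ _); apply: (runs_perm (I := predC (mem c))) => //.
  - apply/allP => xe /flatten_mapP[[d X] _ /(allP (ops_in _ _)) /and4P[_ _ h1 h2]].
    by rewrite h1 h2.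
  - apply/allP => -[x e] /flatten_mapP[e' e'c /mapP[x']].
    move: e'c; rewrite mem_enum mem_rev => e'c xp [-> ->]; rewrite /= negbK e'c andbT.
    by apply: fpath_to_cut uF _ ac e'c xp; rewrite size_tuple.
  - move=> e; rewrite -!/(ops_at e _) ops_at_links ?enum_uniq // mem_enum.
    case: ifP => ec; first by apply: ops_at_cut_forest uF _ ac ec; rewrite size_tuple.
    apply/eqP; rewrite -[_ == _]negbK -has_filter; apply/negP => /hasP[[x y]].
    case/flatten_mapP => -[d X] _ /(allP (ops_in _ _)) /and4P[_ _ _ /=].
    by rewrite negbK => yc /eqP ye; rewrite -ye yc in ec.
apply: eq_runs => t'; rewrite -mulr_algl; congr (_ * _).
have -> : \prod_(e <- enum c) f (bas (t' e))
    = \prod_(e <- filter (mem c) (flabels F)) f (bas (t' e)).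
  apply: perm_big; apply: uniq_perm; rewrite ?enum_uniq ?filter_uniq // => x.
  by rewrite mem_enum mem_filter (perm_mem pF) inE' andbT.
by rewrite -[RHS]/(in_alg R _) rmorph_prod.
Qed.

End CutFormula.

(** * Structure constants *)

Section StructureConstants.
Variables (K : fieldType) (A : lmodType K) (iota : finType).
Variables (bas : iota -> A) (co : iota -> A -> K).
Hypothesis co_bas : forall a, a = \sum_i co i a *: bas i.
Hypothesis co_linear : forall i, linear (co i : A -> K^o).
Hypothesis co_dual : forall i j, co i (bas j) = (i == j)%:R.

Lemma basis_ext (W : lmodType K) (g h : A -> W) : linear g -> linear h ->
  (forall i, g (bas i) = h (bas i)) -> g =1 h.
Proof.
move=> lg lh e a; rewrite (co_bas a) (lin_sum _ _ _ lg) (lin_sum _ _ _ lh).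
by apply: eq_bigr => i _; rewrite (linZ lg) (linZ lh) e.
Qed.

Lemma basis2_ext (W : lmodType K) (g h : A ⊗ A -> W) : linear g -> linear h ->
  (forall i j, g (bas i ⊗ bas j) = h (bas i ⊗ bas j)) -> g =1 h.
Proof.
move=> lg lh e; apply: tensor_ext => // a b; move: a.
apply: basis_ext => [||i].
- exact: linear_comp lg (tens_linl b).
- exact: linear_comp lh (tens_linl b).
move: b; apply: basis_ext => //.
- exact: linear_comp lg (tens_linr _).
- exact: linear_comp lh (tens_linr _).
Qed.

Lemma basis3_ext (W : lmodType K) (g h : A ⊗ (A ⊗ A) -> W) :
  linear g -> linear h ->
  (forall i j k, g (bas i ⊗ (bas j ⊗ bas k)) = h (bas i ⊗ (bas j ⊗ bas k))) ->
  g =1 h.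
Proof.
move=> lg lh e; apply: tensor_ext => // a b; move: a.
apply: basis_ext => [||i].
- exact: linear_comp lg (tens_linl b).
- exact: linear_comp lh (tens_linl b).
move: b; apply: basis2_ext => //.
- exact: linear_comp lg (tens_linr _).
- exact: linear_comp lh (tens_linr _).
Qed.

Variable W : lmodType K.

Definition basis_lift (h : iota -> W) (a : A) : W := \sum_i co i a *: h i.

Lemma basis_lift_linear h : linear (basis_lift h).
Proof.
move=> x a b; rewrite /basis_lift scaler_sumr -big_split.
apply: eq_bigr => i _; rewrite /= scalerA -scalerDl; congr (_ *: _).
exact: (co_linear i x a b).
Qed.

Lemma basis_lift_param (X : lmodType K) (g : X -> iota -> W) a :
  (forall i, linear (g^~ i)) -> linear (fun x => basis_lift (g x) a).
Proof.
move=> lg x u v; rewrite /basis_lift scaler_sumr -big_split.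
by apply: eq_bigr => i _; rewrite lg scalerDr !scalerA mulrC.
Qed.

Lemma basis_lift_bas h j : basis_lift h (bas j) = h j.
Proof.
rewrite /basis_lift (bigD1 j) //= co_dual eqxx scale1r big1 ?addr0 // => i ij.
by rewrite co_dual (negbTE ij) scale0r.
Qed.

Definition basis2_lift (h : iota -> iota -> W) : A ⊗ A -> W :=
  tlift (fun a b => basis_lift (fun i => basis_lift (h i) b) a).

Lemma basis2_bilin h : bilin (fun a b => basis_lift (fun i => basis_lift (h i) b) a).
Proof.
split=> [b|a]; first exact: basis_lift_linear.
apply: (@basis_lift_param A (fun b i => basis_lift (h i) b)) => i.
exact: basis_lift_linear.
Qed.

Lemma basis2_lift_linear h : linear (basis2_lift h).
Proof. exact: tlift_linear (basis2_bilin h). Qed.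

Lemma basis2_lift_bas h i j : basis2_lift h (bas i ⊗ bas j) = h i j.
Proof. by rewrite /basis2_lift (tlift_tens (basis2_bilin h)) !basis_lift_bas. Qed.

Definition basis3_lift (h : iota -> iota -> iota -> W) : A ⊗ (A ⊗ A) -> W :=
  tlift (fun a z => basis_lift (fun i => basis2_lift (h i) z) a).

Lemma basis3_bilin h : bilin (fun a z => basis_lift (fun i => basis2_lift (h i) z) a).
Proof.
split=> [b|a]; first exact: basis_lift_linear.
apply: (@basis_lift_param _ (fun z i => basis2_lift (h i) z)) => i.
exact: basis2_lift_linear.
Qed.

Lemma basis3_lift_linear h : linear (basis3_lift h).
Proof. exact: tlift_linear (basis3_bilin h). Qed.

Lemma basis3_lift_bas h i j k :
  basis3_lift h (bas i ⊗ (bas j ⊗ bas k)) = h i j k.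
Proof.
by rewrite /basis3_lift (tlift_tens (basis3_bilin h)) basis_lift_bas basis2_lift_bas.
Qed.

End StructureConstants.

(** * The axioms of a dual lCEDS in coordinates *)

Section ExchangeRelations.
Variables (K : fieldType) (A : lmodType K) (iota : finType).
Variables (bas : iota -> A) (co : iota -> A -> K).
Hypothesis co_bas : forall a, a = \sum_i co i a *: bas i.
Hypothesis co_linear : forall i, linear (co i : A -> K^o).
Hypothesis co_dual : forall i j, co i (bas j) = (i == j)%:R.
Variable Phi : A ⊗ A -> A ⊗ A.
Hypothesis lPhi : linear Phi.

Definition struct_const i j k l : K := tform (co k) (co l) (Phi (bas i ⊗ bas j)).

Lemma tform_bilin (U V : lmodType K) (g : U -> K) (h : V -> K) :
  linear (g : U -> K^o) -> linear (h : V -> K^o) ->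
  bilin (fun u v => g u * h v : K^o).
Proof.
move=> lg lh; split=> [v x a b|u x a b].
  by rewrite (lg x a b) mulrDl; congr (_ + _); apply/esym/mulrA.
by rewrite (lh x a b) mulrDr; congr (_ + _); apply: mulrCA.
Qed.

Lemma Phi_basE i j : Phi (bas i ⊗ bas j)
  = \sum_k \sum_l struct_const i j k l *: (bas k ⊗ bas l).
Proof.
rewrite /struct_const; move: (Phi _) => z.
pose g (z : A ⊗ A) := \sum_k \sum_l (tform (co k) (co l) z : K) *: (bas k ⊗ bas l).
have lt k l := tlift_linear (tform_bilin (co_linear k) (co_linear l)).
apply: (@basis2_ext _ _ _ _ _ co_bas _ id g) => // [|a b].
  move=> x u v; rewrite /g scaler_sumr -big_split; apply: eq_bigr => k _.
  rewrite scaler_sumr -big_split; apply: eq_bigr => l _.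
  by rewrite /= scalerA -scalerDl; congr (_ *: _); apply: (lt k l).
have tE k l : tform (co k) (co l) (bas a ⊗ bas b) = (k == a)%:R * (l == b)%:R.
  by rewrite /tform (tlift_tens (tform_bilin (co_linear k) (co_linear l))) !co_dual.
rewrite /g (bigD1 a) //= (bigD1 b) //= tE !eqxx mulr1 scale1r.
rewrite big1 ?addr0 => [|l lb]; last by rewrite tE (negbTE lb) mulr0 scale0r.
rewrite big1 ?addr0 // => k ka; rewrite big1 // => l _.
by rewrite tE (negbTE ka) mul0r scale0r.
Qed.

Variable R : comAlgType K.
Let phi i j k l : R := (struct_const i j k l)%:A.
Implicit Types h : iota -> iota -> iota -> R.
Let ev := @basis3_lift K A iota co R.

Let ev_linear h : linear (ev h).
Proof. exact: basis3_lift_linear. Qed.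

(** Together with the three lemmas after it, this transposes the operators of the axioms to
    functions of three basis indices, where an axiom becomes an identity between sums of
    exchanges. *)
Lemma lift_op12 h z : ev h (op12 Phi z)
  = ev (fun i j k => esum2 (exch phi i j) (fun i' j' => h i' j' k)) z.
Proof.
move: z; apply: (basis3_ext co_bas) => [||i j k]; last rewrite [RHS]basis3_lift_bas //.
- exact: linear_comp (ev_linear _) (op12_linear lPhi).
- exact: ev_linear.
rewrite /op12 tassocVE tmapE //.
  rewrite Phi_basE exch_scale.
  have l3 : linear (fun z => ev h (tassoc (z ⊗ bas k))).
    apply: linear_comp (ev_linear h) _.
    exact: linear_comp (@tassoc_linear _ _ _ _) (tens_linl _).
  rewrite (lin_sum _ _ _ l3); apply: eq_bigr => k' _; rewrite (lin_sum _ _ _ l3).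
  apply: eq_bigr => l _; rewrite (linZ l3) tassocE; congr (_ *: _).
  exact: basis3_lift_bas.
Qed.

Lemma lift_op23 h z : ev h (op23 Phi z)
  = ev (fun i j k => esum2 (exch phi j k) (h i)) z.
Proof.
move: z; apply: (basis3_ext co_bas) => [||i j k]; last rewrite [RHS]basis3_lift_bas //.
- exact: linear_comp (ev_linear _) (tmap_linear (@linear_id _ _) lPhi).
- exact: ev_linear.
rewrite /op23 tmapE // Phi_basE exch_scale.
have l3 : linear (fun z => ev h (bas i ⊗ z)).
  exact: linear_comp (ev_linear h) (tens_linr _).
rewrite (lin_sum _ _ _ l3); apply: eq_bigr => k' _; rewrite (lin_sum _ _ _ l3).
apply: eq_bigr => l _; rewrite (linZ l3); congr (_ *: _).
exact: basis3_lift_bas.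
Qed.

Lemma lift_flip12 h z : ev h (op12 (@tflip K A A) z) = ev (fun i j k => h j i k) z.
Proof.
move: z; apply: (basis3_ext co_bas) => [||i j k]; last rewrite [RHS]basis3_lift_bas //.
- exact: linear_comp (ev_linear _) (op12_linear (@tflip_linear _ _ _)).
- exact: ev_linear.
rewrite /op12 tassocVE tmapE ?tflipE ?tassocE //; first exact: basis3_lift_bas.
exact: tflip_linear.
Qed.

Lemma lift_flip23 h z : ev h (op23 (@tflip K A A) z) = ev (fun i j k => h i k j) z.
Proof.
move: z; apply: (basis3_ext co_bas) => [||i j k]; last rewrite [RHS]basis3_lift_bas //.
- exact: linear_comp (ev_linear _) (tmap_linear (@linear_id _ _) (@tflip_linear _ _ _)).
- exact: ev_linear.
rewrite /op23 tmapE ?tflipE //; first exact: basis3_lift_bas.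
exact: tflip_linear.
Qed.

Hypothesis HPhi : dual_lCEDS Phi.

Lemma struct_const_commutes : exch_commutes phi.
Proof.
move=> i j j' h.
(* In the second axiom the crossing edge [i] is the middle factor and the results come in the order
   [k'], [l'], [k]; permuting the arguments of [h] restores its order. *)
have := congr1 (ev (fun a b c => h c a b)) (HPhi.2 (bas j' ⊗ (bas i ⊗ bas j))).
rewrite /= lift_op12 lift_flip12 lift_flip23 lift_op23 lift_flip23 lift_op23.
by rewrite lift_op12 lift_flip12 /ev !basis3_lift_bas.
Qed.

Lemma struct_const_pentagonal : exch_pentagonal phi.
Proof.
move=> i j r h.
have := congr1 (ev h) (HPhi.1 (bas i ⊗ (bas j ⊗ bas r))).
rewrite /= lift_op23 lift_op12 lift_op23 lift_op12 lift_flip23 lift_op12.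
by rewrite /ev !basis3_lift_bas.
Qed.

Variable f : A -> K.
Hypothesis lf : linear (f : A -> K^o).
Hypothesis Hf : tform f f \o Phi =1 tform f f.
Let fR i : R := (f (bas i))%:A.

Lemma struct_const_preserves : exch_preserves phi fR.
Proof.
move=> i j.
have bf := tform_bilin lf lf; have lt := tlift_linear bf.
have := Hf (bas i ⊗ bas j); rewrite /= Phi_basE /tform (lin_sum _ _ _ lt) (tlift_tens bf).
move/(congr1 (fun x : K^o => (x : K)%:A : R)) => e.
rewrite exch_scale; transitivity ((f (bas i) * f (bas j))%:A : R); last first.
  by rewrite -scalerA -mulr_algl.
rewrite -e -[RHS]/(in_alg R _) rmorph_sum; apply: eq_bigr => k _.
rewrite (lin_sum _ _ _ lt) rmorph_sum; apply: eq_bigr => l _.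
rewrite (linZ lt) (tlift_tens bf) /= /fR mulr_algl !scalerA.

by [].
Qed.

End ExchangeRelations.

(** * The Hopf algebra and its coaction *)

Section BilinearComposition.
Variables (K : fieldType) (U V W : lmodType K) (b : U -> V -> W).
Hypothesis bb : bilin b.

Lemma bilin_comp (W' : lmodType K) (g : W -> W') : linear g ->
  bilin (fun u v => g (b u v)).
Proof.
by move=> lg; split=> c; [apply: linear_comp lg (bb.1 c)|apply: linear_comp lg (bb.2 c)].
Qed.

Lemma bilin_pre (U' V' : lmodType K) (g : U' -> U) (h : V' -> V) :
  linear g -> linear h -> bilin (fun u v => b (g u) (h v)).
Proof.
by move=> lg lh; split=> c; [apply: linear_comp (bb.1 _) lg|apply: linear_comp (bb.2 _) lh].
Qed.

Lemma tlift_comp (W' : lmodType K) (g : W -> W') z : linear g ->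
  tlift (fun u v => g (b u v)) z = g (tlift b z).
Proof.
move=> lg; have bg := bilin_comp lg.
move: z; apply: tensor_ext => [||u v]; first exact: tlift_linear bg.
  exact: linear_comp lg (tlift_linear bb).
by rewrite (tlift_tens bg) (tlift_tens bb).
Qed.

End BilinearComposition.

(** * The structural maps between tensor products as algebra morphisms *)

Section TensorAlgebraMorphisms.
Variable K : fieldType.
Implicit Types B H U V W : unitFormAlgType K.

(** Here and below, maps defined by lifts are recognised as instances of [pairing], which makes them
    algebra morphisms. *)
Lemma tmap_alg_morph B H B' H' (g : B -> B') (h : H -> H') :
  alg_morph g -> alg_morph h -> alg_morph (tmap g h : B ⊗ H -> B' ⊗ H').
Proof.
move=> mg mh; apply: eq_alg_morph (pairing_alg_morph
  (alg_morph_comp (alg_morph_inl B' H') mg) (alg_morph_comp (alg_morph_inr B' H') mh)) => z.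
by apply: eq_tlift => x y /=; rewrite tensM mulr1 mul1r.
Qed.

Lemma mult_alg_morph H : alg_morph (@mult K H).
Proof. exact: pairing_alg_morph (alg_morph_id H) (alg_morph_id H). Qed.

Lemma mul_linl (R : comAlgType K) (c : R) : linear ( *%R^~ c : R -> R).
Proof. exact: (mul_bilin R).1. Qed.

Lemma mul_linr (R : comAlgType K) (c : R) : linear ( *%R c : R -> R).
Proof. exact: (mul_bilin R).2. Qed.

Lemma tmap_inl_mul U V W (z : U ⊗ V) (c : U ⊗ (V ⊗ W)) :
  tmap id (fun v : V => v ⊗ (1 : W)) z * c
  = tlift (fun u v => (u ⊗ (v ⊗ (1 : W))) * c) z.
Proof.
have bb : bilin (fun (u : U) (v : V) => u ⊗ (v ⊗ (1 : W))).
  by have h := bilin_pre (tens_bilin U (V ⊗ W)%type) (@linear_id K U) (tens_linl (1 : W)).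
exact: esym (tlift_comp bb z (mul_linl c)).
Qed.

Lemma mul_tmap_inr U V W (z : U ⊗ W) (c : U ⊗ (V ⊗ W)) :
  c * tmap id (fun w : W => (1 : V) ⊗ w) z
  = tlift (fun u w => c * (u ⊗ ((1 : V) ⊗ w))) z.
Proof.
have bb : bilin (fun (u : U) (w : W) => u ⊗ ((1 : V) ⊗ w)).
  by have h := bilin_pre (tens_bilin U (V ⊗ W)%type) (@linear_id K U) (tens_linr (1 : V)).
exact: esym (tlift_comp bb z (mul_linr c)).
Qed.

Lemma tassoc_alg_morph U V W : alg_morph (@tassoc K U V W).
Proof.
have mi : alg_morph (tmap id (fun v : V => v ⊗ (1 : W)) : U ⊗ V -> U ⊗ (V ⊗ W)).
  exact: tmap_alg_morph (alg_morph_id U) (alg_morph_inl V W).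
have mr : alg_morph (fun w : W => (1 : U) ⊗ ((1 : V) ⊗ w)).
  exact: alg_morph_comp (alg_morph_inr U _) (alg_morph_inr V W).
apply: eq_alg_morph (pairing_alg_morph mi mr) => z; apply: eq_tlift => {z} z w.
rewrite tmap_inl_mul; apply: eq_tlift => u v.
by rewrite !tensM !mulr1 !mul1r.
Qed.

Lemma m1_3_24_alg_morph B V W : alg_morph (@m1_3_24 K B V W).
Proof.
have ml : alg_morph (tmap id (fun v : V => v ⊗ (1 : W)) : B ⊗ V -> B ⊗ (V ⊗ W)).
  exact: tmap_alg_morph (alg_morph_id B) (alg_morph_inl V W).
have mr : alg_morph (tmap id (fun w : W => (1 : V) ⊗ w) : B ⊗ W -> B ⊗ (V ⊗ W)).
  exact: tmap_alg_morph (alg_morph_id B) (alg_morph_inr V W).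
apply: eq_alg_morph (pairing_alg_morph ml mr) => z; apply: eq_tlift => {z} x y.
rewrite tmap_inl_mul; apply: eq_tlift => b v; rewrite mul_tmap_inr.
by apply: eq_tlift => b' w; rewrite !tensM !mulr1 !mul1r.
Qed.

Lemma m1_3_24E B V W (x : B ⊗ V) (y : B ⊗ W) :
  m1_3_24 (x ⊗ y) = tmap id (fun v : V => v ⊗ (1 : W)) x
                    * tmap id (fun w : W => (1 : V) ⊗ w) y.
Proof.
have ml : alg_morph (tmap id (fun v : V => v ⊗ (1 : W)) : B ⊗ V -> B ⊗ (V ⊗ W)).
  exact: tmap_alg_morph (alg_morph_id B) (alg_morph_inl V W).
have mr : alg_morph (tmap id (fun w : W => (1 : V) ⊗ w) : B ⊗ W -> B ⊗ (V ⊗ W)).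
  exact: tmap_alg_morph (alg_morph_id B) (alg_morph_inr V W).
rewrite -(pairing_tens ml mr); apply: eq_tlift => {}x {}y.
rewrite tmap_inl_mul; apply: eq_tlift => b v; rewrite mul_tmap_inr.
by apply: eq_tlift => b' w; rewrite !tensM !mulr1 !mul1r.
Qed.

Lemma in_alg_morph (R : comAlgType K) : alg_morph (fun k : K^o => (k : K)%:A : R).
Proof.
split=> [a x y|x y|]; last by rewrite scale1r.
  by rewrite scalerDl scalerA.
by rewrite -scalerAl mul1r scalerA.
Qed.

Lemma tscalel_alg_morph B H (g : B -> K^o) : alg_morph g ->
  alg_morph (tscalel g : B ⊗ H -> H).
Proof.
move=> mg; apply: eq_alg_morph (pairing_alg_morph
  (alg_morph_comp (in_alg_morph H) mg) (alg_morph_id H)) => z.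
by apply: eq_tlift => x y; rewrite /= mulr_algl.
Qed.

Lemma tscaler_alg_morph B H (g : H -> K^o) : alg_morph g ->
  alg_morph (tscaler g : B ⊗ H -> B).
Proof.
move=> mg; apply: eq_alg_morph (pairing_alg_morph
  (alg_morph_id B) (alg_morph_comp (in_alg_morph B) mg)) => z.
by apply: eq_tlift => x y; rewrite /= mulr_algr.
Qed.

Lemma tscalerE B H (g : H -> K^o) x y : alg_morph g ->
  tscaler g (x ⊗ y : B ⊗ H) = g y *: x.
Proof.
move=> mg; have mk := alg_morph_comp (in_alg_morph B) mg.
have -> : g y *: x = x * (g y : K)%:A by rewrite mulr_algr.
rewrite -(pairing_tens (alg_morph_id B) mk).
by apply: eq_tlift => u v; rewrite /= mulr_algr.
Qed.

End TensorAlgebraMorphisms.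

Lemma alg_morph_rmorph (K : fieldType) (R R' : comAlgType K) (g : R -> R') :
  alg_morph g -> exists h : {rmorphism R -> R'}, (h : R -> R') = g.
Proof.
move=> [lg mg g1].
have ga : zmod_morphism g by move=> x y; rewrite (linB lg).
have gm : monoid_morphism g by [].
pose ha := GRing.isZmodMorphism.Build R R' g ga.
pose hm := GRing.isMonoidMorphism.Build R R' g gm.
pose h : {rmorphism R -> R'} := HB.pack g ha hm.
by exists h.
Qed.

Definition sym_cube (K : fieldType) (V : lmodType K) : comAlgType K :=
  (Sym V ⊗ (Sym V ⊗ Sym V))%type.

(** * Characters of trees and the bialgebra attached to a natural product *)

Section Characters.
Variables (K : fieldType) (A : lmodType K) (D : Type) (iota : finType).
Variables (bas : iota -> A) (co : iota -> A -> K).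
Hypothesis co_bas : forall a, a = \sum_i co i a *: bas i.
Hypothesis co_linear : forall i, linear (co i : A -> K^o).
Hypothesis co_dual : forall i j, co i (bas j) = (i == j)%:R.
Local Notation H := (Sym (gtrees A D)).
Local Notation T := (tree D iota).
Local Notation btree := (@btree K A D iota bas).
Local Notation btreel := (@btreel K A D iota bas).
Local Notation btreer := (@btreer K A D iota bas).

Section OneAlgebra.
Variable R : comAlgType K.
Implicit Types u v : T -> R.

(** The algebra morphism with value [u] on basis-typed trees, for [u] swap-invariant. *)
Definition tree_char u : H -> R := slift (tree_lift co u).

Lemma tree_char_morph u : swap_inv u -> alg_morph (tree_char u).
Proof. by move=> iu; apply/slift_alg_morph/tree_lift_linear. Qed.

Lemma tree_char_btree u t : swap_inv u -> tree_char u (btree t) = u t.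
Proof.
move=> iu; rewrite /tree_char /btree slift_sgen; last exact: tree_lift_linear.
exact: tree_lift_bas.
Qed.

Lemma tree_char_ext (g h : H -> R) : alg_morph g -> alg_morph h ->
  (forall t, g (btree t) = h (btree t)) -> g =1 h.
Proof.
move=> mg mh e; apply: sym_ext => // u; move: u.
case: mg mh => lg _ _ [lh _ _].
apply: (gtrees_ext co_bas (g := g \o @sgen K _) (h := h \o @sgen K _)) => //.
- exact: linear_comp lg (@sgen_linear K _).
- exact: linear_comp lh (@sgen_linear K _).
Qed.

Lemma btree_swap_inv (g : H -> R) : swap_inv (fun t => g (btree t)).
Proof.
by move=> t t' /(relabel_swap bas) s; rewrite /btree (tree_class_swap s).
Qed.

End OneAlgebra.

(* A product of characters of trees which is natural in the target algebra,
   associative and unital is the convolution of a bialgebra structure. *)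
Section BialgebraOfProduct.
Variable op : forall R : comAlgType K, (T -> R) -> (T -> R) -> T -> R.
Hypothesis op_swap : forall (R : comAlgType K) (u v : T -> R),
  swap_inv u -> swap_inv v -> swap_inv (op u v).
Hypothesis op_nat : forall (R R' : comAlgType K) (g : R -> R') u v t,
  alg_morph g -> g (op u v t) = op (g \o u) (g \o v) t.
Hypothesis opA : forall (R : comAlgType K) (u v w : T -> R), op (op u v) w = op u (op v w).
Variable e : T -> K^o.
Hypothesis e_swap : swap_inv e.
Hypothesis op1l : forall (R : comAlgType K) (u : T -> R), op (fun t => (e t : K)%:A) u = u.
Hypothesis op1r : forall (R : comAlgType K) (u : T -> R), op u (fun t => (e t : K)%:A) = u.

(** The product of the two inclusions of [H] in [H ⊗ H], seen as characters; by naturality,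
    composing it with a morphism gives the product of the restrictions of that morphism. *)
Definition char_coproduct : H -> H ⊗ H := tree_char (op btreel btreer).
Definition char_counit : H -> K^o := tree_char e.

Let swapl : swap_inv btreel.
Proof. exact: (btree_swap_inv (fun x : H => x ⊗ (1 : H))). Qed.

Let swapr : swap_inv btreer.
Proof. exact: (btree_swap_inv (fun x : H => (1 : H) ⊗ x)). Qed.

Lemma char_coproduct_morph : alg_morph char_coproduct.
Proof. exact/tree_char_morph/op_swap. Qed.

Lemma char_counit_morph : alg_morph char_counit.
Proof. exact/tree_char_morph. Qed.

Lemma char_coproduct_btree t : char_coproduct (btree t) = op btreel btreer t.
Proof. exact/tree_char_btree/op_swap. Qed.

Lemma char_counit_btree t : char_counit (btree t) = e t.
Proof. exact/tree_char_btree. Qed.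

Lemma char_coproduct_nat (R : comAlgType K) (g : H ⊗ H -> R) t : alg_morph g ->
  g (char_coproduct (btree t)) = op (g \o btreel) (g \o btreer) t.
Proof. by move=> mg; rewrite char_coproduct_btree op_nat. Qed.

Lemma char_coproduct_ext (R : comAlgType K) (g h : H ⊗ H -> R) :
  alg_morph g -> alg_morph h ->
  op (g \o btreel) (g \o btreer) = op (h \o btreel) (h \o btreer) ->
  forall x, g (char_coproduct x) = h (char_coproduct x).
Proof.
move=> mg mh e'.
apply: (tree_char_ext (alg_morph_comp mg char_coproduct_morph) (alg_morph_comp mh char_coproduct_morph)) => t.
by rewrite /= !char_coproduct_nat // e'.
Qed.

Lemma char_coproduct_ext1 (R : comAlgType K) (g : H ⊗ H -> R) (h : H -> R) :
  alg_morph g -> alg_morph h -> op (g \o btreel) (g \o btreer) = h \o btree ->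
  forall x, g (char_coproduct x) = h x.
Proof.
move=> mg mh e'; apply: (tree_char_ext (alg_morph_comp mg char_coproduct_morph) mh) => t.
by rewrite /= char_coproduct_nat // e'.
Qed.

Let lcop : linear char_coproduct. Proof. by case: char_coproduct_morph. Qed.
Let lcou : linear char_counit. Proof. by case: char_counit_morph. Qed.
Let cop1 : char_coproduct 1 = 1 ⊗ 1. Proof. by case: char_coproduct_morph. Qed.
Let cou1 : char_counit 1 = 1. Proof. by case: char_counit_morph. Qed.
Let lid : linear (@id H). Proof. exact: linear_id. Qed.

Local Notation H3 := (sym_cube (gtrees A D)).

Lemma char_coproduct_coassoc x : tassoc (tmap char_coproduct id (char_coproduct x)) = tmap id char_coproduct (char_coproduct x).
Proof.
have mid := alg_morph_id H; move: x.
pose L (z : H ⊗ H) : H3 := tassoc (tmap char_coproduct id z).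
pose M (z : H ⊗ H) : H3 := tmap id char_coproduct z.
have mL : alg_morph L.
  exact: alg_morph_comp (tassoc_alg_morph H H H) (tmap_alg_morph char_coproduct_morph mid).
have mM : alg_morph M by apply: tmap_alg_morph mid char_coproduct_morph.
suff e' : op (L \o btreel) (L \o btreer) = op (M \o btreel) (M \o btreer).
  (* Unification of the two module structures on the triple tensor product
     is slow; the kernel's conversion is not. *)
  exact_no_check (@char_coproduct_ext H3 L M mL mM e').
(* The three inclusions of [H] in its triple tensor power: coassociativity becomes the associativity
   of [op] on [j1], [j2], [j3]. *)
pose j1 (s : T) : H3 := btree s ⊗ 1.
pose j2 (s : T) : H3 := 1 ⊗ btreel s.
pose j3 (s : T) : H3 := 1 ⊗ btreer s.
pose I (z : H ⊗ H) : H3 := tassoc (z ⊗ 1).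
pose J (z : H ⊗ H) : H3 := 1 ⊗ z.
have mI : alg_morph I by exact: alg_morph_comp (tassoc_alg_morph H H H) (alg_morph_inl _ _).
have mJ : alg_morph J by apply: alg_morph_inr.
have e1 : L \o btreel = op j1 j2.
  have Ij1 : I \o btreel = j1 by apply/funext => s; apply: tassocE.
  have Ij2 : I \o btreer = j2 by apply/funext => s; apply: tassocE.
  rewrite -Ij1 -Ij2; apply/funext => s; rewrite -(char_coproduct_nat s mI).
  by rewrite /L /= tmapE.
have e2 : L \o btreer = j3.
  by apply/funext => s; rewrite /L /= tmapE // cop1 tassocE.
have e3 : M \o btreel = j1 by apply/funext => s; rewrite /M /= tmapE // cop1.
have e4 : M \o btreer = op j2 j3.
  apply/funext => s; rewrite -[RHS]/(op (J \o btreel) (J \o btreer) s).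
  by rewrite -(char_coproduct_nat s mJ) /M /= tmapE.
rewrite e1 e2 e3 e4.
by rewrite opA.
Qed.

Lemma char_coproduct_bialgebra : is_bialgebra char_coproduct char_counit.
Proof.
have [_ copM _] := char_coproduct_morph; have [_ couM _] := char_counit_morph.
have mid := alg_morph_id H.
split; last by split.
  split=> [x|x|x]; move: x.
  - exact: char_coproduct_coassoc.
  - pose L : H ⊗ H -> H := tscalel char_counit.
    have mL : alg_morph L := tscalel_alg_morph H char_counit_morph.
    apply: (@char_coproduct_ext1 H L id mL mid).
    have e1 : L \o btreel = (fun t => (e t : K)%:A).
      apply/funext => s; apply: (etrans (tscalelE (btree s) (1 : H) lcou)).
      by rewrite char_counit_btree.
    have e2 : L \o btreer = btree.
      apply/funext => s; apply: (etrans (tscalelE (1 : H) (btree s) lcou)).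
      by rewrite cou1 scale1r.
    by rewrite e1 e2 op1l.
  - pose L : H ⊗ H -> H := tscaler char_counit.
    have mL : alg_morph L := tscaler_alg_morph H char_counit_morph.
    apply: (@char_coproduct_ext1 H L id mL mid).
    have e1 : L \o btreel = btree.
      apply/funext => s; apply: (etrans (tscalerE (btree s) (1 : H) char_counit_morph)).
      by rewrite cou1 scale1r.
    have e2 : L \o btreer = (fun t => (e t : K)%:A).
      apply/funext => s; apply: (etrans (tscalerE (1 : H) (btree s) char_counit_morph)).
      by rewrite char_counit_btree.
    by rewrite e1 e2 op1r.
split=> [x y|]; last exact: cop1.
by rewrite copM.
Qed.

End BialgebraOfProduct.
End Characters.

(** * Both convolutions over all commutative algebras, and inverses *)

Section Convolutions.
Variables (K : fieldType) (D : Type) (iota : finType).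
Variables (phi : iota -> iota -> iota -> iota -> K) (f : iota -> K).
Local Notation T := (tree D iota).

Definition scal (R : comAlgType K) i j k l : R := (phi i j k l)%:A.
Definition fscal (R : comAlgType K) i : R := (f i)%:A.

Hypothesis exchC : forall R : comAlgType K, exch_commutes (scal R).
Hypothesis exch_pentagon : forall R : comAlgType K, exch_pentagonal (scal R).
Hypothesis exch_f : forall R : comAlgType K, exch_preserves (scal R) (fscal R).

Lemma morph_scal (R R' : comAlgType K) (g : R -> R') (k : K) :
  alg_morph g -> g (k%:A) = k%:A.
Proof. by case=> lg _ g1; rewrite (linZ lg) g1. Qed.

Section Product.
Variable times : D -> D -> D.
Hypotheses (timesA : associative times) (timesC : commutative times).

Definition cstar (R : comAlgType K) (u v : T -> R) : T -> R := star (scal R) times u v.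
Definition cconv (R : comAlgType K) (u v : T -> R) : T -> R :=
  conv (scal R) (fscal R) u v.
Definition cantip (R : comAlgType K) (u : T -> R) : T -> R :=
  antip (scal R) times (fscal R) u.

Lemma cstar_swap (R : comAlgType K) (u v : T -> R) :
  swap_inv u -> swap_inv v -> swap_inv (cstar u v).
Proof. exact: star_swap_inv timesA timesC (@exchC R) _ _. Qed.

Lemma cconv_swap (R : comAlgType K) (u v : T -> R) :
  swap_inv u -> swap_inv v -> swap_inv (cconv u v).
Proof. exact: conv_swap_inv timesA timesC (@exchC R) _ _ _. Qed.

Lemma cantip_swap (R : comAlgType K) (u : T -> R) : swap_inv u -> swap_inv (cantip u).
Proof. exact: antip_swap_inv timesA timesC (@exchC R) _ _. Qed.

Section Naturality.
Variables (R R' : comAlgType K) (g : R -> R').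
Hypothesis mg : alg_morph g.
Implicit Types u v : T -> R.

Let gscal : (fun i j k l => g (scal R i j k l)) = scal R'.
Proof.
apply/funext => i; apply/funext => j; apply/funext => k; apply/funext => l.
exact: morph_scal.
Qed.

Let gfscal : g \o fscal R = fscal R'.
Proof. by apply/funext => i; apply: morph_scal. Qed.

Lemma cstar_nat u v t : g (cstar u v t) = cstar (g \o u) (g \o v) t.
Proof.
have [h hg] := alg_morph_rmorph mg.
by rewrite /cstar -gscal -hg rmorph_star.
Qed.

Lemma cconv_nat u v t : g (cconv u v t) = cconv (g \o u) (g \o v) t.
Proof.
have [h hg] := alg_morph_rmorph mg.
by rewrite /cconv -gscal -gfscal -hg rmorph_conv.
Qed.

Lemma cantip_nat u t : g (cantip u t) = cantip (g \o u) t.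
Proof.
have [h hg] := alg_morph_rmorph mg.
by rewrite /cantip -gscal -gfscal -hg rmorph_antip.
Qed.

End Naturality.

Section Identities.
Variable R : comAlgType K.
Implicit Types u v w : T -> R.

Lemma cstarA u v w : cstar (cstar u v) w = cstar u (cstar v w).
Proof. exact: star_assoc (@exchC R) timesA timesC (@exch_pentagon R) _ _ _. Qed.

Lemma cconvA u v w : cconv (cconv u v) w = cconv u (cconv v w).
Proof.
exact: conv_assoc (@exchC R) timesA timesC (@exch_pentagon R) _ (@exch_f R) _ _ _.
Qed.

Lemma cstar_conv u v w : cstar u (cconv v w) = cconv (cstar u v) (cstar u w).
Proof. exact: star_conv (@exchC R) timesA timesC (@exch_pentagon R) _ _ _ _. Qed.

Lemma cconv0l u : cconv (fun=> 0) u = u.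
Proof. exact: conv_zerol times _ _. Qed.

Lemma cconv0r u : cconv u (fun=> 0) = u.
Proof. exact: conv_zeror. Qed.

Lemma cstar0 u : cstar u (fun=> 0) = fun=> 0.
Proof. exact: star_zero. Qed.

Lemma cantipl u : cconv (cantip u) u = fun=> 0.
Proof. exact: conv_antip (@exchC R) timesA timesC (@exch_pentagon R) _ _. Qed.

(** The group-theoretic argument: a left inverse which itself has a left inverse is also a right
    inverse, the zero function being the unit. *)
Lemma cantipr u : cconv u (cantip u) = fun=> 0.
Proof.
have e : cconv (cconv (cantip (cantip u)) (cantip u)) (cconv u (cantip u))
    = cconv (cantip (cantip u)) (cantip u).
  by rewrite -cconvA (cconvA _ _ u) cantipl cconv0r.
by rewrite cantipl cconv0l in e.
Qed.

Lemma cantip_unique u v : cconv v u = (fun=> 0) -> v = cantip u.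
Proof. by move=> e; rewrite -[v]cconv0r -(cantipr u) -cconvA e cconv0l. Qed.

Definition cedgeless (t : T) : K^o := edgeless (K^o) t.

Lemma cedgelessE : (fun t => (cedgeless t : K)%:A) = edgeless R.
Proof. by apply/funext => -[d [|x X]]; rewrite /cedgeless /= ?scale1r ?scale0r. Qed.

Lemma zeroE : (fun _ : T => ((0 : K^o) : K)%:A) = (fun=> 0) :> (T -> R).
Proof. by apply/funext => t; rewrite scale0r. Qed.

End Identities.
End Product.

(* The antipode is built with one product on D, but as a convolution inverse it
   does not depend on it. *)
Lemma cstar_antip (times times' : D -> D -> D) :
  associative times -> commutative times ->
  associative times' -> commutative times' ->
  forall (R : comAlgType K) (u v : T -> R),
  cantip times (cstar times' u v) = cstar times' u (cantip times v).
Proof.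
move=> tA tC tA' tC' R u v; apply/esym/cantip_unique => //.
by rewrite -cstar_conv // cantipl // cstar0.
Qed.

End Convolutions.

(** * The Hopf algebra of cuts and its colinearity *)

Section HopfAlgebra.
Variables (K : fieldType) (A : lmodType K) (D : Type) (iota : finType).
Variables (bas : iota -> A) (co : iota -> A -> K).
Hypothesis co_bas : forall a, a = \sum_i co i a *: bas i.
Hypothesis co_linear : forall i, linear (co i : A -> K^o).
Hypothesis co_dual : forall i j, co i (bas j) = (i == j)%:R.
Variables (phi : iota -> iota -> iota -> iota -> K) (f : iota -> K).
Local Notation H := (Sym (gtrees A D)).
Local Notation H3 := (sym_cube (gtrees A D)).
Local Notation T := (tree D iota).
Local Notation btree := (@btree K A D iota bas).
Local Notation btreel := (@btreel K A D iota bas).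
Local Notation btreer := (@btreer K A D iota bas).
Local Notation scal := (scal phi).
Local Notation fscal := (fscal f).
Hypothesis exchC : forall R : comAlgType K, exch_commutes (scal R).
Hypothesis exch_pentagon : forall R : comAlgType K, exch_pentagonal (scal R).
Hypothesis exch_f : forall R : comAlgType K, exch_preserves (scal R) (fscal R).

Variable times0 : D -> D -> D.
Hypotheses (timesA0 : associative times0) (timesC0 : commutative times0).

Local Notation conv := (fun R : comAlgType K => @cconv K D iota phi f R).
Let conv_swap := cconv_swap f exchC timesA0 timesC0.
Let conv_nat (R R' : comAlgType K) (g : R -> R') u v t (mg : alg_morph g) :
  g (conv R u v t) = conv R' (g \o u) (g \o v) t := cconv_nat phi f mg u v t.

Definition cut_coproduct : H -> H ⊗ H := char_coproduct bas co conv.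
Definition cut_counit : H -> K^o := char_counit co (fun=> 0).
Definition cut_antipode : H -> H := tree_char co (cantip phi f times0 btree).

Let zero_swap : swap_inv (fun _ : T => 0 : K^o). Proof. by []. Qed.

Lemma cut_coproduct_morph : alg_morph cut_coproduct.
Proof. exact: char_coproduct_morph. Qed.

Lemma cut_counit_morph : alg_morph cut_counit.
Proof. exact: char_counit_morph. Qed.

Let swap_btree : swap_inv btree.
Proof. exact: (btree_swap_inv bas (fun x : H => x)). Qed.

Let antip_swap := cantip_swap f exchC timesA0 timesC0 swap_btree.

Lemma cut_antipode_morph : alg_morph cut_antipode.
Proof. exact: tree_char_morph. Qed.

Lemma cut_coproduct_btree t : cut_coproduct (btree t) = cconv phi f btreel btreer t.
Proof. exact: char_coproduct_btree. Qed.

Lemma cut_counit_btree t : cut_counit (btree t) = 0.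
Proof. exact: (char_counit_btree co_linear co_dual zero_swap). Qed.

Lemma cut_antipode_btree t : cut_antipode (btree t) = cantip phi f times0 btree t.
Proof. exact: (tree_char_btree co_linear co_dual). Qed.

Let lid : linear (@id H). Proof. exact: linear_id. Qed.
Let lcut_coproduct : linear cut_coproduct. Proof. by case: cut_coproduct_morph. Qed.
Let lcut_counit : linear cut_counit. Proof. by case: cut_counit_morph. Qed.
Let lcut_antipode : linear cut_antipode. Proof. by case: cut_antipode_morph. Qed.
Let cut_coproduct1 : cut_coproduct 1 = 1 ⊗ 1. Proof. by case: cut_coproduct_morph. Qed.
Let cut_antipode1 : cut_antipode 1 = 1. Proof. by case: cut_antipode_morph. Qed.

Lemma multE (x y : H) : mult (x ⊗ y) = x * y.
Proof. exact: (pairing_tens (alg_morph_id H) (alg_morph_id H)). Qed.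

Lemma cut_bialgebra : is_bialgebra cut_coproduct cut_counit.
Proof.
apply: char_coproduct_bialgebra => //.
- by move=> R u v w; apply: cconvA timesA0 timesC0 _ _ _ _.
- by move=> R u; rewrite zeroE; exact: (cconv0l phi f times0 u).
- by move=> R u; rewrite zeroE; exact: (cconv0r phi f u).
Qed.

Lemma cut_hopf : is_hopf_algebra cut_coproduct cut_counit cut_antipode.
Proof.
have mid := alg_morph_id H.
have mE : alg_morph (fun x => (cut_counit x : K)%:A : H).
  exact: alg_morph_comp (in_alg_morph H) cut_counit_morph.
have eE : (fun x => (cut_counit x : K)%:A : H) \o btree = fun=> 0.
  by apply/funext => t; rewrite /= cut_counit_btree scale0r.
split; first exact: cut_bialgebra.
  pose L (z : H ⊗ H) : H := mult (tmap cut_antipode id z).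
  have mL : alg_morph L := alg_morph_comp (mult_alg_morph H) (tmap_alg_morph cut_antipode_morph mid).
  apply: (@char_coproduct_ext1 _ _ _ _ _ _ co_bas co_linear co_dual _ conv_swap conv_nat H L _ mL mE).
  have e1 : L \o btreel = cantip phi f times0 btree.
    apply/funext => t; rewrite -cut_antipode_btree; apply: (etrans (congr1 _ (tmapE _ _ lcut_antipode lid))).
    by rewrite multE mulr1.
  have e2 : L \o btreer = btree.
    apply/funext => t; apply: (etrans (congr1 _ (tmapE _ _ lcut_antipode lid))).
    by rewrite multE cut_antipode1 mul1r.
  by rewrite e1 e2 eE; apply: cantipl.
pose L (z : H ⊗ H) : H := mult (tmap id cut_antipode z).
have mL : alg_morph L := alg_morph_comp (mult_alg_morph H) (tmap_alg_morph mid cut_antipode_morph).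
apply: (@char_coproduct_ext1 _ _ _ _ _ _ co_bas co_linear co_dual _ conv_swap conv_nat H L _ mL mE).
have e1 : L \o btreer = cantip phi f times0 btree.
  apply/funext => t; rewrite -cut_antipode_btree; apply: (etrans (congr1 _ (tmapE _ _ lid lcut_antipode))).
  by rewrite multE mul1r.
have e2 : L \o btreel = btree.
  apply/funext => t; apply: (etrans (congr1 _ (tmapE _ _ lid lcut_antipode))).
  by rewrite multE cut_antipode1 mulr1.
by rewrite e1 e2 eE; apply: cantipr.
Qed.

Lemma tree_char_ext2 (R R1 R2 : comAlgType K) (g : R1 -> R) (h : R2 -> R)
    (g' : H -> R1) (h' : H -> R2) :
  alg_morph g -> alg_morph h -> alg_morph g' -> alg_morph h' ->
  (forall t, g (g' (btree t)) = h (h' (btree t))) -> forall x, g (g' x) = h (h' x).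
Proof.
move=> mg mh mg' mh'.
exact: (tree_char_ext co_bas (alg_morph_comp mg mg') (alg_morph_comp mh mh')).
Qed.

Section Coaction.
Variable times : D -> D -> D.
Hypotheses (timesA : associative times) (timesC : commutative times).
Local Notation star := (fun R : comAlgType K => @cstar K D iota phi times R).
Let star_swap := cstar_swap exchC timesA timesC.
Let star_nat (R R' : comAlgType K) (g : R -> R') u v t (mg : alg_morph g) :
  g (star R u v t) = star R' (g \o u) (g \o v) t := cstar_nat phi times mg u v t.

Definition contraction_coproduct : H -> H ⊗ H := char_coproduct bas co star.
Definition contraction_counit : H -> K^o := char_counit co (@cedgeless K D iota).

Lemma contraction_coproduct_morph : alg_morph contraction_coproduct.
Proof. exact: char_coproduct_morph. Qed.

Lemma contraction_counit_morph : alg_morph contraction_counit.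
Proof. by apply: char_counit_morph => //; apply: edgeless_swap_inv. Qed.

Lemma contraction_coproduct_btree t : contraction_coproduct (btree t) = cstar phi times btreel btreer t.
Proof. exact: char_coproduct_btree. Qed.

Let lcontraction_coproduct : linear contraction_coproduct. Proof. by case: contraction_coproduct_morph. Qed.
Let contraction_coproduct1 : contraction_coproduct 1 = 1 ⊗ 1. Proof. by case: contraction_coproduct_morph. Qed.

Lemma con_bialgebra : is_bialgebra contraction_coproduct contraction_counit.
Proof.
apply: char_coproduct_bialgebra => //.
- by move=> R u v w; exact: (cstarA exchC exch_pentagon timesA timesC u v w).
- exact: edgeless_swap_inv.
- by move=> R u; rewrite cedgelessE; apply: star_edgelessl.
- by move=> R u; rewrite cedgelessE; apply: star_edgelessr.
Qed.

(** [inlr] and [inrr] keep the first factor and put the second one in the middle or in the last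
    place; on pure tensors, [m1_3_24] is the product of their values. *)
Let inlr (z : H ⊗ H) : H3 := tmap id (fun x : H => x ⊗ (1 : H)) z.

Let inlr_morph : alg_morph inlr.
Proof. exact: tmap_alg_morph (alg_morph_id H) (alg_morph_inl H H). Qed.

Let inrr (z : H ⊗ H) : H3 := tmap id (fun x : H => (1 : H) ⊗ x) z.

Let inrr_morph : alg_morph inrr.
Proof. exact: tmap_alg_morph (alg_morph_id H) (alg_morph_inr H H). Qed.

Let inlr1 : inlr (1 ⊗ 1) = 1. Proof. by case: inlr_morph. Qed.
Let inrr1 : inrr (1 ⊗ 1) = 1. Proof. by case: inrr_morph. Qed.

Let coact (z : H ⊗ H) : H3 := tensor_coaction contraction_coproduct contraction_coproduct z.

Let coactE x y : coact (x ⊗ y) = inlr (contraction_coproduct x) * inrr (contraction_coproduct y).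
Proof. by rewrite /coact /tensor_coaction tmapE // m1_3_24E. Qed.

Let coact_morph : alg_morph coact.
Proof.
exact: alg_morph_comp (m1_3_24_alg_morph H H H) (tmap_alg_morph contraction_coproduct_morph contraction_coproduct_morph).
Qed.

(** Multiplying the last two factors undoes both [inlr] and [inrr], so the claim becomes the
    multiplicativity of the contraction coproduct. *)
Lemma mult_colinear : comodule_morphism (tensor_coaction contraction_coproduct contraction_coproduct) contraction_coproduct (@mult K H).
Proof.
pose L (z : H3) : H ⊗ H := tmap id (@mult K H) z.
have mL : alg_morph L := tmap_alg_morph (alg_morph_id H) (mult_alg_morph H).
have [lm _ _] := mult_alg_morph H.
have LE (x : H) (z : H ⊗ H) : L (x ⊗ z) = x ⊗ mult z := tmapE x z lid lm.
have Lr (z : H ⊗ H) : L (inrr z) = z.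
  have [lc _ _] := alg_morph_comp mL inrr_morph; have [lt _ _] := alg_morph_inr H H.
  apply: (tensor_ext lc (@linear_id _ _)) => x y.
  apply: (etrans (congr1 L (tmapE x y lid lt))).
  by rewrite LE multE mul1r.
have Ll (z : H ⊗ H) : L (inlr z) = z.
  have [lc _ _] := alg_morph_comp mL inlr_morph; have [lt _ _] := alg_morph_inl H H.
  apply: (tensor_ext lc (@linear_id _ _)) => x y.
  apply: (etrans (congr1 L (tmapE x y lid lt))).
  by rewrite LE multE mulr1.
have [lc1 _ _] := alg_morph_comp contraction_coproduct_morph (mult_alg_morph H).
have [lc2 _ _] := alg_morph_comp mL coact_morph.
apply: (tensor_ext lc1 lc2) => x y; have [_ LM _] := mL; have [_ cM _] := contraction_coproduct_morph.
apply: (etrans (congr1 contraction_coproduct (multE x y))); apply: (etrans (cM x y)); apply/esym.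
apply: (etrans (congr1 L (coactE x y))); apply: (etrans (LM _ _)).
exact: (congr2 _ (Ll _) (Lr _)).
Qed.

Lemma unit_colinear :
  comodule_morphism (@unit_coaction K H) contraction_coproduct (fun k : K^o => (k : K) *: (1 : H)).
Proof.
move=> k; have lu : linear (fun k : K^o => (k : K) *: (1 : H)).
  by case: (in_alg_morph H).
rewrite (linZ lcontraction_coproduct) contraction_coproduct1 /unit_coaction tmapE //.
by have := linZ (tens_linr (V := H) (1 : H)) k 1 => /= ->.
Qed.

(** Both sides are algebra morphisms that vanish on trees, since [star] is zero when its second
    argument is. *)
Lemma counit_colinear :
  comodule_morphism contraction_coproduct (@unit_coaction K H) (cut_counit : H -> K^o).
Proof.
pose L (z : H ⊗ H) : H ⊗ K^o := tmap id cut_counit z.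
have mL : alg_morph L := tmap_alg_morph (alg_morph_id H) cut_counit_morph.
have mU : alg_morph (@unit_coaction K H \o cut_counit).
  exact: alg_morph_comp (alg_morph_inr H _) cut_counit_morph.
have z0 : (1 : H) ⊗ (0 : K^o) = 0 := lin0 (tens_linr (V := K^o) (1 : H)).
move=> x; apply/esym; move: x.
apply: (@char_coproduct_ext1 _ _ _ _ _ _ co_bas co_linear co_dual _ star_swap star_nat
  (H ⊗ K^o)%type L _ mL mU).
have e0 : (@unit_coaction K H \o cut_counit) \o btree = fun=> 0.
  by apply/funext => t; rewrite -[LHS]/((1 : H) ⊗ cut_counit (btree t)) cut_counit_btree; exact: z0.
have e1 : L \o btreer = fun=> 0.
  apply/funext => t; apply: (etrans (tmapE _ _ lid lcut_counit)).
  by rewrite cut_counit_btree; exact: z0.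
by rewrite e0 e1; apply: cstar0.
Qed.

(** In the triple tensor power, with its three inclusions of [H], this is the distributivity of
    [star j1] over [conv j2 j3]. *)
Lemma coproduct_colinear : comodule_morphism contraction_coproduct (tensor_coaction contraction_coproduct contraction_coproduct) cut_coproduct.
Proof.
pose M (z : H ⊗ H) : H3 := tmap id cut_coproduct z.
have mM : alg_morph M := tmap_alg_morph (alg_morph_id H) cut_coproduct_morph.
pose j1 (s : T) : H3 := btree s ⊗ 1.
pose j2 (s : T) : H3 := 1 ⊗ btreel s.
pose j3 (s : T) : H3 := 1 ⊗ btreer s.
pose J (z : H ⊗ H) : H3 := 1 ⊗ z.
have mJ : alg_morph J := alg_morph_inr H (H ⊗ H)%type.
have [linl _ _] := alg_morph_inl H H; have [linr _ _] := alg_morph_inr H H.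
have i1 : inlr \o btreel = j1 by apply/funext => s; apply: (tmapE _ _ lid linl).
have i2 : inlr \o btreer = j2 by apply/funext => s; apply: (tmapE _ _ lid linl).
have i3 : inrr \o btreel = j1 by apply/funext => s; apply: (tmapE _ _ lid linr).
have i4 : inrr \o btreer = j3 by apply/funext => s; apply: (tmapE _ _ lid linr).
have e1 : coact \o btreel = cstar phi times j1 j2.
  apply/funext => s; rewrite -i1 -i2 -(cstar_nat _ _ inlr_morph) -contraction_coproduct_btree.
  by apply: (etrans (coactE _ _)); rewrite contraction_coproduct1 inrr1 mulr1.
have e2 : coact \o btreer = cstar phi times j1 j3.
  apply/funext => s; rewrite -i3 -i4 -(cstar_nat _ _ inrr_morph) -contraction_coproduct_btree.
  by apply: (etrans (coactE _ _)); rewrite contraction_coproduct1 inlr1 mul1r.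
have e3 : M \o btreel = j1.
  by apply/funext => s; rewrite /M /= (tmapE _ _ lid lcut_coproduct) cut_coproduct1.
have e4 : M \o btreer = cconv phi f j2 j3.
  apply/funext => s; rewrite -[RHS]/(cconv phi f (J \o btreel) (J \o btreer) s).
  by rewrite -(cconv_nat _ _ mJ) -cut_coproduct_btree /M /= (tmapE _ _ lid lcut_coproduct).
suff e t : coact (cut_coproduct (btree t)) = M (contraction_coproduct (btree t)).
  exact_no_check (tree_char_ext2 coact_morph mM cut_coproduct_morph contraction_coproduct_morph e).
rewrite cut_coproduct_btree contraction_coproduct_btree (cconv_nat _ _ coact_morph) (cstar_nat _ _ mM).
rewrite e1 e2 e3 e4.
by rewrite (cstar_conv f exchC exch_pentagon timesA timesC).
Qed.

(** The antipode uses [times0] and the coaction uses [times]; on trees the claim is the identity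
    [cstar_antip] between them. *)
Lemma antipode_colinear : comodule_morphism contraction_coproduct contraction_coproduct cut_antipode.
Proof.
pose M (z : H ⊗ H) : H ⊗ H := tmap id cut_antipode z.
have mM : alg_morph M := tmap_alg_morph (alg_morph_id H) cut_antipode_morph.
pose J (x : H) : H ⊗ H := 1 ⊗ x.
have mJ : alg_morph J := alg_morph_inr H H.
apply: (tree_char_ext2 contraction_coproduct_morph mM cut_antipode_morph contraction_coproduct_morph) => t.
rewrite cut_antipode_btree contraction_coproduct_btree (cstar_nat _ _ mM) (cantip_nat _ _ _ contraction_coproduct_morph).
have e1 : M \o btreel = btreel.
  by apply/funext => s; apply: (etrans (tmapE _ _ lid lcut_antipode)); rewrite cut_antipode1.
have e2 : M \o btreer = cantip phi f times0 btreer.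
  apply/funext => s; apply: (etrans (tmapE _ _ lid lcut_antipode)).
  by rewrite cut_antipode_btree -[LHS]/(J _) (cantip_nat _ _ _ mJ).
have e3 : contraction_coproduct \o btree = cstar phi times btreel btreer by apply/funext => s; apply: contraction_coproduct_btree.
rewrite e1 e2 e3.
by rewrite (cstar_antip exchC exch_pentagon exch_f timesA0 timesC0 timesA timesC).
Qed.

Lemma cut_comodule_hopf : is_comodule_hopf_algebra contraction_coproduct contraction_counit cut_coproduct cut_counit cut_antipode contraction_coproduct.
Proof.
split; split; first exact: con_bialgebra.
- exact: cut_hopf.
- by have [[? ? _] _ _] := con_bialgebra.
- exact: mult_colinear.
- exact: unit_colinear.
- exact: coproduct_colinear.
- exact: counit_colinear.
- exact: antipode_colinear.
Qed.

End Coaction.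
End HopfAlgebra.

(** * Assembly of the theorem *)

Lemma linear_pack (K : fieldType) (U V : lmodType K) (g : U -> V) :
  linear g -> exists h : {linear U -> V}, (h : U -> V) = g.
Proof.
move=> lg; pose hl := GRing.isLinear.Build K U V *:%R g lg.
pose h : {linear U -> V} := HB.pack g hl.
by exists h.
Qed.

Lemma scalar_pack (K : fieldType) (U : lmodType K) (g : U -> K) :
  linear (g : U -> K^o) -> exists h : {scalar U}, (h : U -> K) = g.
Proof.
move=> lg; pose hl := GRing.isLinear.Build K U K *%R g lg.
pose h : {scalar U} := HB.pack g hl.
by exists h.
Qed.

(** The first assertion provides no product on [D], while the antipode is written with one: a
    constant product is associative and commutative on any inhabited set. *)
Lemma exists_comm_op (D : Type) :
  exists times : D -> D -> D, associative times /\ commutative times.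
Proof.
have [[d]|nD] := pselect (inhabited D).
  by exists (fun _ _ => d).
by exists (fun x _ => x); split=> // x; case: nD.
Qed.

Theorem theorem4p5 (K : fieldType) (charK : [pchar K] =i pred0)
    (A : vectType K) (Phi : {linear (A ⊗ A)%type -> (A ⊗ A)%type})
    (HPhi : dual_lCEDS Phi) (D : Type) (f : {scalar A})
    (Hf : tform f f \o Phi =1 tform f f) :
  exists (Delta : {linear SgAD A D -> (SgAD A D ⊗ SgAD A D)%type})
         (eps : {scalar SgAD A D}) (S : {linear SgAD A D -> SgAD A D}),
    [/\ is_cut_coproduct Phi f Delta,
        is_hopf_algebra Delta eps S
      & forall times : D -> D -> D, associative times -> commutative times ->
        exists (delta : {linear SgAD A D -> (SgAD A D ⊗ SgAD A D)%type})
               (epsB : {scalar SgAD A D}),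
          is_contraction_coproduct Phi times delta /\
          is_comodule_hopf_algebra delta epsB Delta eps S delta].
Proof.
pose bas (i : 'I_(\dim {:A})) : A := (vbasis {:A})`_i.
pose co (i : 'I_(\dim {:A})) (a : A) : K := coord (vbasis {:A}) i a.
have co_bas a : a = \sum_i co i a *: bas i by apply: coord_vbasis; apply: memvf.
have co_linear i : linear (co i : A -> K^o) by move=> k a b; apply: (linearP (coord (vbasis {:A}) i)).
have co_dual i j : co i (bas j) = (i == j)%:R.
  by rewrite /co /bas coord_free ?(basis_free (vbasisP _)) // eq_sym.
have lPhi : linear Phi by move=> k a b; apply: linearP.
have lf : linear (f : A -> K^o) by move=> k a b; apply: linearP.
pose phi := struct_const bas co Phi.
have Phi_bas := Phi_basE co_bas co_linear co_dual Phi.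
have exchC R := struct_const_commutes co_bas co_linear co_dual lPhi (R := R) HPhi.
have pent R := struct_const_pentagonal co_bas co_linear co_dual lPhi (R := R) HPhi.
have weight R := struct_const_preserves co_bas co_linear co_dual R lf Hf.
have [times0 [tA tC]] := exists_comm_op D.
have mD := cut_coproduct_morph bas co_linear (f \o bas) exchC tA tC.
have lD : linear (cut_coproduct bas co phi (f \o bas) : SgAD A D -> (SgAD A D ⊗ SgAD A D)%type).
  by case: mD.
have lE : linear (cut_counit co : SgAD A D -> K^o).
  by case: (@cut_counit_morph K A D _ co co_linear).
have lS : linear (cut_antipode bas co phi (f \o bas) times0 : SgAD A D -> SgAD A D).
  by case: (cut_antipode_morph bas co_linear (f \o bas) exchC tA tC).
have cut := cut_formula lPhi co_bas Phi_bas (exchC _) lf mD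
  (cut_coproduct_btree co_linear co_dual (f \o bas) exchC tA tC).
have hopf := cut_hopf co_bas co_linear co_dual exchC pent weight tA tC.
have coact times : associative times -> commutative times ->
    exists (delta : SgAD A D -> (SgAD A D ⊗ SgAD A D)%type) (epsB : SgAD A D -> K^o),
    [/\ linear delta, linear epsB, is_contraction_coproduct Phi times delta
      & is_comodule_hopf_algebra delta epsB (cut_coproduct bas co phi (f \o bas))
          (cut_counit co) (cut_antipode bas co phi (f \o bas) times0) delta].
  move=> timesA timesC; have md := contraction_coproduct_morph bas co_linear exchC timesA timesC.
  exists (contraction_coproduct bas co phi times), (contraction_counit co); split.
  - by case: md.
  - by case: (@contraction_counit_morph K A D _ co co_linear).
  - exact (contraction_formula lPhi co_bas Phi_bas (exchC _) timesA md
      (contraction_coproduct_btree co_linear co_dual exchC timesA timesC)).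
  - exact (cut_comodule_hopf co_bas co_linear co_dual exchC pent weight tA tC timesA timesC).
(* The maps are generalised before being bundled, so that the equations with the bundled maps can be
   substituted everywhere. *)
move: (cut_coproduct _ _ _ _) (cut_counit _) (cut_antipode _ _ _ _ _) lD lE lS cut hopf coact {mD} => g e s.
move=> /linear_pack[Delta eD] /scalar_pack[eps eE] /linear_pack[S eS].
subst g e s; move=> cut hopf coact.
exists Delta, eps, S; split; [exact cut|exact hopf|move=> times timesA timesC].
have [g [e [lg le con cmod]]] := coact _ timesA timesC.
have [delta ed] := linear_pack lg; have [epsB eb] := scalar_pack le.
subst g e.
exists delta, epsB; split; [exact con|exact cmod].
Qed.
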